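(* Feedback Vertex Set (given a graph $G$ on $n$ vertices and $k\in\mathbb{N}$, decide whether there is $S\subseteq V(G)$ with $|S|\le k$ such that $G-S$ is a forest) can be solved in time $(3k)^k \cdot n^{O(1)}$ using $O(k\log n)$ bits of auxiliary space.
   Context: Space model: the input is in read-only random-access memory, output is written to a write-only stream, and only auxiliary read-write memory is counted; words have $O(\log n)$ bits. *)

(* Defs.v *)
(* Mathematical Components. *)
From mathcomp Require Import all_boot.

Set Implicit Arguments.
Unset Strict Implicit.
Unset Printing Implicit Defensive.

(** * A word RAM with read-only input, auxiliary memory and write-only output *)

(* [word_size] is in bits; the auxiliary memory has [aux_words] cells of one
   word each, and [input] is the contents of the read-only memory. *)
Record machine := Machine {
  word_size : nat;
  aux_words : nat;
  input     : seq nat }.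

(* Subtraction is truncated; x / 0 = 0 and x mod 0 = x; the comparisons
   return 0 or 1. *)
Inductive binop := Add | Sub | Mul | Div | Mod | Lt | Eq.

Inductive expr :=
  | Cst of nat
  | Aux of expr              (* contents of an auxiliary cell *)
  | Inp of expr              (* contents of an input cell *)
  | Bin of binop & expr & expr.

Inductive cmd :=
  | Skip
  | Store of expr & expr     (* Store a e: auxiliary cell a receives e *)
  | Emit of expr             (* append a word to the output stream *)
  | Seq of cmd & cmd
  | If of expr & cmd & cmd
  | While of expr & cmd.

Definition binop_sem (o : binop) (x y : nat) : nat :=
  match o with
  | Add => x + y
  | Sub => x - y
  | Mul => x * y
  | Div => x %/ y
  | Mod => x %% y
  | Lt  => x < y
  | Eq  => x == y
  end.

Definition wrap (M : machine) (x : nat) : nat := x %% 2 ^ word_size M.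

(* Every intermediate value is a word. Auxiliary accesses outside the allotted
   memory are faults (None); input cells past the end of the input read as 0. *)
Fixpoint eval (M : machine) (m : nat -> nat) (e : expr) : option nat :=
  match e with
  | Cst v => Some (wrap M v)
  | Aux a =>
      if eval M m a is Some i then
        if i < aux_words M then Some (m i) else None
      else None
  | Inp a =>
      if eval M m a is Some i then Some (wrap M (nth 0 (input M) i)) else None
  | Bin o e1 e2 =>
      match eval M m e1, eval M m e2 with
      | Some x, Some y => Some (wrap M (binop_sem o x y))
      | _, _ => None
      end
  end.

Fixpoint expr_size (e : expr) : nat :=
  match e with
  | Cst _ => 1
  | Aux a | Inp a => (expr_size a).+1
  | Bin _ e1 e2 => (expr_size e1 + expr_size e2).+1
  end.

Fixpoint cmd_size (c : cmd) : nat :=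
  match c with
  | Skip => 1
  | Store a e => (expr_size a + expr_size e).+1
  | Emit e => (expr_size e).+1
  | Seq c1 c2 => (cmd_size c1 + cmd_size c2).+1
  | If e c1 c2 => (expr_size e + cmd_size c1 + cmd_size c2).+1
  | While e c => (expr_size e + cmd_size c).+1
  end.

(* Auxiliary memory and output written so far. Only the first [aux_words] cells
   can ever be accessed. *)
Definition state := ((nat -> nat) * seq nat)%type.

Definition upd (m : nat -> nat) (i v : nat) : nat -> nat :=
  fun j => if j == i then v else m j.

(* [exec M c s t s']: started in s, the program c halts without fault in s'
   after t steps; each operation occurring in an expression is one step. *)
Inductive exec (M : machine) : cmd -> state -> nat -> state -> Prop :=
  | ExecSkip s : exec M Skip s 1 s
  | ExecStore a e m o i v :
      eval M m a = Some i -> i < aux_words M -> eval M m e = Some v ->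
      exec M (Store a e) (m, o) (expr_size a + expr_size e).+1 (upd m i v, o)
  | ExecEmit e m o v :
      eval M m e = Some v ->
      exec M (Emit e) (m, o) (expr_size e).+1 (m, rcons o v)
  | ExecSeq c1 c2 s1 t1 s2 t2 s3 :
      exec M c1 s1 t1 s2 -> exec M c2 s2 t2 s3 ->
      exec M (Seq c1 c2) s1 (t1 + t2).+1 s3
  | ExecIf e c1 c2 s v t s' :
      eval M s.1 e = Some v ->
      exec M (if v != 0 then c1 else c2) s t s' ->
      exec M (If e c1 c2) s (expr_size e + t).+1 s'
  | ExecWhileStop e c s :
      eval M s.1 e = Some 0 ->
      exec M (While e c) s (expr_size e).+1 s
  | ExecWhileLoop e c s1 v t1 s2 t2 s3 :
      eval M s1.1 e = Some v -> v != 0 ->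
      exec M c s1 t1 s2 -> exec M (While e c) s2 t2 s3 ->
      exec M (While e c) s1 (expr_size e + t1 + t2).+1 s3.

(* The auxiliary memory is initially zero and the output stream empty. *)
Definition outputs_in_time (M : machine) (P : cmd) (o : seq nat) (t : nat) :=
  exists m : nat -> nat, exec M P (fun=> 0, [::]) t (m, o).

(* [cmd_size P] words, a constant for a fixed program, pay for the program
   counter and for the temporaries of expression evaluation. *)
Definition aux_bits (M : machine) (P : cmd) : nat :=
  (aux_words M + cmd_size P) * word_size M.

(** * Feedback vertex sets *)

(* [induced_forest e A]: the graph (T, e) induces a forest on A. The bound
   2 < size discards the closed walks x, y, x along an edge. *)
Definition induced_forest (T : finType) (e : rel T) (A : {set T}) : Prop :=
  forall p : seq T, {subset p <= A} -> ucycle e p -> ~~ (2 < size p).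

Definition feedback_vertex_set (T : finType) (e : rel T) (S : {set T}) : Prop :=
  induced_forest e (~: S).

Definition has_fvs (T : finType) (e : rel T) (k : nat) : Prop :=
  exists S : {set T}, #|S| <= k /\ feedback_vertex_set e S.

(* Binary digits of k, least significant first, without leading zeros; the digit
   d is written d + 1, so that the value 0 read past the end of the input marks
   the end of k. Digits are used because k may exceed any word of O(log n)
   bits. *)
Definition parameter_code (k : nat) : seq nat :=
  [seq (odd (k %/ 2 ^ i) : nat).+1 | i <- iota 0 (up_log 2 k.+1)].

(* n, then the adjacency matrix by rows, then k. *)
Definition fvs_input (n : nat) (e : rel 'I_n) (k : nat) : seq nat :=
  n :: [seq (e u v : nat) | u <- enum 'I_n, v <- enum 'I_n] ++ parameter_code k.

(* The base-2 logarithm rounded up, and 1 when n <= 1, so that a word always has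
   at least one bit. *)
Definition lg (n : nat) : nat := maxn 1 (up_log 2 n).

(* Main.v *)
Require Import Defs.
From mathcomp Require Import all_boot.
From mathcomp Require Import zify.

(* Iterative compression. The vertices are added one at a time; F is a feedback
   vertex set of the first i vertices with |F| <= k + 1, so that R, the other
   vertices below i, induces a forest, and a feedback vertex set Z with
   |Z| <= k is sought. The vertices are decided one by one, those of F first,
   then those of R in an order in which every vertex has at most one later
   neighbour in R. The set A of the vertices kept so far always induces a forest.
   Call a neighbour anchored if it is in A and its component of A meets F. A vertex
   of R with at most one anchored neighbour is kept, because deleting its later
   neighbour instead is at least as good; every other vertex is deleted or kept
   according to a guessed bit, and keeping a vertex that closes a cycle refutes
   the guess. Every bit accounts for a vertex of F, a deletion, or the merging of
   components of A that meet F, so at most 3k + 2 bits are used, and enumerating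
   all guesses multiplies the time by O(8^k).

   Only F, Z and the bits are stored. Connectivity in the forests A and R needs
   constantly many words: the walk that leaves a vertex v by the edge that follows,
   in cyclic order, the one by which it entered v visits the whole component. *)

Set Implicit Arguments.
Unset Strict Implicit.
Unset Printing Implicit Defensive.

(** * Forests, tours and the compression step *)

(** The obstacle is space: neither the kept set A nor the order of R fits in $O(k)$ words. Both are
    therefore functions of a single number. The tours of R from all n vertices, $n^2$ steps each,
    are concatenated; a vertex of R counts as decided when it has no visit below a threshold that
    sinks from $n^3$ to 0. Membership in A is recomputed from the threshold at every query, and
    tours of A run on top of such queries. The nesting is harmless: every bounded loop makes the
    same number $4n^3$ of iterations, so one attempt takes polynomial time, with a degree bounded by
    the length of the program text.

    Why an unanchored neighbour a of v is harmless: with R rooted by later neighbours, the kept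
    vertices that a can reach without v form a subtree hanging from v. A cycle through v that avoids
    the later neighbour of v has two neighbours of v in A, at least one of them unanchored, and it
    could leave the corresponding subtree only through v.

    The $8^k$ obtained is at most $3 (3k)^k$, since $8 \le 3k$ for $k \ge 3$ and the factor 3 covers
    smaller k. *)

Lemma sub_in_count (T : eqType) (s : seq T) (P Q : pred T) :
  {in s, forall x, P x -> Q x} -> count P s <= count Q s.
Proof.
move=> PQ; rewrite -!size_filter.
have -> : filter P s = filter P (filter Q s).
  rewrite -filter_predI; apply: eq_in_filter => x xs /=.
  by case Px: (P x); rewrite //= (PQ x).
by rewrite [leqLHS]size_filter count_size.
Qed.

Lemma sub_in_count_lt (T : eqType) (s : seq T) (P Q : pred T) x :
    {in s, forall y, P y -> Q y} -> x \in s -> Q x -> ~~ P x ->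
  count P s < count Q s.
Proof.
move=> PQ xs Qx NPx; have /(sub_in_count (s :=
  s)) : {in s, forall y, predU P (pred1 x) y -> Q y}.
  by move=> y ys /orP[/(PQ y ys)|/eqP->].
apply: leq_trans; rewrite -addn1 -(addn0 (count (predU _ _) s)).
have I0 : count (predI P (pred1 x)) s = 0.
  apply/eqP; rewrite -leqn0 leqNgt -has_count; apply/hasPn => y _ /=.
  by apply: contra NPx => /andP[Py /eqP<-].
rewrite -{2}I0 count_predUI leq_add2l -has_count.
by apply/hasP; exists x => /=.
Qed.

(** [undup] keeps the last occurrence of each element, which is its first occurrence in [rev s]; the
    two orders are therefore opposite. *)
Lemma index_undup_rev (T : eqType) (P : pred T) (s : seq T) x y :
    x \in s -> y \in s -> P x -> P y ->
    index x (filter P (undup s)) < index y (filter P (undup s)) ->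
  index y (rev s) < index x (rev s).
Proof.
elim: s => //= a s IHs; rewrite !inE rev_cons => xs ys Px Py.
rewrite -!cats1 !index_cat !mem_rev.
case: (boolP (a \in s)) => [as_|Nas] => [lt|].
  have xs' : x \in s by case/predU1P: xs => [->|].
  have ys' : y \in s by case/predU1P: ys => [->|].
  by rewrite xs' ys'; apply: IHs.
rewrite /=; case Pa: (P a) => /=; last first.
  have xs' : x \in s by case/predU1P: xs => // xa; rewrite -xa Px in Pa.
  have ys' : y \in s by case/predU1P: ys => // ya; rewrite -ya Py in Pa.
  by rewrite xs' ys'; apply: IHs.
case: (eqVneq a y) => [//|ay].
have ys' : y \in s by case/predU1P: ys => // ya; rewrite ya eqxx in ay.
case: (eqVneq a x) => [ax _|ax] /=.
  by rewrite ys' -ax (negbTE Nas) ltn_addr // index_mem mem_rev.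
have xs' : x \in s by case/predU1P: xs => // xa; rewrite xa eqxx in ax.
by rewrite xs' ys' ltnS; apply: IHs.
Qed.

(** * Induced forests and reachability inside a vertex set *)

Section Forest.

Variables (n : nat) (e : rel nat).
Hypothesis e_sym : symmetric e.
Hypothesis e_irr : irreflexive e.
Hypothesis e_lt : forall u v, e u v -> u < n.

Definition forest (A : pred nat) :=
  forall p, all A p -> ucycle e p -> size p <= 2.

Definition within (A : pred nat) : rel nat :=
  [rel u v | [&& A u, A v & e u v]].

Definition reach (A : pred nat) (a b : nat) : Prop :=
  exists2 p, path (within A) a p & last a p = b.

Lemma within_sym A : symmetric (within A).
Proof. by move=> u v; rewrite /within /= e_sym andbCA. Qed.

Lemma eq_within A B : A =1 B -> within A =2 within B.
Proof. by move=> AB u v; rewrite /within /= !AB. Qed.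

Lemma sub_forest A B : subpred A B -> forest B -> forest A.
Proof. by move=> AB fB p /(sub_all AB); apply: fB. Qed.

Lemma reach0 A a : reach A a a.
Proof. by exists [::]. Qed.

Lemma reach_ind A a (P : nat -> Prop) :
    P a -> (forall x y, P x -> within A x y -> P y) ->
  forall b, reach A a b -> P b.
Proof.
move=> Pa Pstep b [p]; elim: p a Pa => [|x p IHp] a Pa /=; first by move=> _ <-.
by case/andP=> ax xp; apply: IHp xp; apply: Pstep ax.
Qed.

Lemma reach_trans A b a c : reach A a b -> reach A b c -> reach A a c.
Proof.
move=> [p Hp <-] [q Hq <-]; exists (p ++ q); last by rewrite last_cat.
by rewrite cat_path Hp.
Qed.

Lemma reach1 A a b : within A a b -> reach A a b.
Proof. by move=> ab; exists [:: b]; rewrite //= ab. Qed.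

Lemma reach_sym A a b : reach A a b -> reach A b a.
Proof.
move: b; apply: reach_ind => [|x y xa xy]; first exact: reach0.
by apply: reach_trans xa; apply: reach1; rewrite within_sym.
Qed.

Lemma sub_within A B u v : subpred A B -> within A u v -> within B u v.
Proof. by move=> AB /and3P[Au Av uv]; rewrite /within /= !AB. Qed.

Lemma sub_reach A B a b : subpred A B -> reach A a b -> reach B a b.
Proof.
move=> AB; move: b; apply: reach_ind => [|x y ax xy]; first exact: reach0.
by apply: reach_trans ax _; apply: reach1; apply: sub_within xy.
Qed.

Lemma reach_in (A : pred nat) a b : A a -> reach A a b -> A b.
Proof. by move=> Aa; apply: (@reach_ind A a (fun x => A x)) => // x y _ /and3P[]. Qed.

Lemma path_within_all A a p : path (within A) a p -> all A p.
Proof.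
by elim: p a => //= x p IHp a /andP[/and3P[_ -> _] /IHp].
Qed.

Lemma path_within A a p : all A (a :: p) -> path e a p -> path (within A) a p.
Proof.
elim: p a => //= x p IHp a /and3P[Aa Ax Ap] /andP[ax xp].
by rewrite /within /= Aa Ax ax; apply: IHp; rewrite //= Ax.
Qed.

(** Shorten the walk to a simple path. If it still had an edge, it would close up with [v] to a
    cycle of length at least 3. *)
Lemma closed_walk_return A v w p :
    forest A -> path (within A) w p -> v \notin w :: p ->
    within A v w -> within A v (last w p) -> last w p = w.
Proof.
move=> fA wp; case/shortenP: wp => -[|x p'] //= wp' Up' sub vN vw vl.
have vN' : v \notin w :: x :: p'.
  apply: contra vN; rewrite in_cons => /predU1P[->|/sub vp].
    exact: mem_head.
  by rewrite in_cons vp orbT.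
have Aall : all A (v :: w :: x :: p').
  by have /and3P[Av Aw _] := vw; rewrite /= Av Aw;
    apply: (@path_within_all _ w (x :: p')).
suff cyc : cycle e (v :: w :: x :: p').
  have Uc : uniq (v :: w :: x :: p') by rewrite cons_uniq vN'.
  by have := fA _ Aall (introT andP (conj cyc Uc)).
have /and3P[_ _ vw_e] := vw; have /and3P[_ _] := vl; rewrite e_sym => lv_e.
rewrite [cycle _ _]/= vw_e rcons_path /= lv_e andbT.
case/andP: wp' => /and3P[_ _ ->] /=.
by apply: sub_path => a b /and3P[].
Qed.

(** On a cycle through [v], the two neighbours of [v] are joined by the rest of the cycle, which
    lies in [A]. The order [a < b] costs nothing by symmetry and matches the search in [conf]. *)
Lemma forest_add (A : pred nat) v :
    forest A -> ~~ A v ->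
    (forall a b, A a -> A b -> e v a -> e v b -> a < b -> ~ reach A a b) ->
  forest [pred x | (x == v) || A x].
Proof.
move=> fA NAv sep p Ap /andP[cp Up].
case: (boolP (v \in p)) => [vp|vNp]; last first.
  apply: fA; last by rewrite /ucycle cp.
  apply/allP=> x xp; have := allP Ap x xp; rewrite /= => /predU1P[xv|//].
  by rewrite -xv xp in vNp.
case: (rot_to vp) => i q def_q.
rewrite -(size_rot i) def_q.
have cq : cycle e (v :: q) by rewrite -def_q rot_cycle.
have Uq : uniq (v :: q) by rewrite -def_q rot_uniq.
have Aq : all A q.
  apply/allP=> x xq; have /(allP Ap) : x \in p.
    by rewrite -(mem_rot i) def_q inE xq orbT.
  by case/predU1P=> // xv; move: Uq; rewrite /= -xv xq.
case: q cq Uq Aq {def_q} => [|a [|b q]] //= cq Uq Aq.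
move: cq; rewrite rcons_path => /and4P[va ab bq lv].
have Aa : A a by case/andP: Aq.
have pabq : path (within A) a (b :: q).
  by apply: path_within; rewrite //= ab.
set l := last b q in lv.
have al : reach A a l by exists (b :: q).
have Al := reach_in Aa al.
have a_l : a != l.
  apply: contraL Uq => /eqP->; rewrite negb_and; apply/orP; right.
  by rewrite negb_and negbK mem_last.
case: (ltngtP a l) a_l => // al' _; exfalso.
  by apply: (sep a l) => //; rewrite e_sym.
by apply: (sep l a) => //; [rewrite e_sym | apply: reach_sym].
Qed.

Lemma forest_sep (A : pred nat) v a b :
    forest [pred x | (x == v) || A x] -> ~~ A v -> A a -> A b ->
    e v a -> e v b -> reach A a b -> a = b.
Proof.
move=> fA NAv Aa Ab va vb [p ap lp].
have sA : subpred A [pred x | (x == v) || A x] by move=> x Ax; rewrite /= Ax orbT.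
rewrite -lp; apply/esym/(closed_walk_return fA (v := v)).
- by apply: sub_path ap => x y; apply: sub_within.
- rewrite inE negb_or; apply/andP; split.
    by apply: contraNneq NAv => ->.
  by apply: contra NAv => /(allP (path_within_all ap)).
- by rewrite /within /= eqxx va Aa orbT.
- by rewrite lp /within /= eqxx vb Ab orbT.
Qed.

(** * Tours of a forest as a connectivity test in constantly many words *)

Section Tour.

Variable M : nat.
Hypothesis n_gt0 : 0 < n.
Hypothesis le_nM : n * n <= M.

(** The neighbour of [v] that follows [u] cyclically; [u] itself comes last, at [j = n - 1], so a
    leaf sends the walk back. The search runs to [M], not [n], because [M] stands for the iteration
    count shared by all bounded loops of the program. The value [v] marks an isolated vertex. *)
Definition next_nbr (A : pred nat) (v u : nat) : nat :=
  let w j := (u + 1 + j) %% n in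
  let j := find (fun j => within A v (w j)) (iota 0 M) in
  if j < M then w j else v.

Lemma cyclic_scan u w :
  u < n -> w < n -> exists2 j, j < n & (u + 1 + j) %% n = w.
Proof.
move=> un wn; case: (ltnP u w) => uw.
  by exists (w - u.+1); [lia | rewrite addn1 subnKC // modn_small].
exists (w + n - u.+1); first lia.
by rewrite addn1 subnKC ?modnDr ?modn_small //; lia.
Qed.

Lemma within_ltr A v w : within A v w -> w < n.
Proof. by case/and3P=> _ _; rewrite e_sym => /e_lt. Qed.

Lemma le_n_M : n <= M.
Proof. by apply: leq_trans le_nM; rewrite leq_pmulr. Qed.

Lemma next_nbr_some A v u w :
  u < n -> within A v w -> within A v (next_nbr A v u).
Proof.
move=> un vw; rewrite /next_nbr; set P := fun j => _; set j := find _ _.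
have hasP : has P (iota 0 M).
  have [j' j'n def_w] := cyclic_scan un (within_ltr vw).
  apply/hasP; exists j'; last by rewrite /P def_w.
  by rewrite mem_iota add0n (leq_trans j'n) ?le_n_M.
have jM : j < M by move: hasP; rewrite has_find size_iota.
by rewrite jM; move: (nth_find 0 hasP); rewrite nth_iota.
Qed.

Lemma next_nbr_none A v u :
  (forall w, ~~ within A v w) -> next_nbr A v u = v.
Proof.
move=> none; rewrite /next_nbr ifF //; apply/negbTE; rewrite -leqNgt.
rewrite -[X in X <= _](size_iota 0) leqNgt -has_find.
by apply/hasPn => j _; apply: none.
Qed.

Lemma next_nbr_lt A v u : v < n -> next_nbr A v u < n.
Proof. by move=> vn; rewrite /next_nbr; case: ifP => // _; rewrite ltn_pmod. Qed.

(** Repeated [next_nbr] meets every neighbour: by induction on the cyclic distance [j] from [u] to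
    [w], the next neighbour is either [w] or strictly closer to it. *)
Lemma next_nbr_transitive A v (C : nat -> Prop) u :
    u < n -> C u -> (forall u, C u -> C (next_nbr A v u)) ->
  forall w, within A v w -> C w.
Proof.
move=> un Cu Cnext w vw.
have [j jn def_w] := cyclic_scan un (within_ltr vw).
have: j < M := leq_trans jn le_n_M.
rewrite -def_w in vw *; clear def_w w jn un.
elim/ltn_ind: j u Cu vw => j IHj u Cu vw jM.
have := Cnext u Cu; rewrite /next_nbr.
set P := fun j => _; set i := find _ _.
have hasPj : has P (iota 0 M) by apply/hasP; exists j; rewrite ?mem_iota.
have iM : i < M by move: hasPj; rewrite has_find size_iota.
rewrite iM => Ci.
have ij : i <= j.
  rewrite leqNgt; apply/negP => ji.
  by have := before_find 0 ji; rewrite nth_iota // /P vw.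
case: (ltngtP i j) ij => // [lt_ij _|<- //].
have eq_w : ((u + 1 + i) %% n + 1 + (j - i.+1)) %% n = (u + 1 + j) %% n.
  by rewrite -addnA modnDml; congr (_ %% n); lia.
by rewrite -eq_w; apply: IHj => //; rewrite ?eq_w //; lia.
Qed.

(* The dart from u to v is the number u * n + v. *)
Definition tour_step (A : pred nat) (x : nat) : nat :=
  x %% n * n + next_nbr A (x %% n) (x %/ n).

(** The walk starts with the fictitious dart from [a] to [a], so no first edge has to be chosen; on
    an isolated vertex it stays put. *)
Definition tour (A : pred nat) (a j : nat) : nat :=
  iter j (tour_step A) (a * n + a) %% n.

Lemma dart_mod u v : v < n -> (u * n + v) %% n = v.
Proof. by move=> vn; rewrite modnMDl modn_small. Qed.

Lemma dart_div u v : v < n -> (u * n + v) %/ n = u.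
Proof. by move=> vn; rewrite divnMDl // divn_small ?addn0. Qed.

Lemma dart_lt u v : u < n -> v < n -> u * n + v < n * n.
Proof. by move=> un vn; nia. Qed.

Lemma tour_step_lt A x : x < n * n -> tour_step A x < n * n.
Proof. by move=> xn; apply: dart_lt; rewrite ?next_nbr_lt ?ltn_pmod. Qed.

Lemma iter_tour_lt A a j : a < n -> iter j (tour_step A) (a * n + a) < n * n.
Proof.
by move=> an; elim: j => [|j IHj] /=; [apply: dart_lt | apply: tour_step_lt].
Qed.

Lemma tour_lt A a j : tour A a j < n.
Proof. exact: ltn_pmod. Qed.

Lemma tour0 A a : a < n -> tour A a 0 = a.
Proof. exact: dart_mod. Qed.

Lemma tourS A a j : tour A a j.+1 =
  next_nbr A (tour A a j) (iter j (tour_step A) (a * n + a) %/ n).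
Proof. by rewrite {1}/tour iterS dart_mod ?next_nbr_lt ?tour_lt. Qed.

Lemma iter_tourS A a j :
  iter j.+1 (tour_step A) (a * n + a) = tour A a j * n + tour A a j.+1.
Proof. by rewrite tourS. Qed.

Lemma tour_stepP A a j : a < n ->
  tour A a j.+1 = tour A a j \/ within A (tour A a j) (tour A a j.+1).
Proof.
move=> an; rewrite tourS; set v := tour A a j; set u := _ %/ n.
have un : u < n by rewrite ltn_divLR // iter_tour_lt.
case: (ltnP (find (fun w => within A v w) (iota 0 n)) n) => [hn|hn].
  right; apply: (next_nbr_some (w := find (fun w => within A v w) (iota 0 n))) => //.
  have h : has (fun w => within A v w) (iota 0 n) by rewrite has_find size_iota.
  by move: (nth_find 0 h); rewrite nth_iota.
left; apply: next_nbr_none => w; apply/negP => vw.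
suff: has (fun w => within A v w) (iota 0 n) by rewrite has_find size_iota ltnNge hn.
by apply/hasP; exists w; rewrite // mem_iota (within_ltr vw).
Qed.

Lemma reach_tour A a j : a < n -> reach A a (tour A a j).
Proof.
move=> an; elim: j => [|j IHj]; first by rewrite tour0 //; apply: reach0.
case: (tour_stepP A j an) => [->//|tt]; exact: reach_trans IHj (reach1 tt).
Qed.

Lemma path_tour A a i m :
    (forall j, within A (tour A a j) (tour A a j.+1)) ->
  path (within A) (tour A a i) [seq tour A a j | j <- iota i.+1 m].
Proof. by move=> step; elim: m i => //= m IHm i; rewrite step IHm. Qed.

Lemma last_tour A a i m :
  last (tour A a i) [seq tour A a j | j <- iota i.+1 m] = tour A a (i + m).
Proof. by elim: m i => [|m IHm] i /=; rewrite ?addn0 // IHm addSnnS. Qed.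

Lemma iter_collision (T : Type) (f : T -> T) x i j :
  iter i f x = iter j f x -> forall t, iter (i + t) f x = iter (j + t) f x.
Proof. by move=> eq_ij t; rewrite ![_ + t]addnC !iterD eq_ij. Qed.

Lemma bounded_collision (f : nat -> nat) N :
  (forall i, f i < N) -> exists i j, [/\ i < j, j <= N & f i = f j].
Proof.
move=> fN; pose s := [seq f i | i <- iota 0 N.+1].
have: ~~ uniq s.
  apply/negP => Us.
  have: size s <= size (iota 0 N).
    by apply: uniq_leq_size => // _ /mapP[i _ ->]; rewrite mem_iota fN.
  by rewrite size_map !size_iota ltnn.
case/(uniqPn 0) => i [j [ij jN eq_f]]; move: jN eq_f.
rewrite size_map size_iota => jN.
have iN := ltn_trans ij jN.
rewrite !(nth_map 0) ?size_iota // !nth_iota // !add0n.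
by exists i, j.
Qed.

(** * The periodic part of a tour visits the whole component *)

Section Recurrent.

Variables (A : pred nat) (a i m : nat).
Hypothesis fA : forest A.
Hypothesis an : a < n.
Hypothesis step : forall j, within A (tour A a j) (tour A a j.+1).
Let x j := iter j (tour_step A) (a * n + a).
Hypothesis m_gt0 : 0 < m.
Hypothesis per : forall t, i <= t -> x (t + m) = x t.

Let tour_period t : i <= t -> tour A a (t + m) = tour A a t.
Proof. by move=> it; rewrite /tour -!/(x _) per. Qed.

(* The walk that leaves v by the edge vw first comes back to v by the same
   edge, because A is a forest. *)
Lemma tour_returns t :
  i <= t -> exists2 t', t < t' & x t'.+1 = tour A a t.+1 * n + tour A a t.
Proof.
move=> it; set v := tour A a t; set w := tour A a t.+1.
have vw : within A v w := step t.
(* Periodicity provides a return to [v]. Up to the first return the walk avoids [v], so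
   [closed_walk_return] applies to it. *)
have exs : exists s, tour A a (t.+1 + s) == v.
  by exists m.-1; rewrite addSnnS prednK // tour_period.
case: (ex_minnP exs) => -[|s] /eqP sv smin.
  by case/and3P: vw => _ _; rewrite /w -sv addn0 e_irr.
have Nv : v \notin w :: [seq tour A a j | j <- iota t.+2 s].
  apply/negP => vin; suff [s' s's /eqP/smin] : exists2 s', s' <= s & tour A a (t.+1
    + s') = v.
    by rewrite ltnNge s's.
  move: vin; rewrite inE => /predU1P[vE|/mapP[j]].
    by exists 0; rewrite ?addn0.
  rewrite mem_iota => /andP[tj js] vE; exists (j - t.+1); first lia.
  by rewrite subnKC // ltnW.
have lastv : within A v (tour A a (t.+1 + s)).
  by rewrite within_sym -sv addnS; apply: step.
have := closed_walk_return fA (path_tour t.+1 s step) Nv vw.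
rewrite last_tour => /(_ lastv) eq_w.
by exists (t.+1 + s); [rewrite leq_addr | rewrite /x iter_tourS eq_w -addnS sv].
Qed.

(** [C u] says that the dart from [u] to [v] is used after time [i]. Having arrived from [u], the
    walk leaves for the neighbour next after [u] and, by [tour_returns], comes back along that edge.
    So [C] is closed under [next_nbr] and holds for all neighbours of [v]. *)
Lemma tour_exhausts t w :
  i <= t -> within A (tour A a t) w -> exists2 t', i <= t' & tour A a t' = w.
Proof.
move=> it; set v := tour A a t.
pose C u := exists2 t', i <= t' & x t'.+1 = u * n + v.
suff sC : within A v w -> C w.
  move/sC=> [t' it' xt']; exists t' => //.
  have vn : v < n := tour_lt A a t.
  by move: xt'; rewrite /x iter_tourS => /(congr1 (divn^~ n));
    rewrite !dart_div ?tour_lt.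
(* The visit one period later certainly has a predecessor in the periodic part. *)
have C0 : C (tour A a (t + m).-1).
  exists (t + m).-1; first by lia.
  rewrite /x iter_tourS prednK ?addn_gt0 ?m_gt0 ?orbT //.
  by rewrite tour_period.
apply: (next_nbr_transitive _ C0) => [|u [t' it' xt']]; first exact: tour_lt.
have vn : v < n := tour_lt A a t.
have tv : tour A a t'.+1 = v by rewrite /tour -/(x _) xt' dart_mod.
have tw : tour A a t'.+2 = next_nbr A v u.
  by rewrite tourS -/(x _) xt' dart_div // tv.
have [t'' lt_t'' xt''] := tour_returns (leqW it').
by exists t''; [lia | rewrite xt'' tv tw].
Qed.

Lemma recurrent_covers b : reach A a b -> exists2 t, i <= t & tour A a t = b.
Proof.
move=> ab; have: reach A (tour A a i) b.
  exact: reach_trans (reach_sym (reach_tour A i an)) ab.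
move: b {ab}; apply: reach_ind => [|u v [t it <-] uv]; first by exists i.
exact: tour_exhausts uv.
Qed.

End Recurrent.

(** There are only $n^2$ darts, so a dart repeats within $n^2$ steps; from there on the walk is
    periodic and [recurrent_covers] applies. *)
Lemma tour_covers A a b : forest A -> a < n -> reach A a b ->
  exists2 j, j < n * n & tour A a j = b.
Proof.
move=> fA an ab; have [/hasP[w _ aw]|/hasPn none] :=
  boolP (has (within A a) (iota 0 n)); last first.
  case: ab => -[|x p] /=; first by move=> _ <-; exists 0;
    rewrite ?muln_gt0 ?n_gt0 ?tour0.
  case/andP=> ax; have := none x; rewrite mem_iota (within_ltr ax) ax.
  by move=> /(_ isT).
have step j : within A (tour A a j) (tour A a j.+1).
  have ex_nbr : exists w, within A (tour A a j) w.
    elim: j => [|j [w' IHj]]; first by exists w; rewrite tour0.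
    exists (tour A a j); rewrite within_sym tourS.
    by apply: next_nbr_some IHj; rewrite ltn_divLR // iter_tour_lt.
  case: ex_nbr => w' jw'; rewrite tourS.
  by apply: next_nbr_some jw'; rewrite ltn_divLR // iter_tour_lt.
have [i [j [ij jn eq_ij]]] :=
  bounded_collision (fun t => iter_tour_lt A t an).
have m0 : 0 < j - i by rewrite subn_gt0.
have per t : i <= t -> iter (t + (j - i)) (tour_step A) (a * n + a) =
                        iter t (tour_step A) (a * n + a).
  move=> it; have := iter_collision eq_ij (t - i); rewrite subnKC // => ->.
  by congr (iter _ _ _); lia.
have [t it <-] := recurrent_covers fA an step m0 per ab.
(* A visit at time [j] or later is moved back by whole periods until it lies below [j], hence below
   $n^2$. *)
elim/ltn_ind: t it => t IHt it; case: (ltnP t j) => [tj|jt].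
  by exists t => //; apply: leq_trans tj jn.
have lt_t : t - (j - i) < t by lia.
have [|t' t'n eq_t] := IHt _ lt_t; first lia.
exists t' => //; rewrite eq_t /tour -(per (t - (j - i))) ?subnK //; lia.
Qed.

Definition conn (A : pred nat) (a b : nat) : bool :=
  has (fun j => tour A a j == b) (iota 0 M).

Lemma connP A a b : forest A -> a < n -> reflect (reach A a b) (conn A a b).
Proof.
move=> fA an; apply: (iffP hasP) => [[j _ /eqP<-]|ab]; first exact: reach_tour.
have [j jn jb] := tour_covers fA an ab; exists j; last exact/eqP.
by rewrite mem_iota /= (leq_trans jn).
Qed.

(** * The tests applied to a vertex, and the count of components that meet F *)

Definition conf (A : pred nat) (v : nat) : bool :=
  has (fun a => has (fun b =>
    [&& a < b, A a, A b, e v a, e v b & conn A a b]) (iota 0 M)) (iota 0 M).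

(** For [a] in [A], this is being anchored in the sense of the overview. *)
Definition touch (F : seq nat) (A : pred nat) (a : nat) : bool :=
  has (fun f => [&& f \in F, A f & conn A a f]) (iota 0 M).

Definition branch (F : seq nat) (A : pred nat) (v : nat) : bool :=
  has (fun a => has (fun b =>
    [&& a < b, A a, A b, e v a, e v b, touch F A a & touch F A b])
    (iota 0 M)) (iota 0 M).

Lemma nbr_lt_M v a : e v a -> a < M.
Proof. by rewrite e_sym => /e_lt an; apply: leq_trans an le_n_M. Qed.

Lemma nbr_lt v a : e v a -> a < n.
Proof. by rewrite e_sym => /e_lt. Qed.

Lemma has_iotaI (P : pred nat) a : a < M -> P a -> has P (iota 0 M).
Proof. by move=> aM Pa; apply/hasP; exists a; rewrite ?mem_iota. Qed.

Lemma conf_add (A : pred nat) v : forest A -> ~~ A v -> ~~ conf A v ->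
  forest [pred x | (x == v) || A x].
Proof.
move=> fA NAv Ncf; apply: forest_add => // a b Aa Ab va vb ab rab.
move/negP: Ncf; apply; apply: (has_iotaI (nbr_lt_M va)).
apply: (has_iotaI (nbr_lt_M vb)); rewrite ab Aa Ab va vb.
by apply/connP; rewrite ?(nbr_lt va).
Qed.

Lemma conf_forest (A : pred nat) v :
    forest [pred x | (x == v) || A x] -> ~~ A v -> conf A v = false.
Proof.
move=> fA NAv; apply/negP => /hasP[a _ /hasP[b _]].
case/and5P=> ab Aa Ab va /andP[vb].
have fA' : forest A by apply: sub_forest fA => x Ax; rewrite /= Ax orbT.
move/connP => /(_ fA' (nbr_lt va)) rab.
by move: ab; rewrite (forest_sep fA NAv Aa Ab va vb rab) ltnn.
Qed.

Lemma touchP F A a : forest A -> a < n -> all (gtn n) F ->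
  reflect (exists f, [/\ f \in F, A f & reach A a f]) (touch F A a).
Proof.
move=> fA an Fn; apply: (iffP hasP) => [[f _ /and3P[Ff Af /connP]]|].
  by move=> /(_ fA an) af; exists f.
case=> f [Ff Af af]; exists f; last by rewrite Ff Af; apply/connP.
by rewrite mem_iota /= (leq_trans (allP Fn f Ff)) ?le_n_M.
Qed.

(** The kept set has a list description here and a threshold description in the program. They agree
    only pointwise, whence the congruence lemmas. *)
Lemma eq_next_nbr A1 A2 : A1 =1 A2 -> next_nbr A1 =2 next_nbr A2.
Proof.
move=> eqA v u; rewrite /next_nbr; set f1 := find _ _; set f2 := find _ _.
suff -> : f1 = f2 by [].
by apply: eq_find => j; apply: eq_within.
Qed.

Lemma eq_tour_step A1 A2 : A1 =1 A2 -> tour_step A1 =1 tour_step A2.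
Proof. by move=> eqA x; rewrite /tour_step (eq_next_nbr eqA). Qed.

Lemma eq_tour A1 A2 : A1 =1 A2 -> tour A1 =2 tour A2.
Proof.
by move=> eqA a j; rewrite /tour (eq_iter (eq_tour_step eqA)).
Qed.

Lemma eq_conn A1 A2 : A1 =1 A2 -> conn A1 =2 conn A2.
Proof.
by move=> eqA a b; apply: eq_has => j /=; rewrite (eq_tour eqA).
Qed.

Lemma eq_conf A1 A2 : A1 =1 A2 -> conf A1 =1 conf A2.
Proof.
move=> eqA v; apply: eq_has => a /=; apply: eq_has => b /=.
by rewrite !eqA (eq_conn eqA).
Qed.

Lemma eq_touch F A1 A2 : A1 =1 A2 -> touch F A1 =1 touch F A2.
Proof.
by move=> eqA a; apply: eq_has => f /=; rewrite !eqA (eq_conn eqA).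
Qed.

Lemma eq_branch F A1 A2 : A1 =1 A2 -> branch F A1 =1 branch F A2.
Proof.
move=> eqA v; apply: eq_has => a /=; apply: eq_has => b /=.
by rewrite !eqA !(eq_touch F eqA).
Qed.

(* One leader (the least vertex) per component of A that meets F. *)
Definition leader (F : seq nat) (A : pred nat) (x : nat) : bool :=
  A x && ~~ has (fun y => [&& A y, y < x & conn A y x]) F.

Lemma leaderP F A x : forest A -> all (gtn n) F -> x \in F ->
  reflect (A x /\ forall y, y \in F -> A y -> reach A y x -> x <= y)
          (leader F A x).
Proof.
move=> fA /allP Fn Fx; apply: (iffP andP) => -[Ax lx]; split=> //.
  move=> y Fy Ay yx; rewrite leqNgt; apply: contra lx => lt_yx.
  by apply/hasP; exists y; rewrite // Ay lt_yx; apply/connP => //; apply: Fn.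
apply/hasPn => y Fy; apply/negP => /and3P[Ay yx /connP].
by move=> /(_ fA (Fn y Fy)) /(lx y Fy Ay); rewrite leqNgt yx.
Qed.

Lemma leader_exists F A f : forest A -> all (gtn n) F -> f \in F -> A f ->
  exists x, [/\ x \in F, leader F A x & reach A x f].
Proof.
move=> fA Fn; elim/ltn_ind: f => f IHf Ff Af.
case: (boolP (leader F A f)) => [lf|]; first by exists f; split=> //; apply: reach0.
rewrite /leader Af negbK => /hasP[y Fy /and3P[Ay yf /connP]].
move=> /(_ fA (allP Fn y Fy)) r_yf; have [x [Fx lx xy]] := IHf y yf Fy Ay.
by exists x; split=> //; apply: reach_trans r_yf.
Qed.

Lemma leader_sub F (A B : pred nat) x : forest A -> forest B ->
    all (gtn n) F -> x \in F -> subpred A B -> A x -> leader F B x -> leader F A x.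
Proof.
move=> fA fB Fn Fx AB Ax /leaderP[]// Bx lx; apply/leaderP => //; split=> //.
by move=> y Fy Ay yx; apply: lx => //; [apply: AB | apply: sub_reach yx].
Qed.

Definition leaders F A := count (leader F A) F.

Lemma eq_leaders F A1 A2 : A1 =1 A2 -> leaders F A1 = leaders F A2.
Proof.
move=> eqA; apply: eq_count => x /=; rewrite /leader eqA.
by congr (_ && ~~ _); apply: eq_has => y /=; rewrite eqA (eq_conn eqA).
Qed.

(** Enlarging the set can only merge old components, so a new leader other than [v] was a leader
    before. *)
Lemma leaders_add F (A : pred nat) v : uniq F -> all (gtn n) F ->
    forest [pred x | (x == v) || A x] ->
  leaders F [pred x | (x == v) || A x] <= leaders F A + (v \in F).
Proof.
move=> UF Fn fB; have AB : subpred A [pred x | (x == v) || A x].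
  by move=> x Ax; rewrite /= Ax orbT.
have fA := sub_forest AB fB.
rewrite /leaders -(count_uniq_mem v UF).
have sub : {in F, forall x, leader F [pred x | (x == v) || A x] x ->
                      predU (leader F A) (pred1 v) x}.
  move=> x Fx lx /=; case: eqP => [|/eqP xv]; rewrite ?orbT ?orbF //.
  have Ax : A x by case/andP: lx => /=; rewrite (negbTE xv).
  exact: leader_sub lx.
apply: leq_trans (sub_in_count sub) _.
by rewrite -[leqRHS]count_predUI leq_addr.
Qed.

(** The two anchored neighbours lie in different components, since [v] closes no cycle. Adding [v]
    joins these components, and the larger of their two leaders loses its role. *)
Lemma leaders_branch F (A : pred nat) v : all (gtn n) F ->
    forest [pred x | (x == v) || A x] -> v \notin F -> ~~ A v ->
    branch F A v ->
  leaders F [pred x | (x == v) || A x] < leaders F A.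
Proof.
set B : pred nat := [pred x | (x == v) || A x] => Fn fB NFv NAv.
have AB : subpred A B by move=> x Ax; apply/orP; right.
have fA := sub_forest AB fB.
case/hasP=> a _ /hasP[b _ /and5P[ab Aa Ab va /and3P[vb]]].
case/(touchP fA (nbr_lt va) Fn)=> f [Ff Af af].
case/(touchP fA (nbr_lt vb) Fn)=> g [Fg Ag bg].
have [x [Fx lx xf]] := leader_exists fA Fn Ff Af.
have [y [Fy ly yg]] := leader_exists fA Fn Fg Ag.
have [Ax _] := leaderP fA Fn Fx lx.
have [Ay _] := leaderP fA Fn Fy ly.
have xa : reach A x a by apply: reach_trans xf (reach_sym af).
have yb : reach A y b by apply: reach_trans yg (reach_sym bg).
have Nxy : ~ reach A x y.
  move=> xy; have ab' : reach A a b.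
    exact: reach_trans (reach_sym xa) (reach_trans xy yb).
  by move: ab; rewrite (forest_sep fB NAv Aa Ab va vb ab') ltnn.
have Bv : B v by apply/orP; left.
have xyB : reach B x y.
  apply: reach_trans (sub_reach AB xa) _.
  apply: reach_trans (reach_sym (sub_reach AB yb)).
  apply: (@reach_trans _ v); apply: reach1.
    by apply/and3P; split=> //; [apply: AB | rewrite e_sym].
  by apply/and3P; split=> //; apply: AB.
have sub : {in F, forall z, leader F B z -> leader F A z}.
  move=> z Fz lz; have Az : A z.
    case/andP: lz => /orP[/eqP zv|//] _.
    by move: NFv; rewrite -zv Fz.
  exact: leader_sub lz.
have [xy|yx|xy] := ltngtP x y.
- apply: (sub_in_count_lt sub Fy ly); apply/negP => /leaderP[]// _.
  by move=> /(_ x Fx (AB _ Ax) xyB); rewrite leqNgt xy.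
- apply: (sub_in_count_lt sub Fx lx); apply/negP => /leaderP[]// _.
  by move=> /(_ y Fy (AB _ Ay) (reach_sym xyB)); rewrite leqNgt yx.
- by case: Nxy; rewrite xy; apply: reach0.
Qed.

(** * One attempt with fixed guesses, and its soundness *)

Definition kept (done Z : seq nat) : pred nat :=
  [pred u | (u \in done) && (u \notin Z)].

(* The vertices chosen for deletion, the number of guessed bits already used,
   and whether the guess has been refuted. *)
Definition guess_state := (seq nat * nat * bool)%type.

(** A set bit means deletion. A refuted attempt runs on, possibly with a cycle in the kept set; this
    is harmless because the flag is never lowered. *)
Definition process (k : nat) (bits : nat -> bool) (F : seq nat) (A : pred nat)
    (v : nat) (st : guess_state) : guess_state :=
  let: (Z, b, fl) := st in
  let br := (v \in F) || branch F A v in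
  let b' := b + br in
  if br && bits b then
    if size Z < k then (rcons Z v, b', fl) else (Z, b', true)
  else (Z, b', fl || conf A v).

Fixpoint attempt (k : nat) (bits : nat -> bool) (F done rest : seq nat)
    (st : guess_state) : guess_state :=
  if rest is v :: rest' then
    attempt k bits F (rcons done v) rest'
      (process k bits F (kept done st.1.1) v st)
  else st.

Lemma attempt_fail k bits F done rest (st : guess_state) :
  st.2 -> (attempt k bits F done rest st).2.
Proof.
elim: rest done st => //= v rest IHr done [[Z b] fl] /= flT; apply: IHr.
by rewrite /process flT; case: ifP => //; case: ifP.
Qed.

Lemma attempt_cat k bits F done r1 r2 st :
  attempt k bits F done (r1 ++ r2) st =
  attempt k bits F (done ++ r1) r2 (attempt k bits F done r1 st).
Proof.
elim: r1 done st => [|v r1 IHr] done st /=; first by rewrite cats0.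
by rewrite IHr cat_rcons.
Qed.

Lemma kept_rcons done Z v : v \notin Z ->
  kept (rcons done v) Z =1 [pred x | (x == v) || kept done Z x].
Proof.
by move=> NZv x; rewrite /kept /= mem_rcons in_cons; case: eqP => [->|].
Qed.

Lemma kept_delete done Z v : v \notin done ->
  kept (rcons done v) (rcons Z v) =1 kept done Z.
Proof.
move=> Nv x; rewrite /kept /= !mem_rcons !in_cons negb_or.
by case: eqP => [->|] //=; rewrite (negbTE Nv).
Qed.

Lemma eq_forest A B : A =1 B -> forest A -> forest B.
Proof. by move=> AB; apply: sub_forest => x; rewrite AB. Qed.

(** Independent of how good the guesses are: without refutation every kept vertex has passed [conf]
    and every deletion was within the budget. *)
Lemma attempt_sound k bits (F done rest Z : seq nat) b :
    uniq (done ++ rest) -> {subset Z <= done} -> uniq Z -> size Z <= k ->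
    forest (kept done Z) ->
    ~~ (attempt k bits F done rest (Z, b, false)).2 ->
  exists Z' b', [/\ attempt k bits F done rest (Z, b, false) = (Z', b', false),
    uniq Z', size Z' <= k, {subset Z' <= done ++ rest} &
    forest (kept (done ++ rest) Z')].
Proof.
elim: rest done Z b => [|v rest IHr] done Z b /=.
  by rewrite cats0 => _ Zd UZ Zk fZ _; exists Z, b.
move=> U Zd UZ Zk fZ.
have Nv : v \notin done.
  by move: U; rewrite cat_uniq /= negb_or => /and3P[_ /andP[]].
have NZv : v \notin Z by apply: contra Nv => /Zd.
rewrite -cat_rcons in U *.
case: ifP => _; last first.
  case: (boolP (conf _ v)) => [_|Ncf]; first by rewrite attempt_fail.
  apply: IHr => //; first by move=> x /Zd xd; rewrite mem_rcons in_cons xd orbT.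
  apply: eq_forest (conf_add fZ _ Ncf) => [x|]; first by rewrite kept_rcons.
  by rewrite /kept /= (negbTE Nv).
case: ifP => [Zk'|_]; last by rewrite attempt_fail.
apply: IHr => //.
- by move=> x; rewrite !mem_rcons !in_cons => /predU1P[->|/Zd->]; rewrite ?eqxx ?orbT.
- by rewrite rcons_uniq NZv.
- by rewrite size_rcons.
- by apply: eq_forest fZ => x; rewrite kept_delete.
Qed.

(** * The exchange argument for vertices kept without a guess *)

Section Exchange.

Variables (F vs done rest : seq nat) (v : nat) (Z0 : seq nat).
Hypothesis def_vs : done ++ v :: rest = vs.
Hypothesis U : uniq vs.
Hypothesis vsn : all (gtn n) vs.
Hypothesis Fvs : {subset F <= done}.
Hypothesis later_nbr : forall y z1 z2,
  y \in vs -> y \notin F -> z1 \in vs -> z1 \notin F ->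
  z2 \in vs -> z2 \notin F ->
  e y z1 -> e y z2 -> index y vs < index z1 vs -> index y vs < index z2 vs ->
  z1 = z2.
Hypothesis UZ0 : uniq Z0.
Hypothesis fZ0 : forest (kept vs Z0).
Hypothesis vZ0 : v \in Z0.
Hypothesis Nbr : ~~ branch F (kept done Z0) v.

Let A := kept done Z0.

Let index_done x : x \in vs -> (x \in done) = (index x vs < index v vs).
Proof.
move: U; rewrite -def_vs cat_uniq => /and3P[_ Nd _] xvs.
have Nvd : v \notin done.
  by apply: contra Nd => vd; rewrite /= vd.
rewrite !index_cat (negbTE Nvd) /= eqxx addn0.
case: ifP => [xd|_]; first by rewrite index_mem xd.
by rewrite ltnNge leq_addr.
Qed.

Let v_vs : v \in vs.
Proof. by rewrite -def_vs mem_cat mem_head orbT. Qed.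

Let done_vs x : x \in done -> x \in vs.
Proof. by rewrite -def_vs mem_cat => ->. Qed.

Let Nvd : v \notin done.
Proof. by rewrite index_done // ltnn. Qed.

Let NvF : v \notin F.
Proof. by apply: contra Nvd => /Fvs. Qed.

Let fA : forest A.
Proof. by apply: sub_forest fZ0 => x /andP[/done_vs xd xZ]; apply/andP. Qed.

Let Fn : all (gtn n) F.
Proof. by apply/allP => x /Fvs/done_vs/(allP vsn). Qed.

Section Separation.

Variables (X : seq nat) (a b : nat).
Let B : pred nat := [pred x | (x \notin X) && kept vs Z0 x].
Hypotheses (Aa : A a) (va : e v a) (vb : e v b) (ab : a != b).
Hypothesis Na : ~~ touch F A a.

(* The vertices below a, the forest being rooted by the later neighbours. *)
Inductive below : nat -> Prop :=
  | below0 : below a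
  | belowS y z : below y -> A z -> z \notin F -> e y z ->
      index z vs < index y vs -> below z.

Let below_reach y : below y -> A y /\ reach A a y.
Proof.
elim=> [|x z _ [Ax ax] Az NFz xz _]; first by split=> //; apply: reach0.
by split=> //; apply: reach_trans ax (reach1 _); apply/and3P.
Qed.

Let reach_NF y : A y -> reach A a y -> y \notin F.
Proof.
move=> Ay ay; apply: contra Na => Fy.
by apply/(touchP fA (nbr_lt va) Fn); exists y.
Qed.

Let below_vs y : below y -> [/\ A y, y \in vs, y \in done & y \notin F].
Proof.
move=> /below_reach[Ay ay]; split=> //; last exact: reach_NF.
  by case/andP: Ay => /done_vs.
by case/andP: Ay.
Qed.

Let below_later y z :
    below y -> e y z -> z \in vs -> z \notin F -> index y vs < index z vs ->
  z = v \/ below z.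
Proof.
move=> by_y; have [Ay yvs yd NFy] := below_vs by_y.
case: by_y Ay yvs yd NFy => [|x {}y bx Ay NFy xy lt_yx] Ay' yvs yd _ yz zvs NFz lt_yz.
  left; apply: (later_nbr (y := a)) => //.
  - by apply: reach_NF => //; apply: reach0.
  - by rewrite e_sym.
  - by rewrite -index_done.
right; have [Ax xvs _ NFx] := below_vs bx.
by rewrite (later_nbr (y := y) (z1 := z) (z2 := x)) // e_sym.
Qed.

(** The vertices below [a] are closed under adjacency in [B]. An earlier neighbour is again below
    [a]; a later one is the unique later neighbour, which is already below [a] or is the deleted
    [v]; a neighbour in [F] would anchor [a]. If [b] were below [a], its unique later neighbour
    would be [v] and also a vertex below [a], although everything below [a] precedes [v]. *)
Lemma exchange_separated : ~ reach B a b.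
Proof.
have Nv_below : ~ below v by move=> /below_vs[_ _]; rewrite (negbTE Nvd).
have Bv x : B x -> x \in vs /\ x \notin Z0 by case/and3P.
move=> rab; suff bb : below b.
  have [_ bvs bd NFb] := below_vs bb.
  have bv : index b vs < index v vs by rewrite -index_done.
  have [ab' vb'] := (ab, vb).
  case: bb ab' bvs bd NFb vb' bv => [|x y bx Ay NFy xy lt_yx]; first by rewrite eqxx.
  move=> _ yvs yd _ vy lt_yv; have [Ax xvs xd NFx] := below_vs bx.
  apply: Nv_below; rewrite (later_nbr (y := y) (z1 := v) (z2 := x)) //.
    by rewrite e_sym.
  by rewrite e_sym.
apply: (reach_ind _ _ rab) => [|y z by_y yz]; first exact: below0.
have [Ay yvs yd NFy] := below_vs by_y.
have [_ ay] := below_reach by_y.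
case/and3P: yz => _ Bz yz; have [zvs NZ0z] := Bv z Bz.
have Az : z \in done -> A z by rewrite /A /kept /= NZ0z => ->.
have NFz : z \notin F.
  apply/negP => Fz; have Az' := Az (Fvs Fz).
  have az : reach A a z.
    by apply: reach_trans ay (reach1 _); apply/and3P.
  by move: (reach_NF Az' az); rewrite Fz.
case: (ltngtP (index z vs) (index y vs)) => [zy|yz_lt|eq_i].
- by apply: (belowS by_y) => //; apply: Az;
    rewrite index_done // (ltn_trans zy) // -index_done.
- case: (below_later by_y yz zvs NFz yz_lt) => // zv.
  by move: NZ0z; rewrite zv vZ0.
- have zy : z = y by rewrite -(nth_index 0 zvs) eq_i nth_index.
  by rewrite zy e_irr in yz.
Qed.

End Separation.

(** [Z1] trades [v] for its later neighbour, if there is one. A new cycle would use two kept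
    neighbours of [v]; both are already decided, and as they are not both anchored,
    [exchange_separated] keeps them apart. *)
Lemma exchange : exists Z1, [/\ uniq Z1, size Z1 <= size Z0,
  forest (kept vs Z1), v \notin Z1 & {in done, Z1 =i Z0}].
Proof.
have [X [X1 Xrest X_nbr]] : exists X : seq nat, [/\ size X <= 1,
    {subset X <= rest} & forall x, x \in rest -> e v x -> x \in X].
  case: (boolP (has (e v) rest)) => [/hasP[x xr vx]|/hasPn none]; last first.
    by exists [::]; split=> // x /none; case: (e v x).
  have rest_later z : z \in rest -> [/\ z \in vs, z \notin F & index v vs < index z vs].
    move=> zr; have zvs : z \in vs by rewrite -def_vs mem_cat in_cons zr !orbT.
    have Nzd : z \notin done.
      apply/negP => zd; move: U; rewrite -def_vs cat_uniq => /and3P[_ /hasPn Nd _].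
      by have := Nd z; rewrite in_cons zr orbT zd => /(_ isT).
    split=> //; first by apply: contra Nzd => /Fvs.
    rewrite ltn_neqAle leqNgt -index_done // Nzd andbT.
    apply: contraTneq zr => eq_i.
    have -> : z = v by rewrite -(nth_index 0 zvs) -eq_i nth_index.
    by move: U; rewrite -def_vs cat_uniq => /and3P[_ _ /= /andP[]].
  exists [:: x]; split=> // [z|z zr vz]; first by rewrite mem_seq1 => /eqP->.
  have [xvs NFx lt_x] := rest_later x xr; have [zvs NFz lt_z] := rest_later z zr.
  by rewrite mem_seq1 (later_nbr (y := v) (z1 := z) (z2 := x)).
(* [undup] because the later neighbour may already belong to [Z0]. *)
exists (undup (X ++ rem v Z0)); split; first exact: undup_uniq.
- apply: leq_trans (size_undup _) _; rewrite size_cat size_rem //.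
  case: Z0 vZ0 => // z Z _ /=; lia.
- pose B : pred nat := [pred x | (x \notin X) && kept vs Z0 x].
  have fB : forest B by apply: sub_forest fZ0 => x /andP[].
  suff : forest [pred x | (x == v) || B x].
    apply: sub_forest => x /andP[xvs]; rewrite mem_undup mem_cat negb_or.
    case/andP=> NXx; rewrite mem_rem_uniq // !inE negb_and negbK => xZ.
    by rewrite /B /kept /= NXx xvs.
  apply: forest_add => //; first by rewrite /B /kept /= vZ0 !andbF.
  move=> a b Ba Bb va vb lt_ab rab.
  have BA x : B x -> e v x -> A x.
    case/and3P=> NXx xvs NZ0x vx; apply/andP; split=> //.
    move: xvs; rewrite -def_vs mem_cat in_cons => /or3P[//|/eqP xv|xr].
      by move: vx; rewrite xv e_irr.
    by move: NXx; rewrite X_nbr.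
  have Aa := BA a Ba va; have Ab := BA b Bb vb.
  have ab : a != b by rewrite neq_ltn lt_ab.
  have /nandP[Na|Nb] : ~~ (touch F A a && touch F A b).
  + apply: contra Nbr => tt; apply: (has_iotaI (nbr_lt_M va)).
    by apply: (has_iotaI (nbr_lt_M vb)); rewrite -/A lt_ab Aa Ab va vb.
  + exact: (exchange_separated Aa va vb ab Na rab).
  + apply: (exchange_separated Ab vb va _ Nb (reach_sym rab)).
    by rewrite eq_sym.
- rewrite mem_undup mem_cat negb_or mem_rem_uniqF // andbT.
  apply/negP => /Xrest vr; move: U; rewrite -def_vs cat_uniq.
  by case/and3P=> _ _ /= /andP[]; rewrite vr.
- move=> x xd; rewrite mem_undup mem_cat mem_rem_uniq // inE.
  have -> : x \in X = false.
    apply/negP => /Xrest xr; move: U; rewrite -def_vs cat_uniq.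
    case/and3P=> _ /hasPn/(_ x); rewrite in_cons xr orbT xd.
    by move=> /(_ isT).
  by rewrite /=; case: eqP => // xv; move: Nvd; rewrite -xv xd.
Qed.

End Exchange.

(** * Completeness of the guessing, with the number of bits *)

(** [Z0] is a solution that agrees with the decisions made so far; it is modified by [exchange] when
    the rule keeps one of its vertices. Each bit lowers the bound: a vertex of [F] has two units,
    one for its bit and one for the leader it may create; a deletion uses up budget; a vertex
    outside [F] that is kept after branching destroys a leader. Bits are read from offset [b] on, so
    the list can be built from the front. *)
Lemma attempt_complete k (F ord rest done Z Z0 : seq nat) :
    let vs := F ++ ord in
    done ++ rest = vs -> uniq vs -> all (gtn n) vs ->
    (forall y z1 z2, y \in vs -> y \notin F -> z1 \in vs -> z1 \notin F ->
       z2 \in vs -> z2 \notin F -> e y z1 -> e y z2 ->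
       index y vs < index z1 vs -> index y vs < index z2 vs -> z1 = z2) ->
    {subset Z <= done} -> uniq Z -> {in done, Z0 =i Z} ->
    uniq Z0 -> size Z0 <= k -> forest (kept vs Z0) ->
  exists2 bs : seq bool,
    size bs <= 2 * count [in F] rest + (k - size Z) + leaders F (kept done Z) &
    forall bits b, (forall j, j < size bs -> bits (b + j) = nth false bs j) ->
      (attempt k bits F done rest (Z, b, false)).2 = false.
Proof.
move=> vs def_vs U vsn later;
  elim: rest done Z Z0 def_vs => [|v rest IHr] done Z Z0 def_vs Zd UZ eqZ UZ0 Z0k fZ0.
  by exists [::].
have UF : uniq F by move: U; rewrite cat_uniq => /and3P[].
have Fn : all (gtn n) F by move: vsn; rewrite all_cat => /andP[].
have Nvd : v \notin done.
  by move: U; rewrite -def_vs cat_uniq /= negb_or => /and3P[_ /andP[]].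
have NvZ : v \notin Z by apply: contra Nvd => /Zd.
have vvs : v \in vs by rewrite -def_vs mem_cat mem_head orbT.
have done_vs x : x \in done -> x \in vs by rewrite -def_vs mem_cat => ->.
have def_vs' : rcons done v ++ rest = vs by rewrite cat_rcons.
have ZZ0 : {subset Z <= Z0} by move=> x xZ; rewrite eqZ ?Zd.
have A_Z0 : kept done Z =1 kept done Z0.
  by move=> x; rewrite /kept /=; case xd: (x \in done); rewrite //= eqZ.
pose B : pred nat := [pred x | (x == v) || kept done Z x].
have NAv : ~~ kept done Z v by rewrite /kept /= (negbTE Nvd).
have sub_cases Z1 : v \notin Z1 -> {in done, Z1 =i Z} ->
    [/\ {subset Z <= rcons done v}, {in rcons done v, Z1 =i Z} &
        subpred B (kept vs Z1)].
  move=> NZv eqZ1; split=> [x /Zd xd|x|x]; first by rewrite mem_rcons in_cons xd orbT.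
    rewrite mem_rcons in_cons => /predU1P[->|/eqZ1//].
    by rewrite (negbTE NZv) (negbTE NvZ).
  case/predU1P=> [->|/andP[xd NZx]]; first by apply/andP.
  by apply/andP; rewrite eqZ1 ?done_vs.
have kept_v : kept (rcons done v) Z =1 B by apply: kept_rcons.
case: (boolP ((v \in F) || branch F (kept done Z) v)) => [br|/norP[NFv Nbr]];
  last first.
  have [Z1 [UZ1 Z1k fZ1 NZ1v eqZ1]] : exists Z1, [/\ uniq Z1, size Z1 <= k,
      forest (kept vs Z1), v \notin Z1 & {in done, Z1 =i Z}].
    case: (boolP (v \in Z0)) => [vZ0|NZ0v]; last by exists Z0.
    (* [F] is a prefix of [vs], so all of it is decided before any vertex outside [F] comes up. *)
    have Fdone : {subset F <= done}.
      move=> f Ff; have : index f vs < size done.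
        apply: (@leq_trans (index v vs)).
          rewrite !index_cat Ff (negbTE NFv).
          by apply: leq_trans (leq_addr _ _); rewrite index_mem.
        by rewrite -def_vs index_cat (negbTE Nvd) /= eqxx addn0.
      rewrite -def_vs index_cat; case: ifP => // _.
      by rewrite ltnNge leq_addr.
    have Nbr0 : ~~ branch F (kept done Z0) v by rewrite -(eq_branch F A_Z0).
    have [Z1 [UZ1 Z1k fZ1 NZ1v eqZ1]] :=
      exchange def_vs U vsn Fdone later UZ0 fZ0 vZ0 Nbr0.
    exists Z1; split=> //; first exact: leq_trans Z0k.
    by move=> x xd; rewrite eqZ1 // eqZ.
  have [Zd' eqZ1' sB] := sub_cases Z1 NZ1v eqZ1.
  have fB : forest B := sub_forest sB fZ1.
  have [bs szbs run] := IHr _ _ _ def_vs' Zd' UZ eqZ1' UZ1 Z1k fZ1.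
  exists bs.
    apply: leq_trans szbs _; rewrite (@eq_leaders F _ B) //= (negbTE NFv) add0n.
    by rewrite leq_add2l; have := leaders_add UF Fn fB; rewrite (negbTE NFv) addn0.
  move=> bits b eqb; rewrite /= /process (negbTE NFv) (negbTE Nbr) /= addn0.
  by rewrite conf_forest //; apply: run.
case: (boolP (v \in Z0)) => [vZ0|NZ0v].
  have Zd' : {subset rcons Z v <= rcons done v}.
    by move=> x; rewrite !mem_rcons !in_cons => /predU1P[->|/Zd->]; rewrite ?eqxx ?orbT.
  have UZ' : uniq (rcons Z v) by rewrite rcons_uniq NvZ.
  have eqZ' : {in rcons done v, Z0 =i rcons Z v}.
    move=> x; rewrite !mem_rcons !in_cons => /predU1P[->|xd]; first by rewrite eqxx.
    by rewrite eqZ //; case: eqP => [xv|//]; move: Nvd; rewrite -xv xd.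
  have szZ : size Z < k.
    apply: leq_trans Z0k; rewrite -(size_rcons Z v); apply: uniq_leq_size => // x.
    by rewrite mem_rcons in_cons => /predU1P[->|/ZZ0].
  have [bs szbs run] := IHr _ _ _ def_vs' Zd' UZ' eqZ' UZ0 Z0k fZ0.
  exists (true :: bs).
    rewrite (@eq_leaders F _ (kept done Z)) in szbs; last by apply: kept_delete.
    move: szbs; rewrite size_rcons /=.
    move: (count _ _) (leaders _ _) (size bs) (nat_of_bool _) szZ.
    by clear; lia.
  move=> bits b eqb; rewrite /= /process br /= addn1.
  have := eqb 0 isT; rewrite addn0 /= => ->; rewrite szZ.
  by apply: run => j jb; rewrite addSnnS eqb.
have [Zd' eqZ' sB] := sub_cases Z0 NZ0v eqZ.
have fB : forest B := sub_forest sB fZ0.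
have [bs szbs run] := IHr _ _ _ def_vs' Zd' UZ eqZ' UZ0 Z0k fZ0.
exists (false :: bs).
  rewrite (@eq_leaders F _ B) // in szbs.
  case: (boolP (v \in F)) br => [Fv _|NFv /= br].
    have := leaders_add UF Fn fB; move: szbs; rewrite -/B /= Fv.
    move: (count _ _) (leaders _ _) (leaders _ _) (size bs) (k - _).
    by clear; lia.
  have := leaders_branch Fn fB NFv NAv br; move: szbs; rewrite -/B /=.
  move: (count _ _) (leaders _ _) (leaders _ _) (size bs) (k - _) (nat_of_bool _).
  by clear; lia.
move=> bits b eqb; rewrite /= /process br /= addn1.
have := eqb 0 isT; rewrite addn0 /= => ->.
by rewrite conf_forest //; apply: run => j jb; rewrite addSnnS eqb.
Qed.

Lemma eq_process k bits F A1 A2 v st : A1 =1 A2 ->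
  process k bits F A1 v st = process k bits F A2 v st.
Proof.
by move=> eqA; rewrite /process (eq_branch F eqA) (eq_conf eqA).
Qed.

(** * The elimination order read off from the tours *)

(** Position [q] in the concatenation of the tours from 0, 1, and so on, each cut after $n^2$ steps.
    One number thus denotes a position in a sequence that visits every component. *)
Definition scan (R : pred nat) (q : nat) : nat :=
  tour R (q %/ (n * n)) (q %% (n * n)).

Lemma scan_run R r j : j < n * n -> scan R (r * (n * n) + j) = tour R r j.
Proof.
move=> jn; have nn : 0 < n * n by apply: leq_trans jn.
by rewrite /scan divnMDl // (divn_small jn) addn0 modnMDl modn_small.
Qed.

Definition seen (R : pred nat) (th u : nat) : bool :=
  has (fun q => scan R q == u) (iota 0 th).

Definition scans (R : pred nat) (th : nat) : seq nat :=
  [seq scan R q | q <- iota 0 th].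

Lemma seenE R th u : seen R th u = (u \in scans R th).
Proof.
apply/hasP/mapP => [[q q_th /eqP <-]|[q q_th ->]]; first by exists q.
by exists q.
Qed.

Lemma scansS R th : scans R th.+1 = rcons (scans R th) (scan R th).
Proof. by rewrite /scans -addn1 iotaD map_cat /= cats1. Qed.

(* A first visit in a tour of a tree comes from the parent, so the reverse of
   the order of first visits is an elimination order of R. *)
Definition elim_order (R : pred nat) (th : nat) : seq nat :=
  [seq u <- undup (rev (scans R th)) | R u].

Lemma elim_order_uniq R th : uniq (elim_order R th).
Proof. by rewrite filter_uniq // undup_uniq. Qed.

Lemma mem_elim_order R th u : (u \in elim_order R th) = R u && seen R th u.
Proof. by rewrite mem_filter mem_undup mem_rev seenE. Qed.

(** Lowering the threshold by one removes the head exactly at a first visit of a vertex of [R]. A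
    loop that lowers the threshold therefore meets the vertices in this order without storing it. *)
Lemma elim_orderS R th : elim_order R th.+1 =
  if R (scan R th) && ~~ seen R th (scan R th)
  then scan R th :: elim_order R th else elim_order R th.
Proof.
rewrite /elim_order scansS rev_rcons seenE /= mem_rev.
by case: ifP => _ /=; case: (R _).
Qed.

Lemma seen_all R u : u < n -> seen R (n * n * n) u.
Proof.
move=> un; have nn : 0 < n * n by rewrite muln_gt0 n_gt0.
apply/hasP; exists (u * (n * n)).
  by rewrite mem_iota add0n /= [n * n * n]mulnC ltn_pmul2r.
by rewrite /scan mulnK // modnMl tour0.
Qed.

Lemma index_scans_le R th q : q < th -> index (scan R q) (scans R th) <= q.
Proof.
move=> qt; rewrite leqNgt; apply/negP => /(before_find (scan R q)).
by rewrite (nth_map 0) ?size_iota // nth_iota //= eqxx.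
Qed.

(** Between the first visits of [z1] and [z2] the walk has not met [y] yet, so it connects them in
    [R] without [y]. Two distinct neighbours of [y] connected in this way would give a cycle in the
    forest [R]. *)
Lemma elim_order_later (R : pred nat) y z1 z2 :
    let th := n * n * n in
    (forall u, R u -> u < n) -> forest R -> R y -> R z1 -> R z2 ->
    e y z1 -> e y z2 ->
    index z1 (scans R th) < index y (scans R th) ->
    index z2 (scans R th) < index y (scans R th) ->
  z1 = z2.
Proof.
move=> th Rn fR Ry Rz1 Rz2 yz1 yz2; set S := scans R th.
have nn : 0 < n * n by rewrite muln_gt0 n_gt0.
have S_scan u : R u -> index u S < th /\ scan R (index u S) = u.
  move=> Ru; have uS : u \in S by rewrite -seenE seen_all ?Rn.
  have iu : index u S < th by move: uS; rewrite -index_mem size_map size_iota.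
  split=> //; move: (nth_index u uS).
  by rewrite (nth_map 0) ?size_iota // nth_iota.
set gy := index y S; have [gy_th gyE] := S_scan y Ry.
(* A neighbour of [y] that precedes it lies in the same tour as the first visit of [y]: an earlier
   tour containing the neighbour covers its whole component and would have met [y] already. *)
have run q : q < gy -> R (scan R q) -> e y (scan R q) ->
    q %/ (n * n) = gy %/ (n * n).
  move=> q_gy Rq yq; apply/eqP; rewrite eqn_leq leq_div2r ?(ltnW q_gy) //=.
  rewrite leqNgt; apply/negP => lt_r.
  have rn : q %/ (n * n) < n by rewrite ltn_divLR // mulnC (ltn_trans q_gy).
  have ry : reach R (q %/ (n * n)) y.
    apply: reach_trans (reach_tour R _ rn) (reach1 _).
    by apply/and3P; split; [exact: Rq | exact: Ry | rewrite e_sym].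
  have [j jn def_y] := tour_covers fR rn ry.
  have lt_q : q %/ (n * n) * (n * n) + j < gy.
    rewrite [gy in _ < gy](divn_eq gy (n * n)).
    by move: lt_r jn; set c := n * n; nia.
  have := index_scans_le R (ltn_trans lt_q gy_th).
  rewrite scan_run // def_y.
  by rewrite leqNgt -/S -/gy lt_q.
move=> lt1 lt2; have [_ z1E] := S_scan z1 Rz1; have [_ z2E] := S_scan z2 Rz2.
move: (index z1 S) (index z2 S) lt1 lt2 z1E z2E => q1 q2.
wlog le_q : z1 z2 q1 q2 Rz1 Rz2 yz1 yz2 / q1 <= q2.
  move=> IH; case: (leqP q1 q2) => [le|/ltnW le] lt1 lt2 z1E z2E.
    exact: (IH z1 z2 q1 q2).
  by apply/esym; apply: (IH z2 z1 q2 q1).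
move=> lt1 lt2 z1E z2E.
pose A' := [pred x | R x && (x != y)].
have Ny q : q < gy -> scan R q != y.
  move=> q_gy; apply: contraTneq q_gy => def_y; rewrite -leqNgt.
  case: (ltnP q th) => [q_th|th_q]; last exact: leq_trans (ltnW gy_th) th_q.
  by rewrite /gy -def_y index_scans_le.
pose r := gy %/ (n * n); pose j1 := q1 %% (n * n).
have rn : r < n by rewrite ltn_divLR // mulnC.
have r1 : q1 %/ (n * n) = r by apply: run; rewrite ?z1E.
have r2 : q2 %/ (n * n) = r by apply: run; rewrite ?z2E.
have walk m : q1 + m <= q2 -> scan R (q1 + m) = tour R r (j1 + m) /\
    reach A' z1 (scan R (q1 + m)).
  elim: m => [|m IHm] le_m.
    rewrite !addn0 z1E; split; last exact: reach0.
    by rewrite -z1E /scan r1.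
  have [eq_m reach_m] := IHm (leq_trans (leq_add (leqnn _) (leqnSn _)) le_m).
  have eq_m' : scan R (q1 + m.+1) = tour R r (j1 + m.+1).
    have le_jn : j1 + m.+1 < n * n.
      have := ltn_pmod q2 nn; have := divn_eq q1 (n * n); have := divn_eq q2 (n * n).
      by rewrite r1 r2 -/j1; lia.
    by rewrite {1}(divn_eq q1 (n * n)) r1 -/j1 -addnA scan_run.
  split=> //; apply: reach_trans reach_m _; rewrite eq_m eq_m' addnS.
  have [->|tt] := tour_stepP R (j1 + m) rn; first exact: reach0.
  apply: reach1; have /and3P[R1 R2 e12] := tt.
  apply/and3P; split=> //; apply/andP; split=> //.
    by rewrite -eq_m Ny // (leq_ltn_trans _ lt2) // (leq_trans _ le_m) // leq_add2l.
  by rewrite -addnS -eq_m' Ny // (leq_ltn_trans le_m).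
have [|_ r12] := walk (q2 - q1); first by rewrite subnKC.
rewrite subnKC // z2E in r12.
have NA'y : ~~ A' y by rewrite /A' /= eqxx andbF.
have nbr_A' z : R z -> e y z -> A' z.
  move=> Rz yz; apply/andP; split=> //.
  by apply: contraTneq yz => ->; rewrite e_irr.
apply: (forest_sep (A := A') (v := y)) => //; try exact: nbr_A'.
by apply: sub_forest fR => x /predU1P[->//|/andP[]].
Qed.

Lemma elim_order_later_cat (R : pred nat) F y z1 z2 :
    let th := n * n * n in let vs := F ++ elim_order R th in
    (forall u, R u -> u < n) -> forest R ->
    y \in vs -> y \notin F -> z1 \in vs -> z1 \notin F ->
    z2 \in vs -> z2 \notin F -> e y z1 -> e y z2 ->
    index y vs < index z1 vs -> index y vs < index z2 vs ->
  z1 = z2.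
Proof.
move=> th vs Rn fR.
have in_ord x : x \in vs -> x \notin F -> x \in elim_order R th.
  by rewrite mem_cat => /orP[->|].
move=> yvs NFy z1vs NFz1 z2vs NFz2 yz1 yz2.
rewrite !index_cat (negbTE NFy) (negbTE NFz1) (negbTE NFz2) !ltn_add2l.
have := in_ord y yvs NFy; rewrite mem_elim_order seenE => /andP[Ry yS].
have := in_ord _ z1vs NFz1; rewrite mem_elim_order seenE => /andP[Rz1 z1S].
have := in_ord _ z2vs NFz2; rewrite mem_elim_order seenE => /andP[Rz2 z2S].
have idx x z : R x -> R z -> x \in scans R th -> z \in scans R th ->
    index x (elim_order R th) < index z (elim_order R th) ->
    index z (scans R th) < index x (scans R th).
  move=> Rx Rz xS zS; rewrite -[scans R th]revK.
  by apply: index_undup_rev; rewrite ?mem_rev.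
move=> /idx lt1 /idx lt2.
exact: elim_order_later (lt1 Ry Rz1 yS z1S) (lt2 Ry Rz2 yS z2S).
Qed.

Definition outside (i : nat) (Z : seq nat) : pred nat :=
  [pred u | (u < i) && (u \notin Z)].

Definition vertex_order (i : nat) (F : seq nat) : seq nat :=
  F ++ elim_order (outside i F) (n * n * n).

(** * One compression step *)

Section Compress.

Variables (k i : nat) (F : seq nat).
Hypothesis i_le_n : i <= n.
Hypothesis UF : uniq F.
Hypothesis Fi : all (gtn i) F.
Hypothesis fF : forest (outside i F).

Let vs := vertex_order i F.

Lemma outside_lt Z u : outside i Z u -> u < n.
Proof. by case/andP=> ui _; apply: leq_trans i_le_n. Qed.

Lemma mem_vertex_order u : (u \in vs) = (u < i).
Proof.
rewrite mem_cat mem_elim_order /outside /=.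
case: (boolP (u \in F)) => [/(allP Fi)/= ->//|_] /=; rewrite andbT.
by case: ltnP => //= ui; rewrite seen_all // (leq_trans ui).
Qed.

Lemma vertex_order_uniq : uniq vs.
Proof.
rewrite cat_uniq UF elim_order_uniq andbT /=; apply/hasPn => u.
by rewrite mem_elim_order => /andP[/andP[]].
Qed.

Lemma kept_vertex_order Z : kept vs Z =1 outside i Z.
Proof. by move=> u; rewrite /kept /= mem_vertex_order. Qed.

Lemma compress_sound bits :
    ~~ (attempt k bits F [::] vs ([::], 0, false)).2 ->
  exists Z b, [/\ attempt k bits F [::] vs ([::], 0, false) = (Z, b, false),
    uniq Z, size Z <= k, all (gtn i) Z & forest (outside i Z)].
Proof.
move=> ok; have f0 : forest (kept [::] [::]) by move=> [|x p] //= /andP[].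
have [||||Z [b [-> UZ Zk Zvs fZ]]] := attempt_sound _ _ _ _ f0 ok => //.
  exact: vertex_order_uniq.
exists Z, b; split=> //.
  by apply/allP => x /Zvs; rewrite mem_vertex_order.
by apply: eq_forest fZ; apply: kept_vertex_order.
Qed.

(** Nothing is kept at the start, hence there is no leader and the bound of [attempt_complete] is
    $2|F| + k \le 3k + 2$. *)
Lemma compress_complete Z0 :
    size F <= k.+1 -> uniq Z0 -> size Z0 <= k -> forest (outside i Z0) ->
  exists2 bs : seq bool, size bs <= 3 * k + 2 &
    forall bits, (forall j, j < size bs -> bits j = nth false bs j) ->
      (attempt k bits F [::] vs ([::], 0, false)).2 = false.
Proof.
move=> Fk UZ0 Z0k fZ0.
have vsn : all (gtn n) vs.
  by apply/allP => x; rewrite mem_vertex_order => xi; apply: leq_trans i_le_n.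
have fZ0' : forest (kept vs Z0).
  by apply: eq_forest fZ0 => x; rewrite kept_vertex_order.
have [||bs szbs run] := attempt_complete (done := [::]) (erefl vs)
  vertex_order_uniq vsn _ (Z := [::]) (fun x xN => xN) isT _ UZ0 Z0k fZ0' => //.
  by move=> y z1 z2; apply: elim_order_later_cat => //; apply: outside_lt.
exists bs; last by move=> bits eqb; apply: run => j jb; rewrite add0n eqb.
apply: leq_trans szbs _; rewrite subn0.
have -> : leaders F (kept [::] [::]) = 0.
  by rewrite /leaders (@eq_count _ _ pred0) ?count_pred0.
suff : count [in F] vs <= k.+1 by lia.
rewrite count_cat [X in _ + X](_ : _ = 0) ?addn0.
  by apply: leq_trans (count_size _ _) _.
apply/eqP; rewrite eqn0Ngt -has_count; apply/hasPn => u.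
by rewrite mem_elim_order => /andP[/andP[]].
Qed.

End Compress.
End Tour.
End Forest.

(** * A small language with bounded loops and its compiler *)

(** Binders are functions on [V]. The same polymorphic text is read in two ways, both with [V] equal
    to [nat]: [sem] substitutes values for variables, [compile] substitutes the addresses of
    cells. *)
Inductive term (V : Type) :=
  | Const of nat
  | Var of V
  | Cell of nat
  | Arr of nat & term V
  | Input of term V
  | Op of binop & term V & term V
  | Cond of term V & term V & term V
  | Let of term V & (V -> term V)
  | Iter of term V & (V -> V -> term V).

Arguments Const {V}.
Arguments Cell {V}.

Inductive stmt (V : Type) :=
  | Assign of nat & term V
  | Put of nat & term V & term V
  | Nop
  | Then of stmt V & stmt V
  | Test of term V & stmt V & stmt V
  | Repeat of (V -> stmt V).

Arguments Nop {V}.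

Definition store := ((nat -> nat) * (nat -> nat -> nat))%type.

Definition set_cell (s : store) (x v : nat) : store := (upd s.1 x v, s.2).

Definition set_arr (s : store) (a j v : nat) : store :=
  (s.1, fun b => if b == a then upd (s.2 a) j v else s.2 b).

Section Semantics.

Variables (W : nat) (I : seq nat).

(** Only [Add] and [Mul] can leave the range of a word. *)
Definition op_sem (o : binop) (x y : nat) : nat :=
  match o with
  | Add | Mul => binop_sem o x y %% W
  | _ => binop_sem o x y
  end.

(** Array accesses are checked against the length in cell 1, here and in [run], so loops over the
    whole range of cell 0 may index arrays without faults. *)
Fixpoint sem (s : store) (t : term nat) : nat :=
  match t with
  | Const c => c
  | Var x => x
  | Cell x => s.1 x
  | Arr a t => let j := sem s t in if j < s.1 1 then s.2 a j else 0
  | Input t => nth 0 I (sem s t)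
  | Op o t1 t2 => op_sem o (sem s t1) (sem s t2)
  | Cond t1 t2 t3 => if sem s t1 != 0 then sem s t2 else sem s t3
  | Let t f => sem s (f (sem s t))
  | Iter t f => iteri (s.1 0) (fun i v => sem s (f v i)) (sem s t)
  end.

Fixpoint run (s : store) (p : stmt nat) : store :=
  match p with
  | Assign x t => set_cell s x (sem s t)
  | Put a t1 t2 =>
      if sem s t1 < s.1 1 then set_arr s a (sem s t1) (sem s t2) else s
  | Nop => s
  | Then p q => run (run s p) q
  | Test t p q => if sem s t != 0 then run s p else run s q
  | Repeat f => iteri (s.1 0) (fun i s => run s (f i)) s
  end.

End Semantics.

(** * Running time read off from the program text *)

(** An upper bound for code whose loops make at most [N] iterations; both branches of a test are
    charged, so it does not depend on the state. *)
Fixpoint cost (N : nat) (c : cmd) : nat :=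
  match c with
  | Skip => 1
  | Store a e => (expr_size a + expr_size e).+1
  | Emit e => (expr_size e).+1
  | Seq c1 c2 => (cost N c1 + cost N c2).+1
  | If e c1 c2 => (expr_size e + (cost N c1 + cost N c2)).+1
  | While e c => N * (expr_size e + cost N c).+1 + (expr_size e).+1
  end.

(** Crude but uniform: the nesting depth of loops is at most the size of the text. *)
Lemma cost_poly N c : cost N c <= cmd_size c * N.+1 ^ cmd_size c.
Proof.
have X a b : a <= b -> N.+1 ^ a <= N.+1 ^ b by move=> ab; rewrite leq_pexp2l.
have X0 a : 0 < N.+1 ^ a by rewrite expn_gt0.
elim: c => [|a e|e|c1 IH1 c2 IH2|e c1 IH1 c2 IH2|e c IH] /=.
- by rewrite mul1n expn1.
- by rewrite leq_pmulr.
- by rewrite leq_pmulr.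
- set x := cmd_size c1 in IH1 *; set y := cmd_size c2 in IH2 *.
  have := X x (x + y).+1 ltac:(lia); have := X y (x + y).+1 ltac:(lia).
  move: (X0 (x + y).+1) IH1 IH2; nia.
- set x := cmd_size c1 in IH1 *; set y := cmd_size c2 in IH2 *.
  set z := expr_size e.
  have := X x (z + x + y).+1 ltac:(lia); have := X y (z + x + y).+1 ltac:(lia).
  move: (X0 (z + x + y).+1) IH1 IH2; nia.
- set x := cmd_size c in IH *; set z := expr_size e.
  have := X x.+1 (z + x).+1 ltac:(lia).
  have := X0 x; rewrite expnS; move: IH; set p := _ ^ x; set q := _ ^ (z + x).+1.
  nia.
Qed.

(** * The compiler and its correctness *)

Section Compiler.

(* Cells below [scalars] hold the variables, cells from [scalars] to [base] the
   temporaries; cell 0 is the number of iterations of every loop and cell 1 the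
   length of the three interleaved arrays that start at [base]. *)
Variables scalars base : nat.

Definition loc (x : nat) : expr := Aux (Cst x).

(** Interleaving makes the address independent of the array length, which is known only at run
    time. *)
Definition elt (a : nat) (x : expr) : expr :=
  Bin Add (Cst (base + a)) (Bin Mul (Cst 3) x).

(** A stack discipline: the value is left in cell [l], the cells below [l] are not overwritten, and
    bound variables become the addresses of the cells that hold them. [height] is one past the last
    temporary. *)
Fixpoint compile (l : nat) (t : term nat) : cmd :=
  match t with
  | Const c => Store (Cst l) (Cst c)
  | Var x | Cell x => Store (Cst l) (loc x)
  | Arr a t =>
      Seq (compile l t)
        (If (Bin Lt (loc l) (loc 1))
          (Store (Cst l) (Aux (elt a (loc l))))
          (Store (Cst l) (Cst 0)))
  | Input t => Seq (compile l t) (Store (Cst l) (Inp (loc l)))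
  | Op o t1 t2 =>
      Seq (compile l t1)
        (Seq (compile l.+1 t2) (Store (Cst l) (Bin o (loc l) (loc l.+1))))
  | Cond t1 t2 t3 =>
      Seq (compile l t1) (If (loc l) (compile l t2) (compile l t3))
  | Let t f =>
      Seq (compile l t) (Seq (compile l.+1 (f l)) (Store (Cst l) (loc l.+1)))
  | Iter t f =>
      Seq (compile l t) (Seq (Store (Cst l.+1) (Cst 0))
        (While (Bin Lt (loc l.+1) (loc 0))
          (Seq (compile l.+2 (f l l.+1))
            (Seq (Store (Cst l) (loc l.+2))
              (Store (Cst l.+1) (Bin Add (loc l.+1) (Cst 1)))))))
  end.

Fixpoint height (l : nat) (t : term nat) : nat :=
  match t with
  | Const _ | Var _ | Cell _ => l.+1
  | Arr _ t | Input t => height l t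
  | Op _ t1 t2 => maxn (height l t1) (height l.+1 t2)
  | Cond t1 t2 t3 => maxn (height l t1) (maxn (height l t2) (height l t3))
  | Let t f => maxn (height l t) (height l.+1 (f l))
  | Iter t f => maxn (height l t) (height l.+2 (f l l.+1))
  end.

Fixpoint compile_stmt (l : nat) (p : stmt nat) : cmd :=
  match p with
  | Assign x t => Seq (compile l t) (Store (Cst x) (loc l))
  | Put a t1 t2 =>
      Seq (compile l t1) (Seq (compile l.+1 t2)
        (If (Bin Lt (loc l) (loc 1)) (Store (elt a (loc l)) (loc l.+1)) Skip))
  | Nop => Skip
  | Then p q => Seq (compile_stmt l p) (compile_stmt l q)
  | Test t p q =>
      Seq (compile l t) (If (loc l) (compile_stmt l p) (compile_stmt l q))
  | Repeat f =>
      Seq (Store (Cst l) (Cst 0))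
        (While (Bin Lt (loc l) (loc 0))
          (Seq (compile_stmt l.+1 (f l))
            (Store (Cst l) (Bin Add (loc l) (Cst 1)))))
  end.

Fixpoint height_stmt (l : nat) (p : stmt nat) : nat :=
  match p with
  | Assign _ t => height l t
  | Put _ t1 t2 => maxn (height l t1) (height l.+1 t2)
  | Nop => l
  | Then p q => maxn (height_stmt l p) (height_stmt l q)
  | Test t p q => maxn (height l t) (maxn (height_stmt l p) (height_stmt l q))
  | Repeat f => maxn l.+1 (height_stmt l.+1 (f l))
  end.

(* Terms that differ only in their variables: values on the left, the cells
   that hold these values on the right. *)
Inductive term_rel : seq (nat * nat) -> term nat -> term nat -> Prop :=
  | RelConst G c : c < 4 -> term_rel G (Const c) (Const c)
  | RelVar G x c : (x, c) \in G -> term_rel G (Var x) (Var c)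
  | RelCell G x : x < scalars -> term_rel G (Cell x) (Cell x)
  | RelArr G a t t' : a < 3 -> term_rel G t t' -> term_rel G (Arr a t) (Arr a t')
  | RelInput G t t' : term_rel G t t' -> term_rel G (Input t) (Input t')
  | RelOp G o t1 t2 t1' t2' : term_rel G t1 t1' -> term_rel G t2 t2' ->
      term_rel G (Op o t1 t2) (Op o t1' t2')
  | RelCond G t1 t2 t3 t1' t2' t3' : term_rel G t1 t1' -> term_rel G t2 t2' ->
      term_rel G t3 t3' -> term_rel G (Cond t1 t2 t3) (Cond t1' t2' t3')
  | RelLet G t f t' f' : term_rel G t t' ->
      (forall x c, term_rel ((x, c) :: G) (f x) (f' c)) ->
      term_rel G (Let t f) (Let t' f')
  | RelIter G t f t' f' : term_rel G t t' ->
      (forall x c y d, term_rel [:: (x, c), (y, d) & G] (f x y) (f' c d)) ->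
      term_rel G (Iter t f) (Iter t' f').

(** The condition [1 < x] protects the loop bound and the array length, which therefore stay fixed
    during a run; see [run_fixed]. *)
Inductive stmt_rel : seq (nat * nat) -> stmt nat -> stmt nat -> Prop :=
  | RelAssign G x t t' : 1 < x < scalars -> term_rel G t t' ->
      stmt_rel G (Assign x t) (Assign x t')
  | RelPut G a t1 t2 t1' t2' : a < 3 -> term_rel G t1 t1' -> term_rel G t2 t2' ->
      stmt_rel G (Put a t1 t2) (Put a t1' t2')
  | RelNop G : stmt_rel G Nop Nop
  | RelThen G p q p' q' : stmt_rel G p p' -> stmt_rel G q q' ->
      stmt_rel G (Then p q) (Then p' q')
  | RelTest G t p q t' p' q' : term_rel G t t' -> stmt_rel G p p' ->
      stmt_rel G q q' -> stmt_rel G (Test t p q) (Test t' p' q')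
  | RelRepeat G f f' : (forall x c, stmt_rel ((x, c) :: G) (f x) (f' c)) ->
      stmt_rel G (Repeat f) (Repeat f').

Variable M : machine.
Let W := 2 ^ word_size M.
Hypothesis scalars_ge2 : 1 < scalars.
Hypothesis scalars_base : scalars <= base.
Hypothesis aux_W : aux_words M <= W.
Hypothesis W_ge4 : 4 <= W.
Hypothesis input_W : all (gtn W) (input M).

Definition agree (s : store) (m : nat -> nat) : Prop :=
  (forall x, x < scalars -> m x = s.1 x) /\
  (forall a j, a < 3 -> j < s.1 1 -> m (base + a + 3 * j) = s.2 a j).

Definition bounded (m : nat -> nat) : Prop := forall x, m x < W.

Definition bound_in (G : seq (nat * nat)) (l : nat) (m : nat -> nat) : Prop :=
  forall x c, (x, c) \in G -> scalars <= c < l /\ m c = x.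

Definition same_below (l : nat) (m m' : nat -> nat) : Prop :=
  forall x, (x < l) || (base <= x) -> m' x = m x.

Let W_gt0 : 0 < W.
Proof. by apply: leq_trans W_ge4. Qed.

Lemma agree_same l s m m' :
  scalars <= l -> same_below l m m' -> agree s m -> agree s m'.
Proof.
move=> sl mm' [cells arrays]; split=> [x xs|a j a3 j_lt].
  by rewrite mm' ?cells // (leq_trans xs).
by rewrite mm' ?arrays // -addnA leq_addr orbT.
Qed.

Lemma bound_in_same l l' G m m' : l <= l' ->
  same_below l m m' -> bound_in G l m -> bound_in G l' m'.
Proof.
move=> ll' mm' Gm x c /Gm[/andP[sc cl] mc]; rewrite sc (leq_trans cl ll').
by rewrite mm' ?cl.
Qed.

Lemma bound_in_cons G l m x c :
  scalars <= c < l -> m c = x -> bound_in G l m -> bound_in ((x, c) :: G) l m.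
Proof. by move=> cl mc Gm y d; rewrite inE => /predU1P[[-> ->]|/Gm]. Qed.

Lemma same_below_trans l m1 m2 m3 :
  same_below l m1 m2 -> same_below l m2 m3 -> same_below l m1 m3.
Proof. by move=> m12 m23 x xl; rewrite m23 ?m12. Qed.

Lemma same_below_le l l' m m' :
  l <= l' -> same_below l' m m' -> same_below l m m'.
Proof.
move=> ll' mm' x /orP[xl|xb]; apply: mm'; last by rewrite xb orbT.
by rewrite (leq_trans xl ll').
Qed.

Lemma same_below_upd l m x v :
  l <= x -> x < base -> same_below l m (upd m x v).
Proof.
move=> lx xb y; rewrite /upd; case: eqP => // ->.
by rewrite ltnNge lx leqNgt xb.
Qed.

Lemma bounded_upd m x v : bounded m -> v < W -> bounded (upd m x v).
Proof. by move=> mW vW y; rewrite /upd; case: eqP. Qed.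

Lemma upd_same m x v : upd m x v x = v.
Proof. by rewrite /upd eqxx. Qed.

Lemma upd_other m x y v : y != x -> upd m x v y = m y.
Proof. by rewrite /upd => /negbTE->. Qed.

Lemma eval_cst m c : c < W -> eval M m (Cst c) = Some c.
Proof. by move=> cW; congr Some; apply: modn_small. Qed.

Lemma eval_loc m x : x < aux_words M -> eval M m (loc x) = Some (m x).
Proof.
move=> xa; rewrite -[eval _ _ _]/(if eval M m (Cst x) is Some i then
  if i < aux_words M then Some (m i) else None else None).
by rewrite eval_cst ?xa //; apply: leq_trans aux_W.
Qed.

Lemma op_sem_lt o x y : x < W -> y < W -> op_sem W o x y < W.
Proof.
move=> xW yW; case: o => /=; rewrite ?ltn_pmod //.
- by apply: leq_ltn_trans xW; rewrite leq_subr.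
- by apply: leq_ltn_trans xW; apply: leq_div.
- by apply: leq_ltn_trans xW; apply: leq_mod.
- by apply: leq_trans W_ge4; case: (x < y).
- by apply: leq_trans W_ge4; case: (x == y).
Qed.

Lemma eval_op m o e1 e2 x y :
    eval M m e1 = Some x -> eval M m e2 = Some y -> x < W -> y < W ->
  eval M m (Bin o e1 e2) = Some (op_sem W o x y).
Proof.
move=> ev1 ev2 xW yW; rewrite /= ev1 ev2; congr Some.
have := op_sem_lt o xW yW; case: o => //= lt; exact: modn_small.
Qed.

Lemma eval_elt m e a j : eval M m e = Some j ->
  base + a + 3 * j < aux_words M -> eval M m (elt a e) = Some (base + a + 3 * j).
Proof.
move=> ev ja; have jW : base + a + 3 * j < W by apply: leq_trans aux_W.
have [aW W3j W3 Wj] : [/\ base + a < W, 3 * j < W, 3 < W & j < W] by split; lia.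
have -> : base + a + 3 * j = op_sem W Add (base + a) (op_sem W Mul 3 j).
  by rewrite /= [(3 * j) %% W]modn_small // modn_small.
apply: eval_op => //; first exact: eval_cst.
  by apply: eval_op => //; apply: eval_cst.
by rewrite /= modn_small.
Qed.

Lemma exec_store m o x e v : x < aux_words M -> eval M m e = Some v ->
  exec M (Store (Cst x) e) (m, o) (expr_size e).+2 (upd m x v, o).
Proof.
move=> xa ev; apply: (@ExecStore M (Cst x) e) => //.
by apply: eval_cst; apply: leq_trans aux_W.
Qed.

(** The loop test has size 5; each round costs one more step for [While], and the final failing test
    costs 6. *)
Lemma counted_loop (Inv : nat -> (nat -> nat) -> Prop) body c N T o :
    c < aux_words M -> 0 < aux_words M -> N < W ->
    (forall i m, Inv i m -> [/\ m c = i, m 0 = N & bounded m]) ->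
    (forall i m, i < N -> Inv i m -> exists m' t,
      [/\ exec M body (m, o) t (m', o), Inv i.+1 m' & t <= T]) ->
  forall d i m, i + d = N -> Inv i m -> exists m' t,
    [/\ exec M (While (Bin Lt (loc c) (loc 0)) body) (m, o) t (m', o),
         Inv N m' & t <= d * (5 + T).+1 + 6].
Proof.
move=> ca a0 NW invP step.
have evc i m : Inv i m -> eval M m (Bin Lt (loc c) (loc 0)) = Some (i < N : nat).
  move=> /invP[mc m0 mW]; rewrite (@eval_op _ _ _ _ i N) //;
    first by rewrite eval_loc ?mc.
    by rewrite eval_loc ?m0.
  by rewrite -mc; apply: mW.
elim=> [|d IHd] i m iN inv.
  rewrite addn0 in iN; exists m, 6; split=> //; last by rewrite -iN.
  by apply: ExecWhileStop; rewrite -[(m, o).1]/m (evc i) // iN ltnn.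
have lt_iN : i < N by rewrite -iN -addSnnS leq_addr.
have [m1 [t1 [ex1 inv1 t1T]]] := step i m lt_iN inv.
have [|m2 [t2 [ex2 inv2 t2T]]] := IHd i.+1 m1 _ inv1; first by rewrite addSnnS.
exists m2, (5 + t1 + t2).+1; split=> //; last by lia.
by apply: (ExecWhileLoop (v := 1)) ex1 ex2; rewrite // -[(m, o).1]/m (evc i) // lt_iN.
Qed.

Lemma height_gt l t : l < height l t.
Proof.
elim: t l => //=.
- by move=> o t1 IH1 t2 IH2 l; rewrite leq_max IH1.
- by move=> t1 IH1 t2 IH2 t3 IH3 l; rewrite leq_max IH1.
- by move=> t IH f IHf l; rewrite leq_max IH.
- by move=> t IH f IHf l; rewrite leq_max IH.
Qed.

Section Correct.

Variable o : seq nat.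

Definition computes (s : store) (l : nat) (c : cmd) (m : nat -> nat) (v : nat) :=
  exists m' t, [/\ exec M c (m, o) t (m', o), m' l = v, same_below l m m',
    bounded m' & t <= cost (s.1 0) c].

(** The induction is on [term_rel], not on the term: under a binder the semantic body is needed at a
    value and the compiled body at a cell, and the relation provides both. *)
Theorem compile_correct s : base + 3 * s.1 1 <= aux_words M ->
  forall G t t', term_rel G t t' -> forall l m,
    scalars <= l -> height l t' <= base ->
    agree s m -> bounded m -> bound_in G l m ->
  computes s l (compile l t') m (sem W (input M) s t).
Proof.
move=> s_aux; have base_aux : base <= aux_words M by apply: leq_trans s_aux;
  rewrite leq_addr.
move=> G t t'; elim=> {G t t'}.
- move=> G c c4 l m sl /= hl ag bd Gm; exists (upd m l c), 3; split=> //.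
  + by apply: exec_store; [lia | apply: eval_cst; lia].
  + exact: upd_same.
  + by apply: same_below_upd.
  + by apply: bounded_upd => //; lia.
- move=> G x c Gxc l m sl /= hl ag bd Gm; have [/andP[_ cl] mc] := Gm _ _ Gxc.
  exists (upd m l x), 4; split=> //.
  + by apply: exec_store; [lia | rewrite eval_loc ?mc //; lia].
  + exact: upd_same.
  + by apply: same_below_upd.
  + by apply: bounded_upd => //; rewrite -mc.
- move=> G x xs l m sl /= hl ag bd Gm; have [mx _] := ag.
  exists (upd m l (s.1 x)), 4; split=> //.
  + by apply: exec_store; [lia | rewrite eval_loc ?mx //; lia].
  + exact: upd_same.
  + by apply: same_below_upd.
  + by apply: bounded_upd => //; rewrite -mx.
- move=> G a t t' a3 _ IH l m sl hl ag bd Gm.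
  have [m1 [t1 [ex1 v1 sb1 bd1 c1]]] := IH l m sl hl ag bd Gm.
  have lb : l < base := leq_trans (height_gt l t') hl.
  have [cells arrays] := agree_same sl sb1 ag.
  have m11 : m1 1 = s.1 1 by rewrite cells.
  set j := sem _ _ s t in v1; rewrite [sem _ _ _ _]/= -/j.
  have evlt : eval M m1 (Bin Lt (loc l) (loc 1)) = Some (j < s.1 1 : nat).
    rewrite (@eval_op _ _ _ _ j (s.1 1)) -?v1 -?m11 ?eval_loc //; lia.
  case: (ltnP j (s.1 1)) evlt => [j_lt|j_ge] evlt.
  + exists (upd m1 l (s.2 a j)), (t1 + (5 + 9).+1).+1; split.
    * apply: ExecSeq ex1 _; apply: (ExecIf (v := 1)) => //=.
      have ja : base + a + 3 * j < aux_words M by move: s_aux j_lt a3; lia.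
      apply: exec_store; first lia.
      have -> : eval M m1 (Aux (elt a (loc l))) =
        if eval M m1 (elt a (loc l)) is Some i then if i < aux_words M then Some
          (m1 i) else None else None by [].
      rewrite (@eval_elt _ _ _ j) ?ja ?arrays //.
      by rewrite eval_loc ?v1 //; lia.
    * exact: upd_same.
    * by apply: same_below_trans sb1 _; apply: same_below_upd.
    * by apply: bounded_upd => //; rewrite -arrays.
    * by move: c1; rewrite /=; lia.
  + exists (upd m1 l 0), (t1 + (5 + 3).+1).+1; split.
    * apply: ExecSeq ex1 _; apply: (ExecIf (v := 0)) => //=.
      by apply: exec_store; [lia | apply: eval_cst].
    * exact: upd_same.
    * by apply: same_below_trans sb1 _; apply: same_below_upd.
    * exact: bounded_upd.
    * by move: c1; rewrite /=; lia.
- move=> G t t' _ IH l m sl hl ag bd Gm.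
  have [m1 [t1 [ex1 v1 sb1 bd1 c1]]] := IH l m sl hl ag bd Gm.
  have lb : l < base := leq_trans (height_gt l t') hl.
  have inW : nth 0 (input M) (m1 l) < W.
    case: (ltnP (m1 l) (size (input M))) => [lt|ge]; last by rewrite nth_default.
    by apply: (allP input_W); apply: mem_nth.
  exists (upd m1 l (nth 0 (input M) (m1 l))), (t1 + 5).+1; split.
  + apply: ExecSeq ex1 _; apply: exec_store; first lia.
    have -> : eval M m1 (Inp (loc l)) =
      if eval M m1 (loc l) is Some i then Some (Defs.wrap M (nth 0 (input M) i))
        else None by [].
    by rewrite eval_loc ?/Defs.wrap ?modn_small //; lia.
  + by rewrite upd_same v1.
  + by apply: same_below_trans sb1 _; apply: same_below_upd.
  + exact: bounded_upd.
  + by move: c1; rewrite /=; lia.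
- move=> G b t1 t2 t1' t2' _ IH1 _ IH2 l m sl /=;
    rewrite geq_max => /andP[h1 h2] ag bd Gm.
  have [m1 [x1 [ex1 v1 sb1 bd1 c1]]] := IH1 l m sl h1 ag bd Gm.
  have ag1 := agree_same sl sb1 ag.
  have Gm1 := bound_in_same (leqnSn l) sb1 Gm.
  have [m2 [x2 [ex2 v2 sb2 bd2 c2]]] := IH2 l.+1 m1 (leqW sl) h2 ag1 bd1 Gm1.
  have lb : l.+1 < base := leq_trans (height_gt l.+1 t2') h2.
  have v1' : m2 l = sem W (input M) s t1 by rewrite sb2 ?ltnSn.
  exists (upd m2 l (op_sem W b (m2 l) (m2 l.+1))), (x1 + (x2 + 7).+1).+1; split.
  + apply: ExecSeq ex1 _; apply: ExecSeq ex2 _; apply: exec_store; first lia.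
    by apply: eval_op; rewrite ?eval_loc //; lia.
  + by rewrite upd_same v1' v2.
  + apply: same_below_trans sb1 _;
      apply: same_below_trans (same_below_le (leqnSn l) sb2) _.
    by apply: same_below_upd; lia.
  + by apply: bounded_upd => //; apply: op_sem_lt.
  + by move: c1 c2; rewrite /=; lia.
- move=> G t1 t2 t3 t1' t2' t3' _ IH1 _ IH2 _ IH3 l m sl /=.
  rewrite !geq_max => /and3P[h1 h2 h3] ag bd Gm.
  have [m1 [x1 [ex1 v1 sb1 bd1 c1]]] := IH1 l m sl h1 ag bd Gm.
  have lb : l < base := leq_trans (height_gt l t1') h1.
  have ag1 := agree_same sl sb1 ag.
  have Gm1 := bound_in_same (leqnn l) sb1 Gm.
  have evl : eval M m1 (loc l) = Some (sem W (input M) s t1).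
    by rewrite eval_loc ?v1 //; lia.
  case: ifP evl => tv evl.
  + have [m2 [x2 [ex2 v2 sb2 bd2 c2]]] := IH2 l m1 sl h2 ag1 bd1 Gm1.
    exists m2, (x1 + (2 + x2).+1).+1; split=> //.
    * by apply: ExecSeq ex1 _; apply: (@ExecIf M (loc l) _ _ (m1, o) _ _ _ evl);
        rewrite tv.
    * exact: same_below_trans sb1 sb2.
    * by move: c1 c2; rewrite /=; lia.
  + have [m2 [x2 [ex2 v2 sb2 bd2 c2]]] := IH3 l m1 sl h3 ag1 bd1 Gm1.
    exists m2, (x1 + (2 + x2).+1).+1; split=> //.
    * by apply: ExecSeq ex1 _; apply: (@ExecIf M (loc l) _ _ (m1, o) _ _ _ evl);
        rewrite tv.
    * exact: same_below_trans sb1 sb2.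
    * by move: c1 c2; rewrite /=; lia.
- move=> G t f t' f' _ IH _ IHf l m sl /=; rewrite geq_max => /andP[h1 h2] ag bd Gm.
  have [m1 [x1 [ex1 v1 sb1 bd1 c1]]] := IH l m sl h1 ag bd Gm.
  have ag1 := agree_same sl sb1 ag.
  have Gm1 := bound_in_cons (l :=
    l.+1) (introT andP (conj sl (ltnSn l))) v1 (bound_in_same (leqnSn l) sb1 Gm).
  have [m2 [x2 [ex2 v2 sb2 bd2 c2]]] := IHf _ l l.+1 m1 (leqW sl) h2 ag1 bd1 Gm1.
  have lb : l.+1 < base := leq_trans (height_gt l.+1 _) h2.
  exists (upd m2 l (m2 l.+1)), (x1 + (x2 + 4).+1).+1; split.
  + apply: ExecSeq ex1 _; apply: ExecSeq ex2 _; apply: exec_store; first lia.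
    by rewrite eval_loc //; lia.
  + by rewrite upd_same v2.
  + apply: same_below_trans sb1 _;
      apply: same_below_trans (same_below_le (leqnSn l) sb2) _.
    by apply: same_below_upd; lia.
  + exact: bounded_upd.
  + by move: c1 c2; rewrite /=; lia.
- move=> G t f t' f' _ IH _ IHf l m sl /=; rewrite geq_max => /andP[h1 h2] ag bd Gm.
  have [m1 [x1 [ex1 v1 sb1 bd1 c1]]] := IH l m sl h1 ag bd Gm.
  have lb : l.+2 < base := leq_trans (height_gt l.+2 _) h2.
  set N := s.1 0.
  have NW : N < W by rewrite /N -(ag.1 0) //; lia.
  pose val i := iteri i (fun i v => sem W (input M) s (f v i)) (sem W (input M) s t).
  (* During the loop, cell [l] holds the accumulator, cell [l.+1] the counter, and the body works
     from [l.+2] on. *)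
  pose Inv i m2 := [/\ m2 l.+1 = i, m2 l = val i, same_below l m m2 & bounded m2].
  have InvP i m2 : Inv i m2 -> [/\ m2 l.+1 = i, m2 0 = N & bounded m2].
    move=> [mi _ sb b2]; split=> //.
    by have [-> //] := agree_same sl sb ag; lia.
  set body := Seq (compile l.+2 _) _.
  have step i m2 : i < N -> Inv i m2 -> exists m3 t3,
      [/\ exec M body (m2, o) t3 (m3, o), Inv i.+1 m3 & t3 <= cost N body].
    move=> iN [mi mv sb b2].
    have Gm2 : bound_in [:: (val i, l), (i, l.+1) & G] l.+2 m2.
      apply: bound_in_cons => //; first lia; apply: bound_in_cons => //; first lia.
      by apply: bound_in_same sb Gm; lia.
    have [m3 [x3 [ex3 v3 sb3 b3 c3]]] := IHf _ l _ l.+1 l.+2 m2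
      (leqW (leqW sl)) h2 (agree_same sl sb ag) b2 Gm2.
    have m3i : m3 l.+1 = i by rewrite sb3 ?mi // ltnSn.
    exists (upd (upd m3 l (m3 l.+2)) l.+1 i.+1), (x3 + (4 + 6).+1).+1; split.
    - apply: ExecSeq ex3 _; apply: ExecSeq.
        by apply: exec_store; rewrite ?eval_loc //; lia.
      apply: exec_store; first lia.
      rewrite (_ : i.+1 = op_sem W Add i 1);
        last by rewrite /= addn1 modn_small //; lia.
      apply: eval_op; [|apply: eval_cst; lia|lia|lia].
      by rewrite eval_loc ?upd_other ?m3i //; lia.
    - split; first exact: upd_same.
      + by rewrite upd_other ?upd_same ?v3 //; lia.
      + apply: same_below_trans sb _;
          apply: same_below_trans (same_below_le _ sb3) _; first lia.
        apply: (@same_below_trans _ _ (upd m3 l (m3 l.+2))); apply: same_below_upd; lia.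
      + by do 2?apply: bounded_upd => //; lia.
    - by move: c3; rewrite /body /= -/N; lia.
  have inv0 : Inv 0 (upd m1 l.+1 0).
    split; first exact: upd_same.
    + by rewrite upd_other ?v1 //; lia.
    + by apply: same_below_trans sb1 _; apply: same_below_upd; lia.
    + by apply: bounded_upd.
  have [||m3 [x3 [ex3 [mi mv sb b3] c3]]] := counted_loop (c :=
    l.+1) _ _ NW InvP step (add0n N) inv0; try lia.
  exists m3, (x1 + (3 + x3).+1).+1; split=> //.
  + apply: ExecSeq ex1 _; apply: ExecSeq ex3.
    by apply: exec_store; [lia | apply: eval_cst].
  + by move: c1 c3; rewrite /= -/N -/body; lia.
Qed.

Lemma run_fixed G p p' : stmt_rel G p p' -> forall s,
  (run W (input M) s p).1 0 = s.1 0 /\ (run W (input M) s p).1 1 = s.1 1.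
Proof.
elim=> {G p p'} //=.
- by move=> G x t t' /andP[x1 _] _ s; rewrite !upd_other // neq_ltn ?x1 ?(ltnW x1).
- by move=> G a t1 t2 t1' t2' _ _ _ s; case: ifP.
- move=> G p q p' q' _ IHp _ IHq s.
  by have [-> ->] := IHq (run W (input M) s p); apply: IHp.
- by move=> G t p q t' p' q' _ _ IHp _ IHq s; case: ifP.
- move=> G f f' _ IH s; elim: {1 3}(s.1 0) => //= i [IH0 IH1].
  by rewrite -IH0 -IH1; apply: (IH i 0).
Qed.

Lemma agree_set_cell s m x v :
  1 < x < scalars -> agree s m -> agree (set_cell s x v) (upd m x v).
Proof.
case/andP=> x1 xs [cells arrays]; split=> [y ys|a j a3] /=.
  by rewrite /upd; case: eqP => // _; apply: cells.
rewrite upd_other; last by rewrite neq_ltn x1.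
by move=> j_lt; rewrite upd_other ?arrays // neq_ltn; apply/orP; right; lia.
Qed.

Lemma agree_set_arr s m a j v :
  a < 3 -> agree s m ->
  agree (set_arr s a j v) (upd m (base + a + 3 * j) v).
Proof.
move=> a3 [cells arrays]; split=> [y ys|b i b3 i_lt] /=.
  by rewrite upd_other ?cells // neq_ltn; apply/orP; left; lia.
case: (eqVneq b a) => [->|ba].
  rewrite {2}/upd; case: (eqVneq i j) => [->|ij]; first exact: upd_same.
  by rewrite upd_other ?arrays //; lia.
by rewrite upd_other ?arrays //; lia.
Qed.

(** Weaker than [same_below], since statements also change variables and arrays; the counters of
    enclosing loops are still preserved. *)
Definition same_temps (l : nat) (m m' : nat -> nat) : Prop :=
  forall x, scalars <= x < l -> m' x = m x.

Lemma same_below_temps l m m' : same_below l m m' -> same_temps l m m'.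
Proof. by move=> mm' x /andP[_ xl]; rewrite mm' ?xl. Qed.

Lemma same_temps_trans l m1 m2 m3 :
  same_temps l m1 m2 -> same_temps l m2 m3 -> same_temps l m1 m3.
Proof. by move=> m12 m23 x xl; rewrite m23 ?m12. Qed.

Lemma same_temps_le l l' m m' :
  l <= l' -> same_temps l' m m' -> same_temps l m m'.
Proof. by move=> ll' mm' x /andP[sx xl]; rewrite mm' ?sx ?(leq_trans xl). Qed.

Lemma same_temps_upd l m x v :
  (x < scalars) || (l <= x) -> same_temps l m (upd m x v).
Proof.
move=> xl y /andP[sy yl]; rewrite upd_other // neq_ltn.
by apply/orP; case/orP: xl => xl; [right|left]; lia.
Qed.

Lemma bound_in_temps G l l' m m' : l <= l' ->
  same_temps l m m' -> bound_in G l m -> bound_in G l' m'.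
Proof.
move=> ll' mm' Gm x c /Gm[/andP[sc cl] mc]; rewrite sc (leq_trans cl ll').
by rewrite mm' ?sc.
Qed.

Definition performs (s s' : store) (l : nat) (c : cmd) (m : nat -> nat) :=
  exists m' t, [/\ exec M c (m, o) t (m', o), agree s' m', same_temps l m m',
    bounded m' & t <= cost (s.1 0) c].

Theorem compile_stmt_correct G p p' : stmt_rel G p p' -> forall s l m,
    base + 3 * s.1 1 <= aux_words M ->
    scalars <= l -> height_stmt l p' <= base ->
    agree s m -> bounded m -> bound_in G l m ->
  performs s (run W (input M) s p) l (compile_stmt l p') m.
Proof.
elim=> {G p p'}.
- move=> G x t t' xs tt' s l m sa sl /= h ag bd Gm.
  have [m1 [x1 [ex1 v1 sb1 bd1 c1]]] := compile_correct sa tt' sl h ag bd Gm.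
  have lb : l < base := leq_trans (height_gt l t') h.
  exists (upd m1 x (m1 l)), (x1 + 4).+1; split.
  + apply: ExecSeq ex1 _; apply: exec_store; first lia.
    by rewrite eval_loc //; lia.
  + by rewrite v1; apply: agree_set_cell => //; apply: agree_same sl sb1 ag.
  + apply: same_temps_trans (same_below_temps sb1) _.
    by apply: same_temps_upd; case/andP: xs => _ ->.
  + exact: bounded_upd.
  + by move: c1; rewrite /=; lia.
- move=> G a t1 t2 t1' t2' a3 tt1 tt2 s l m sa sl /=;
    rewrite geq_max => /andP[h1 h2] ag bd Gm.
  have [m1 [x1 [ex1 v1 sb1 bd1 c1]]] := compile_correct sa tt1 sl h1 ag bd Gm.
  have ag1 := agree_same sl sb1 ag.
  have Gm1 := bound_in_same (leqnSn l) sb1 Gm.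
  have [m2 [x2 [ex2 v2 sb2 bd2 c2]]] := compile_correct sa tt2 (leqW sl) h2 ag1 bd1 Gm1.
  have ag2 := agree_same (leqW sl) sb2 ag1.
  have lb2 : l.+1 < base := leq_trans (height_gt l.+1 t2') h2.
  set j := sem _ _ s t1 in v1 *.
  have v1' : m2 l = j by rewrite sb2 ?ltnSn.
  have m21 : m2 1 = s.1 1 by case: ag2 => ->.
  have evlt : eval M m2 (Bin Lt (loc l) (loc 1)) = Some (j < s.1 1 : nat).
    rewrite (@eval_op _ _ _ _ j (s.1 1)) -?v1' -?m21 ?eval_loc //; lia.
  have st12 : same_temps l m m2.
    apply: same_temps_trans (same_below_temps sb1) _.
    exact: same_temps_le (leqnSn l) (same_below_temps sb2).
  case: (ltnP j (s.1 1)) evlt => [j_lt|j_ge] evlt.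
  + exists (upd m2 (base + a + 3 * j) (m2 l.+1)), (x1 + (x2 + (5 + 9).+1).+1).+1; split.
    * apply: ExecSeq ex1 _; apply: ExecSeq ex2 _.
      apply: (@ExecIf M _ _ _ (m2, o) _ _ _ evlt) => /=.
      have ja : base + a + 3 * j < aux_words M by move: sa j_lt a3; lia.
      apply: (@ExecStore M (elt a (loc l)) (loc l.+1)) => //;
        last by rewrite eval_loc //; lia.
      by apply: eval_elt => //; rewrite eval_loc ?v1' //; lia.
    * by rewrite v2; apply: agree_set_arr.
    * apply: same_temps_trans st12 _.
      by apply: same_temps_upd; apply/orP; right; lia.
    * exact: bounded_upd.
    * by move: c1 c2; rewrite /=; lia.
  + exists m2, (x1 + (x2 + (5 + 1).+1).+1).+1; split=> //.
    * apply: ExecSeq ex1 _; apply: ExecSeq ex2 _.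
      by apply: (@ExecIf M _ _ _ (m2, o) _ _ _ evlt) => /=; apply: ExecSkip.
    * by move: c1 c2; rewrite /=; lia.
- move=> G s l m sa sl /= h ag bd Gm.
  by exists m, 1; split=> //; apply: ExecSkip.
- move=> G p q p' q' pp' IHp _ IHq s l m sa sl /=;
    rewrite geq_max => /andP[h1 h2] ag bd Gm.
  have [m1 [x1 [ex1 ag1 st1 bd1 c1]]] := IHp s l m sa sl h1 ag bd Gm.
  have [s0 s1] := run_fixed pp' s; rewrite -s1 in sa.
  have Gm1 := bound_in_temps (leqnn l) st1 Gm.
  have [m2 [x2 [ex2 ag2 st2 bd2]]] := IHq _ l m1 sa sl h2 ag1 bd1 Gm1.
  rewrite s0 => c2; exists m2, (x1 + x2).+1; split=> //.
  + exact: ExecSeq ex1 ex2.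
  + exact: same_temps_trans st1 st2.
  + by rewrite /= ltnS leq_add.
- move=> G t p q t' p' q' tt' _ IHp _ IHq s l m sa sl /=.
  rewrite !geq_max => /and3P[h h1 h2] ag bd Gm.
  have [m1 [x1 [ex1 v1 sb1 bd1 c1]]] := compile_correct sa tt' sl h ag bd Gm.
  have lb : l < base := leq_trans (height_gt l t') h.
  have ag1 := agree_same sl sb1 ag.
  have Gm1 := bound_in_same (leqnn l) sb1 Gm.
  have st1 := same_below_temps sb1.
  have evl : eval M m1 (loc l) = Some (sem W (input M) s t).
    by rewrite eval_loc ?v1 //; lia.
  case: ifP evl => tv evl.
  + have [m2 [x2 [ex2 ag2 st2 bd2 c2]]] := IHp s l m1 sa sl h1 ag1 bd1 Gm1.
    exists m2, (x1 + (2 + x2).+1).+1; split=> //.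
    * by apply: ExecSeq ex1 _; apply: (@ExecIf M (loc l) _ _ (m1, o) _ _ _ evl);
        rewrite tv.
    * exact: same_temps_trans st1 st2.
    * by move: c1 c2; rewrite /=; lia.
  + have [m2 [x2 [ex2 ag2 st2 bd2 c2]]] := IHq s l m1 sa sl h2 ag1 bd1 Gm1.
    exists m2, (x1 + (2 + x2).+1).+1; split=> //.
    * by apply: ExecSeq ex1 _; apply: (@ExecIf M (loc l) _ _ (m1, o) _ _ _ evl);
        rewrite tv.
    * exact: same_temps_trans st1 st2.
    * by move: c1 c2; rewrite /=; lia.
- move=> G f f' ff' IH s l m sa sl /=; rewrite geq_max => /andP[lb' h] ag bd Gm.
  set N := s.1 0.
  have NW : N < W by rewrite /N -(ag.1 0) //; lia.
  pose st i := iteri i (fun i s => run W (input M) s (f i)) s.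
  have st_fixed i : (st i).1 0 = N /\ (st i).1 1 = s.1 1.
    elim: i => //= i [IH0 IH1].
    by have := run_fixed (ff' i 0) (st i); rewrite IH0 IH1.
  pose Inv i m2 := [/\ m2 l = i, agree (st i) m2, same_temps l m m2 & bounded m2].
  have InvP i m2 : Inv i m2 -> [/\ m2 l = i, m2 0 = N & bounded m2].
    move=> [mi [cells _] _ b2]; split=> //.
    by rewrite cells ?(st_fixed i).1 //; lia.
  set body := Seq (compile_stmt _ _) _.
  have step i m2 : i < N -> Inv i m2 -> exists m3 t3,
      [/\ exec M body (m2, o) t3 (m3, o), Inv i.+1 m3 & t3 <= cost N body].
    move=> iN [mi ag2 st2 b2]; have [st0 st1] := st_fixed i.
    have sa2 : base + 3 * (st i).1 1 <= aux_words M by rewrite st1.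
    have Gm2 : bound_in ((i, l) :: G) l.+1 m2.
      by apply: bound_in_cons => //; [lia | apply: bound_in_temps st2 Gm].
    have [m3 [x3 [ex3 ag3 st3 b3]]] := IH i l (st i) l.+1 m2 sa2 (leqW sl) h ag2 b2 Gm2.
    rewrite st0 => c3.
    have m3i : m3 l = i by rewrite st3 ?mi // sl ltnSn.
    exists (upd m3 l i.+1), (x3 + 6).+1; split.
    - apply: ExecSeq ex3 _; apply: exec_store; first lia.
      rewrite (_ : i.+1 = op_sem W Add i 1);
        last by rewrite /= addn1 modn_small //; lia.
      apply: eval_op; [|apply: eval_cst; lia|lia|lia].
      by rewrite eval_loc ?m3i //; lia.
    - split; first exact: upd_same.
      + by apply: (agree_same sl) ag3; apply: same_below_upd.
      + apply: same_temps_trans st2 _;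
          apply: same_temps_trans (same_temps_le (leqnSn l) st3) _.
        by apply: same_temps_upd; rewrite leqnn orbT.
      + by apply: bounded_upd => //; lia.
    - by move: c3; rewrite /body /=; lia.
  have inv0 : Inv 0 (upd m l 0).
    split; first exact: upd_same.
    + by apply: agree_same sl _ ag; apply: same_below_upd.
    + by apply: same_temps_upd; rewrite leqnn orbT.
    + exact: bounded_upd.
  have [||m3 [x3 [ex3 [mi ag3 st3 b3] c3]]] := counted_loop (c :=
    l) _ _ NW InvP step (add0n N) inv0; try lia.
  exists m3, (3 + x3).+1; split=> //; apply: ExecSeq ex3.
  by apply: exec_store (eval_cst _ W_gt0); apply: leq_trans sa; lia.
Qed.

End Correct.

End Compiler.

(** * The program *)

(* Cells: 0 loop bound, 1 array length, 2 n, 3 k, 4 i, 5 |F|, 6 processed part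
   of F, 7 threshold of the scan, 8 |Z|, 9 used bits, 10 refuted, 11 current
   vertex, 12 whether it is in F, 13 whether it uses a bit, 14 whether it is
   deleted, 15 current scan position, 16 carry, 17 done, 18 answer.
   Arrays: 0 F, 1 Z, 2 guessed bits. *)
Definition scalars : nat := 19.

Section Terms.

Variable V : Type.
Implicit Types (u v : V) (A : V -> term V).

Definition tand (a b : term V) := Cond a b (Const 0).
Definition tor (a b : term V) := Cond a (Const 1) b.
Definition tnot (a : term V) := Cond a (Const 0) (Const 1).

Definition texists (f : V -> term V) :=
  Iter (Const 0) (fun acc x => Cond (Var acc) (Const 1) (f x)).

Definition tmem (a c : nat) u :=
  texists (fun j => tand (Op Lt (Var j) (Cell c)) (Op Eq (Arr a (Var j)) (Var u))).

Definition tedge u v :=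
  tand (Op Lt (Var u) (Cell 2)) (tand (Op Lt (Var v) (Cell 2))
    (Input (Op Add (Const 1) (Op Add (Op Mul (Var u) (Cell 2)) (Var v))))).

Definition toutside u := tand (Op Lt (Var u) (Cell 4)) (tnot (tmem 0 5 u)).

(** The accumulator holds [w + 1] once the neighbour [w] is found, so that 0 can mean not found. *)
Definition tnext A v u :=
  Let (Iter (Const 0) (fun acc j => Cond (Var acc) (Var acc)
        (Let (Op Mod (Op Add (Op Add (Var u) (Const 1)) (Var j)) (Cell 2)) (fun w =>
          Cond (tand (A v) (tand (A w) (tedge v w)))
            (Op Add (Var w) (Const 1)) (Const 0)))))
    (fun r => Cond (Var r) (Op Defs.Sub (Var r) (Const 1)) (Var v)).

Definition tstep A x :=
  Let (Op Mod (Var x) (Cell 2)) (fun v => Let (Op Div (Var x) (Cell 2)) (fun u =>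
    Let (tnext A v u) (fun w => Op Add (Op Mul (Var v) (Cell 2)) (Var w)))).

(** All loops have the same length, so the walk simply stops moving after [j] rounds. *)
Definition ttour A a j :=
  Op Mod (Iter (Op Add (Op Mul (Var a) (Cell 2)) (Var a)) (fun x c =>
    Cond (Op Lt (Var c) (Var j)) (tstep A x) (Var x))) (Cell 2).

Definition tconn A a b := texists (fun j => Op Eq (ttour A a j) (Var b)).

Definition tscan q :=
  Let (Op Mul (Cell 2) (Cell 2)) (fun m => Let (Op Div (Var q) (Var m)) (fun r =>
    Let (Op Mod (Var q) (Var m)) (fun j => ttour toutside r j))).

Definition tseen (c : nat) u :=
  texists (fun q => tand (Op Lt (Var q) (Cell c)) (Op Eq (tscan q) (Var u))).

(** The kept set is recomputed, not stored: a vertex is decided if it is in the processed part of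
    [F], or if it is in R and is not visited below the threshold in cell 7. *)
Definition tkept u :=
  tand (Op Lt (Var u) (Cell 4)) (tand (tnot (tmem 1 8 u))
    (tor (tmem 0 6 u) (tand (tnot (tmem 0 5 u)) (tnot (tseen 7 u))))).

Definition tconf :=
  Let (Cell 11) (fun v => texists (fun a => texists (fun b =>
    tand (Op Lt (Var a) (Var b)) (tand (tkept a) (tand (tkept b)
      (tand (tedge v a) (tand (tedge v b) (tconn tkept a b)))))))).

Definition ttouch a :=
  texists (fun f => tand (tmem 0 5 f) (tand (tkept f) (tconn tkept a f))).

Definition tbranch :=
  Let (Cell 11) (fun v => texists (fun a => texists (fun b =>
    tand (Op Lt (Var a) (Var b)) (tand (tkept a) (tand (tkept b)
      (tand (tedge v a) (tand (tedge v b) (tand (ttouch a) (ttouch b))))))))).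

Definition tfirst :=
  Let (Cell 11) (fun v => tand (toutside v) (tnot (tseen 15 v))).

Definition tbool (t : term V) := Cond t (Const 1) (Const 0).

Definition sprocess : stmt V :=
  Then (Assign 13 (tbool (tor (Cell 12) tbranch)))
  (Then (Assign 14 (tand (Cell 13) (Arr 2 (Cell 9))))
  (Then (Assign 9 (Op Add (Cell 9) (Cell 13)))
  (Test (Cell 14)
    (Test (Op Lt (Cell 8) (Cell 3))
      (Then (Put 1 (Cell 8) (Cell 11)) (Assign 8 (Op Add (Cell 8) (Const 1))))
      (Assign 10 (Const 1)))
    (Test tconf (Assign 10 (Const 1)) Nop)))).

Definition sforced : stmt V :=
  Repeat (fun j => Test (Op Lt (Var j) (Cell 5))
    (Then (Assign 6 (Var j)) (Then (Assign 11 (Arr 0 (Var j)))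
      (Then (Assign 12 (Const 1)) sprocess))) Nop).

(** While position [q] is treated, cell 7 still holds [q + 1], so the current vertex counts as
    undecided; afterwards the threshold becomes [q]. *)
Definition selim : stmt V :=
  Repeat (fun _ => Test (Op Lt (Const 0) (Cell 7))
    (Then (Assign 15 (Op Defs.Sub (Cell 7) (Const 1)))
    (Then (Assign 11 (Let (Cell 15) (fun q => tscan q)))
    (Then (Assign 12 (Const 0))
    (Then (Test tfirst sprocess Nop) (Assign 7 (Cell 15)))))) Nop).

Definition sattempt : stmt V :=
  Then (Assign 6 (Const 0)) (Then (Assign 8 (Const 0))
  (Then (Assign 9 (Const 0)) (Then (Assign 10 (Const 0))
  (Then (Assign 7 (Op Mul (Op Mul (Cell 2) (Cell 2)) (Cell 2)))
  (Then sforced (Then (Assign 6 (Cell 5)) selim)))))).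

(** Binary increment of the guess. A carry left at the end means that all guesses have failed, and
    the answer is no. *)
Definition snext_guess : stmt V :=
  Then (Assign 16 (Const 1))
  (Then (Repeat (fun j => Test (tand (Op Lt (Var j) (Cell 1)) (Cell 16))
      (Test (Arr 2 (Var j)) (Put 2 (Var j) (Const 0))
        (Then (Put 2 (Var j) (Const 1)) (Assign 16 (Const 0)))) Nop))
  (Test (Cell 16) (Then (Assign 17 (Const 1)) (Assign 18 (Const 0))) Nop)).

(** The solution found, together with the new vertex [i], becomes the next [F], and the guess is
    reset to 0. *)
Definition snext_vertex : stmt V :=
  Then (Repeat (fun j => Put 0 (Var j) (Arr 1 (Var j))))
  (Then (Assign 5 (Cell 8))
  (Test (Op Eq (Cell 4) (Cell 2))
    (Then (Assign 17 (Const 1)) (Assign 18 (Const 1)))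
    (Then (Put 0 (Cell 5) (Cell 4))
    (Then (Assign 5 (Op Add (Cell 5) (Const 1)))
    (Then (Assign 4 (Op Add (Cell 4) (Const 1)))
      (Repeat (fun j => Put 2 (Var j) (Const 0)))))))).

Definition sstep : stmt V := Then sattempt (Test (Cell 10) snext_guess snext_vertex).

(** The search starts with one vertex and [F] consisting of vertex 0, which the zeroed array already
    contains. *)
Definition sinit : stmt V := Then (Assign 4 (Const 1)) (Assign 5 (Const 1)).

(** Horner's rule from digit [N - 1] down, capped at [n] because [k] may not fit in a word; the cap
    is stable, as doubling never brings the value below [n]. A nonzero entry at digit [N] means $k
    \ge 2^N$, so the value starts at the cap. *)
Definition tparameter : term V :=
  Let (Op Add (Op Mul (Cell 2) (Cell 2)) (Const 1)) (fun p =>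
  Iter (Cond (Input (Op Add (Var p) (Cell 0))) (Cell 2) (Const 0)) (fun acc j =>
    Let (Input (Op Add (Var p) (Op Defs.Sub (Cell 0) (Op Add (Var j) (Const 1)))))
      (fun d =>
    Cond (Var d)
      (Let (Op Add (Op Add (Var acc) (Var acc)) (Op Defs.Sub (Var d) (Const 1)))
        (fun c =>
        Cond (Op Lt (Var c) (Cell 2)) (Var c) (Cell 2)))
      (Var acc)))).

End Terms.

(** * The program respects the change of variables from values to cells *)

Section Parametricity.

Lemma in_tail (T : eqType) (x y : T) s : x \in s -> x \in y :: s.
Proof. by rewrite inE => ->; rewrite orbT. Qed.

Ltac solve_in := first [assumption | apply: mem_head | apply: in_tail; solve_in].

Ltac solve_rel :=
  intros;
  lazymatch goal with
  | |- is_true (_ \in _) => solve_in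
  | |- term_rel _ _ (Const _) _ => apply: RelConst; done
  | |- term_rel _ _ (Var _) _ => apply: RelVar; solve_in
  | |- term_rel _ _ (Cell _) _ => apply: RelCell; done
  | |- term_rel _ _ (Arr _ _) _ => apply: RelArr => //; solve_rel
  | |- term_rel _ _ (Input _) _ => apply: RelInput; solve_rel
  | |- term_rel _ _ (Op _ _ _) _ => apply: RelOp; solve_rel
  | |- term_rel _ _ (Cond _ _ _) _ => apply: RelCond; solve_rel
  | |- term_rel _ _ (Let _ _) _ => apply: RelLet; solve_rel
  | |- term_rel _ _ (Iter _ _) _ => apply: RelIter; solve_rel
  | |- stmt_rel _ _ (Assign _ _) _ => apply: RelAssign => //; solve_rel
  | |- stmt_rel _ _ (Put _ _ _) _ => apply: RelPut => //; solve_rel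
  | |- stmt_rel _ _ Nop _ => apply: RelNop
  | |- stmt_rel _ _ (Then _ _) _ => apply: RelThen; solve_rel
  | |- stmt_rel _ _ (Test _ _ _) _ => apply: RelTest; solve_rel
  | |- stmt_rel _ _ (Repeat _) _ => apply: RelRepeat; solve_rel
  | |- term_rel _ _ (texists _) _ => rewrite /texists; solve_rel
  | |- term_rel _ _ (tand _ _) _ => rewrite /tand; solve_rel
  | |- term_rel _ _ (tor _ _) _ => rewrite /tor; solve_rel
  | |- term_rel _ _ (tnot _) _ => rewrite /tnot; solve_rel
  | |- term_rel _ _ (tbool _) _ => rewrite /tbool; solve_rel
  | _ => idtac
  end.

Definition uniform (A A' : nat -> term nat) :=
  forall G u c, (u, c) \in G -> term_rel scalars G (A u) (A' c).

Lemma rel_mem a c G u d : a < 3 -> c < scalars -> (u, d) \in G ->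
  term_rel scalars G (tmem a c u) (tmem a c d).
Proof. by move=> a3 cs; rewrite /tmem; solve_rel. Qed.

Lemma rel_edge G u v c d : (u, c) \in G -> (v, d) \in G ->
  term_rel scalars G (tedge u v) (tedge c d).
Proof. by rewrite /tedge; solve_rel. Qed.

Ltac solve_rel1 :=
  solve_rel;
  try (first [apply: rel_mem => //; solve_in | apply: rel_edge; solve_in ]).

Lemma rel_outside : uniform (@toutside nat) (@toutside nat).
Proof. by rewrite /uniform /toutside; solve_rel1. Qed.

Lemma rel_next A A' G v u c d : uniform A A' -> (v, c) \in G -> (u, d) \in G ->
  term_rel scalars G (tnext A v u) (tnext A' c d).
Proof. by move=> AA'; rewrite /tnext; solve_rel1; apply: AA'; solve_in. Qed.

Lemma rel_tour A A' G v u c d : uniform A A' -> (v, c) \in G -> (u, d) \in G ->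
  term_rel scalars G (ttour A v u) (ttour A' c d).
Proof.
by move=> AA'; rewrite /ttour /tstep; solve_rel1; apply: rel_next => //; solve_in.
Qed.

Lemma rel_conn A A' G v u c d : uniform A A' -> (v, c) \in G -> (u, d) \in G ->
  term_rel scalars G (tconn A v u) (tconn A' c d).
Proof. by move=> AA'; rewrite /tconn; solve_rel1; apply: rel_tour => //; solve_in. Qed.

Lemma rel_scan : uniform (@tscan nat) (@tscan nat).
Proof.
rewrite /uniform /tscan; solve_rel1.
by apply: rel_tour; [exact: rel_outside | solve_in | solve_in].
Qed.

Lemma rel_seen c : c < scalars -> uniform (tseen c) (tseen c).
Proof.
by move=> cs; rewrite /uniform /tseen; solve_rel1; apply: rel_scan; solve_in.
Qed.

Lemma rel_kept : uniform (@tkept nat) (@tkept nat).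
Proof.
by rewrite /uniform /tkept; solve_rel1; apply: rel_seen => //; solve_in.
Qed.

Lemma rel_conf G : term_rel scalars G (tconf nat) (tconf nat).
Proof.
rewrite /tconf; solve_rel1; try (apply: rel_kept; solve_in).
by apply: rel_conn; [exact: rel_kept | solve_in | solve_in].
Qed.

Lemma rel_touch : uniform (@ttouch nat) (@ttouch nat).
Proof.
rewrite /uniform /ttouch; solve_rel1; first by apply: rel_kept; solve_in.
by apply: rel_conn; [exact: rel_kept | solve_in | solve_in].
Qed.

Lemma rel_branch G : term_rel scalars G (tbranch nat) (tbranch nat).
Proof.
rewrite /tbranch; solve_rel1; try (apply: rel_kept; solve_in);
  by apply: rel_touch; solve_in.
Qed.

Lemma rel_first G : term_rel scalars G (tfirst nat) (tfirst nat).
Proof.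
rewrite /tfirst; solve_rel1; first by apply: rel_outside; solve_in.
by apply: rel_seen => //; solve_in.
Qed.

Lemma rel_process G : stmt_rel scalars G (sprocess nat) (sprocess nat).
Proof.
by rewrite /sprocess; solve_rel; [exact: rel_branch | exact: rel_conf].
Qed.

Lemma rel_step : stmt_rel scalars [::] (sstep nat) (sstep nat).
Proof.
rewrite /sstep; solve_rel.
- rewrite /sattempt /sforced /selim; solve_rel.
  + exact: rel_process.
  + by apply: rel_scan; solve_in.
  + exact: rel_first.
  + exact: rel_process.
- by rewrite /snext_guess; solve_rel.
- by rewrite /snext_vertex; solve_rel.
Qed.

Lemma rel_init : stmt_rel scalars [::] (sinit nat) (sinit nat).
Proof. by rewrite /sinit; solve_rel. Qed.

Lemma rel_parameter : term_rel scalars [::] (tparameter nat) (tparameter nat).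
Proof. by rewrite /tparameter; solve_rel. Qed.

End Parametricity.

(** * Semantics of the terms *)

(** Searches shorter than the common loop bound carry a guard [j < m], which is removed here. *)
Lemma has_iota_lt (P Q : pred nat) m N : m <= N ->
  (forall j, j < N -> P j = (j < m) && Q j) -> has P (iota 0 N) = has Q (iota 0 m).
Proof.
move=> mN PQ; apply/hasP/hasP => [[j]|[j]]; rewrite mem_iota add0n => /= jN Pj.
  by move: Pj; rewrite PQ // => /andP[jm Qj]; exists j; rewrite ?mem_iota.
have jN' : j < N := leq_trans jN mN.
by exists j; rewrite ?mem_iota // PQ // jN.
Qed.

Lemma iteri_has (F : nat -> nat) m :
  (iteri m (fun i v => if v != 0 then 1 else F i) 0 != 0) =
  has (fun i => F i != 0) (iota 0 m).
Proof.
elim: m => // m IHm; rewrite -addn1 iotaD has_cat -IHm addn1 /= orbF add0n.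
by case: (iteri m _ _ != 0).
Qed.

Lemma iteri_find (P : pred nat) (F : nat -> nat) m :
  iteri m (fun i v => if v != 0 then v else if P i then (F i).+1 else 0) 0 =
  if find P (iota 0 m) < m then (F (find P (iota 0 m))).+1 else 0.
Proof.
have iota_rcons k : iota 0 k.+1 = iota 0 k ++ [:: k] by rewrite -addn1 iotaD.
elim: m => // m IHm; rewrite iteriS IHm iota_rcons find_cat.
rewrite size_iota has_find size_iota /=.
case: ltnP => [lt|_] /=; first by rewrite (ltn_trans lt).
by case: (P m); rewrite ?addn0 ?ltnSn ?addn1 ?ltnn.
Qed.

Lemma iteri_iter (T : Type) (f : T -> T) x j m : j <= m ->
  iteri m (fun c y => if c < j then f y else y) x = iter j f x.
Proof.
move=> jm; rewrite -(subnKC jm); elim: (m - j) => [|d IHd].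
  suff le_j i : i <= j -> iteri i (fun c y => if c < j then f y else y) x = iter i f x.
    by rewrite addn0 le_j.
  by elim: i => //= i IHi ij; rewrite ij IHi // ltnW.
by rewrite addnS /= IHd ltnNge leq_addr.
Qed.

Section TermSemantics.

Variables (W : nat) (I : seq nat) (s : store).
Let N := s.1 0.
Let n := s.1 2.
Hypothesis n_gt0 : 0 < n.
Hypothesis nn_N : n * n * n <= N.
Hypothesis W_big : N + n + 2 <= W.

Notation sem := (sem W I s).

Definition edge (n : nat) : rel nat :=
  [rel u v | [&& u < n, v < n & nth 0 I (1 + (u * n + v)) != 0]].

Let e := edge n.

Lemma nn_le_N : n * n <= N.
Proof. by apply: leq_trans nn_N; rewrite leq_pmulr. Qed.

Lemma lt_nz (a b : nat) : ((a < b : nat) != 0) = (a < b).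
Proof. by case: (a < b). Qed.

Lemma eq_nz (a b : nat) : ((a == b : nat) != 0) = (a == b).
Proof. by case: (a == b). Qed.

Lemma sem_let t f : sem (Let t f) = sem (f (sem t)).
Proof. by []. Qed.

Lemma sem_tand a b : (sem (tand a b) != 0) = (sem a != 0) && (sem b != 0).
Proof. by rewrite /=; case: (sem a != 0). Qed.

Lemma sem_tor a b : (sem (tor a b) != 0) = (sem a != 0) || (sem b != 0).
Proof. by rewrite /=; case: (sem a != 0). Qed.

Lemma sem_tnot a : (sem (tnot a) != 0) = ~~ (sem a != 0).
Proof. by rewrite /=; case: (sem a != 0). Qed.

Lemma sem_texists f :
  (sem (texists f) != 0) = has (fun x => sem (f x) != 0) (iota 0 N).
Proof. exact: iteri_has. Qed.

Lemma sem_tbool t : sem (tbool t) = (sem t != 0).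
Proof. by rewrite /=; case: (sem t != 0). Qed.

Lemma sem_lt (a b : term nat) : (sem (Op Lt a b) != 0) = (sem a < sem b).
Proof. exact: lt_nz. Qed.

Lemma sem_eq (a b : term nat) : (sem (Op Eq a b) != 0) = (sem a == sem b).
Proof. exact: eq_nz. Qed.

Lemma sem_tmem a c u : s.1 c <= s.1 1 -> s.1 c <= N ->
  (sem (tmem a c u) != 0) = (u \in mkseq (s.2 a) (s.1 c)).
Proof.
move=> c1 cN; rewrite sem_texists (@has_iota_lt _ (fun j => s.2 a j == u) (s.1 c)) //.
  apply/hasP/mapP => [[j jc /eqP <-]|[j jc ->]]; first by exists j.
  by exists j.
move=> j jN; rewrite sem_tand sem_lt sem_eq /=.
by case: ltnP => //= jc; rewrite (leq_trans jc c1).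
Qed.

Lemma sem_tedge u v : (sem (tedge u v) != 0) = e u v.
Proof.
rewrite /tedge 2!sem_tand !sem_lt /e /edge /= -/n.
case: (ltnP u n) => //= un; case: (ltnP v n) => //= vn.
have lt : u * n + v < n * n by nia.
have := nn_le_N => le; rewrite [(u * n) %% W]modn_small; last by nia.
by rewrite [(u * n + v) %% W]modn_small ?modn_small //; lia.
Qed.

Section Next.

Variables (tA : nat -> term nat) (A : pred nat).
Hypothesis tA_A : forall u, (sem (tA u) != 0) = A u.

Lemma sem_tnext v u : u < n -> sem (tnext tA v u) = next_nbr n e N A v u.
Proof.
move=> un; rewrite /next_nbr.
set P := fun j => within e A v ((u + 1 + j) %% n).
pose body w := Cond (tand (tA v) (tand (tA w) (tedge v w)))
  (Op Add (Var w) (Const 1)) (Const 0).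
have sem_body w : w < n -> sem (body w) = if within e A v w then w.+1 else 0.
  move=> wn; rewrite -[sem _]/(if sem (tand (tA v) (tand (tA w) (tedge v w))) != 0
    then (w + 1) %% W else 0) ; rewrite 2!sem_tand sem_tedge !tA_A.
  by rewrite addn1 modn_small //; lia.
set r := iteri N (fun i w => if w != 0 then w
            else if P i then ((u + 1 + i) %% n).+1 else 0) 0.
have -> : sem (tnext tA v u) = if r != 0 then r - 1 else v.
  pose r' := iteri N (fun i w => if w != 0 then w
            else sem (body ((((u + 1) %% W + i) %% W) %% n))) 0.
  rewrite -[sem _]/(if r' != 0 then r' - 1 else v); suff -> : r' = r by [].
  have le_NN := leqnn N; rewrite /r /r'; elim: {-2}N le_NN => // m IHm mN.
  rewrite !iteriS (IHm (ltnW mN)) [(u + 1) %% W]modn_small; last by lia.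
  rewrite [(u + 1 + m) %% W]modn_small; last by lia.
  by rewrite sem_body // ltn_pmod.
rewrite /r (iteri_find P (fun i => (u + 1 + i) %% n)).
by case: (find P (iota 0 N) < N) => //=; rewrite subn1.
Qed.

Lemma sem_tstep x : x < n * n -> sem (tstep tA x) = tour_step n e N A x.
Proof.
move=> xn; have := nn_le_N => le.
rewrite -[sem _]/((((x %% n * n) %% W) + sem (tnext tA (x %% n) (x %/ n))) %% W).
have un : x %/ n < n by rewrite ltn_divLR.
have vn : x %% n < n by apply: ltn_pmod.
have wn : next_nbr n e N A (x %% n) (x %/ n) < n by apply: next_nbr_lt.
rewrite sem_tnext // [(x %% n * n) %% W]modn_small; last by nia.
by apply: modn_small; nia.
Qed.

Lemma sem_ttour a j : a < n -> j <= N -> sem (ttour tA a j) = tour n e N A a j.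
Proof.
move=> an jN; rewrite /tour -(iteri_iter _ _ jN).
rewrite -[sem _]/(iteri N (fun i v => if (i < j : nat) != 0 then sem (tstep tA v)
  else v) (((a * n) %% W + a) %% W) %% n).
have := nn_le_N => le.
rewrite [(a * n) %% W]modn_small; last by nia.
rewrite [(a * n + a) %% W]modn_small; last by nia.
congr (_ %% n); set x0 := a * n + a.
suff : forall m, iteri m (fun i v => if ((i < j : nat) != 0) then sem (tstep tA v)
  else v) x0 =
  iteri m (fun c y => if c < j then tour_step n e N A y else y) x0 /\
  iteri m (fun c y => if c < j then tour_step n e N A y else y) x0 < n * n.
  by move=> /(_ N)[].
elim=> [|m [IH lt]]; first by split=> //=; rewrite /x0; nia.
rewrite !iteriS lt_nz IH; case: ifP => // _.
by rewrite sem_tstep // tour_step_lt.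
Qed.

Lemma sem_tconn a b : a < n -> (sem (tconn tA a b) != 0) = conn n e N A a b.
Proof.
move=> an; rewrite sem_texists; apply: eq_in_has => j.
rewrite mem_iota add0n => jN; cbv beta; rewrite sem_eq.
by rewrite (sem_ttour an (ltnW jN)).
Qed.

End Next.

Section Vertices.

Variables (i fc th : nat) (F Z : seq nat).
Hypotheses (s_i : s.1 4 = i) (s_fs : s.1 5 = size F) (s_fc : s.1 6 = fc)
  (s_th : s.1 7 = th) (s_zc : s.1 8 = size Z)
  (s_F : mkseq (s.2 0) (size F) = F) (s_Z : mkseq (s.2 1) (size Z) = Z).
Hypotheses (F_1 : size F <= s.1 1) (F_N : size F <= N)
  (Z_1 : size Z <= s.1 1) (Z_N : size Z <= N) (fc_F : fc <= size F)
  (th_n : th <= n * n * n).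

Lemma sem_tF u : (sem (tmem 0 5 u) != 0) = (u \in F).
Proof. by rewrite sem_tmem s_fs // s_F. Qed.

Lemma sem_tfc u : (sem (tmem 0 6 u) != 0) = (u \in take fc F).
Proof.
rewrite sem_tmem s_fc ?(leq_trans fc_F) //; congr (_ \in _).
by rewrite -[in RHS]s_F /mkseq -map_take take_iota (minn_idPl fc_F).
Qed.

Lemma sem_tZ u : (sem (tmem 1 8 u) != 0) = (u \in Z).
Proof. by rewrite sem_tmem s_zc // s_Z. Qed.

Lemma sem_toutside u : (sem (toutside u) != 0) = outside i F u.
Proof. by rewrite /toutside sem_tand sem_lt sem_tnot sem_tF /= s_i. Qed.

Lemma sem_tscan q : q < n * n * n -> sem (tscan q) = scan n e N (outside i F) q.
Proof.
move=> qn; have := nn_le_N => le; have nn0 : 0 < n * n by rewrite muln_gt0 n_gt0.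
have -> : sem (tscan q) = sem (ttour (@toutside nat) (q %/ (n * n)) (q %% (n * n))).
  by rewrite -[LHS]/(sem (ttour (@toutside nat) (q %/ ((n * n) %% W)) (q %% ((n *
    n) %% W)))) [(n * n) %% W]modn_small //; lia.
rewrite (sem_ttour sem_toutside) //; first by rewrite ltn_divLR // mulnA.
by apply: leq_trans le; apply/ltnW/ltn_pmod.
Qed.

Lemma sem_tseen c u : s.1 c <= n * n * n ->
  (sem (tseen c u) != 0) = seen n e N (outside i F) (s.1 c) u.
Proof.
move=> cn; rewrite sem_texists /seen; apply: has_iota_lt; first exact: leq_trans nn_N.
move=> q qN; rewrite sem_tand sem_lt sem_eq [sem (Cell c)]/= [sem (Var q)]/=.
by case: ltnP => // qc; rewrite !andTb sem_tscan // (leq_trans qc).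
Qed.

Definition kept_at (fc th : nat) : pred nat :=
  fun u => [&& u < i, u \notin Z &
    (u \in take fc F) || (u \notin F) && ~~ seen n e N (outside i F) th u].

Lemma sem_tkept u : (sem (tkept u) != 0) = kept_at fc th u.
Proof.
rewrite /tkept 2!sem_tand sem_lt sem_tor sem_tand !sem_tnot sem_tF sem_tfc sem_tZ.
by rewrite sem_tseen s_th //= s_i.
Qed.

Hypothesis i_n : i <= n.

Lemma kept_at_lt u : kept_at fc th u -> u < n.
Proof. by case/and3P=> ui _ _; apply: leq_trans i_n. Qed.

Lemma sem_tconf : (sem (tconf nat) != 0) = conf n e N (kept_at fc th) (s.1 11).
Proof.
rewrite /tconf sem_let /conf; cbv beta.
rewrite sem_texists; apply: eq_has => a; cbv beta; rewrite sem_texists;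
  apply: eq_has => b; cbv beta.
rewrite (sem_tand (Op Lt _ _)) (sem_tand (tkept a)) (sem_tand (tkept b)) !(sem_tand
  (tedge _ _))
  sem_lt !sem_tkept !sem_tedge [sem (Var a)]/= [sem (Var b)]/=.
case: (a < b) => //=; case Aa: (kept_at fc th a) => //=.
by rewrite (sem_tconn sem_tkept) ?(kept_at_lt Aa).
Qed.

Lemma sem_ttouch a : a < n ->
  (sem (ttouch a) != 0) = touch n e N F (kept_at fc th) a.
Proof.
move=> an; rewrite /ttouch sem_texists; apply: eq_has => f; cbv beta.
by rewrite (sem_tand (tmem 0 5 f)) (sem_tand (tkept f)) sem_tF sem_tkept (sem_tconn
  sem_tkept).
Qed.

Lemma sem_tbranch :
  (sem (tbranch nat) != 0) = branch n e N F (kept_at fc th) (s.1 11).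
Proof.
rewrite /tbranch sem_let /branch; cbv beta.
rewrite sem_texists; apply: eq_has => a; cbv beta; rewrite sem_texists;
  apply: eq_has => b; cbv beta.
rewrite (sem_tand (Op Lt _ _)) (sem_tand (tkept a)) (sem_tand (tkept b)) !(sem_tand
  (tedge _ _)) (sem_tand (ttouch a))
  sem_lt !sem_tkept !sem_tedge [sem (Var a)]/= [sem (Var b)]/=.
case: (a < b) => //=; case Aa: (kept_at fc th a) => //=.
case Ab: (kept_at fc th b) => //=.
by rewrite !sem_ttouch ?(kept_at_lt Aa) ?(kept_at_lt Ab).
Qed.

End Vertices.

End TermSemantics.

(** * Semantics of one step *)

Section StepSemantics.

Variables (W : nat) (I : seq nat) (N L n k : nat).
Hypothesis n_gt0 : 0 < n.
Hypothesis nn_N : n * n * n <= N.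
Hypothesis W_big : N + n + 2 <= W.
Hypothesis L_def : L = 3 * k + 3.
Hypothesis L_N : L <= N.

Let e := edge I n.
Hypothesis e_sym : symmetric e.
Hypothesis e_irr : irreflexive e.

Notation sem := (sem W I).
Notation run := (run W I).

Let nn_M : n * n <= N.
Proof. by apply: leq_trans nn_N; rewrite leq_pmulr. Qed.

Let n_N : n <= N.
Proof. by apply: leq_trans nn_M; rewrite leq_pmulr. Qed.

Let e_lt u v : e u v -> u < n.
Proof. by case/and3P. Qed.

Lemma run_then s p q : run s (Then p q) = run (run s p) q.
Proof. by []. Qed.

Lemma run_assign s x t : run s (Assign x t) = set_cell s x (sem s t).
Proof. by []. Qed.

Lemma run_test s t p q :
  run s (Test t p q) = if sem s t != 0 then run s p else run s q.
Proof. by []. Qed.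

Lemma run_repeat s f :
  run s (Repeat f) = iteri (s.1 0) (fun i s => run s (f i)) s.
Proof. by []. Qed.

Lemma sem_cell s x : sem s (Cell x) = s.1 x.
Proof. by []. Qed.

Lemma set_cell_same s x v : (set_cell s x v).1 x = v.
Proof. by rewrite /= upd_same. Qed.

Lemma set_cell_other s x y v : y != x -> (set_cell s x v).1 y = s.1 y.
Proof. exact: upd_other. Qed.

(** Memory contents during an attempt. The list of decided vertices is represented only by [fc], a
    prefix length of [F], and [th], a scan threshold. *)
Record rep (s : store) (i : nat) (F Z : seq nat) (fc th b : nat) (fl : bool)
    (bits : nat -> bool) : Prop := Rep {
  rep_N : s.1 0 = N;
  rep_L : s.1 1 = L;
  rep_n : s.1 2 = n;
  rep_k : s.1 3 = k;
  rep_i : s.1 4 = i;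
  rep_fs : s.1 5 = size F;
  rep_fc : s.1 6 = fc;
  rep_th : s.1 7 = th;
  rep_zc : s.1 8 = size Z;
  rep_b : s.1 9 = b;
  rep_fl : (s.1 10 != 0) = fl;
  rep_go : s.1 17 = 0;
  rep_F : mkseq (s.2 0) (size F) = F;
  rep_Z : mkseq (s.2 1) (size Z) = Z;
  rep_bits : forall j, bits j = (j < L) && (s.2 2 j != 0);
  rep_F_L : size F <= L;
  rep_Z_k : size Z <= k;
  rep_fc_F : fc <= size F;
  rep_th_n : th <= n * n * n;
  rep_i_n : i <= n }.

Definition current (i : nat) (F Z : seq nat) (fc th : nat) : pred nat :=
  fun u => [&& u < i, u \notin Z &
    (u \in take fc F) || (u \notin F) && ~~ seen n e N (outside i F) th u].

(* Cells 11 to 16 are scratch. *)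
Lemma rep_scratch s x v i F Z fc th b fl bits : 10 < x < 17 ->
  rep s i F Z fc th b fl bits -> rep (set_cell s x v) i F Z fc th b fl bits.
Proof.
case/andP=> x10 x17 [] *; split=> //; rewrite set_cell_other // neq_ltn;
  by apply/orP; lia.
Qed.

Section Rep.

Variables (s : store) (i : nat) (F Z : seq nat) (fc th b : nat) (fl : bool).
Variable (bits : nat -> bool).
Hypothesis r : rep s i F Z fc th b fl bits.

Let n_gt0' : 0 < s.1 2. Proof. by rewrite (rep_n r). Qed.
Let nn_N' : s.1 2 * s.1 2 * s.1 2 <= s.1 0.
Proof. by rewrite (rep_n r) (rep_N r). Qed.
Let W_big' : s.1 0 + s.1 2 + 2 <= W.
Proof. by rewrite (rep_n r) (rep_N r). Qed.
Let F_1 : size F <= s.1 1. Proof. by rewrite (rep_L r) (rep_F_L r). Qed.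
Let F_N : size F <= s.1 0.
Proof. by rewrite (rep_N r) (leq_trans (rep_F_L r)). Qed.
Let Z_1 : size Z <= s.1 1.
Proof. by rewrite (rep_L r) (leq_trans (rep_Z_k r)) // L_def; lia. Qed.
Let Z_N : size Z <= s.1 0.
Proof. by rewrite (rep_N r) (leq_trans (rep_Z_k r)) // (leq_trans _ L_N) // L_def;
  lia. Qed.
Let th_n : th <= s.1 2 * s.1 2 * s.1 2.
Proof. by rewrite (rep_n r) (rep_th_n r). Qed.
Let i_n : i <= s.1 2. Proof. by rewrite (rep_n r) (rep_i_n r). Qed.

Lemma rep_conf :
  (sem s (tconf nat) != 0) = conf n e N (current i F Z fc th) (s.1 11).
Proof.
rewrite (sem_tconf I n_gt0' nn_N' W_big' (rep_i r) (rep_fs r) (rep_fc r) (rep_th r)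
  (rep_zc r) (rep_F r) (rep_Z r) F_1 F_N Z_1 Z_N (rep_fc_F r) th_n i_n).
by rewrite /kept_at (rep_n r) (rep_N r).
Qed.

Lemma rep_branch :
  (sem s (tbranch nat) != 0) = branch n e N F (current i F Z fc th) (s.1 11).
Proof.
rewrite (sem_tbranch I n_gt0' nn_N' W_big' (rep_i r) (rep_fs r) (rep_fc r) (rep_th r)
  (rep_zc r) (rep_F r) (rep_Z r) F_1 F_N Z_1 Z_N (rep_fc_F r) th_n i_n).
by rewrite /kept_at (rep_n r) (rep_N r).
Qed.

Lemma rep_outside u : (sem s (toutside u) != 0) = outside i F u.
Proof. exact: (sem_toutside W I (rep_i r) (rep_fs r) (rep_F r) F_1 F_N). Qed.

Lemma rep_scan q : q < n * n * n -> sem s (tscan q) = scan n e N (outside i F) q.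
Proof.
move=> qn; have qn' : q < s.1 2 * s.1 2 * s.1 2 by rewrite (rep_n r).
rewrite (sem_tscan I n_gt0' nn_N' W_big' (rep_i r) (rep_fs r) (rep_fc r) (rep_th r)
  (rep_zc r) (rep_F r) F_1 F_N Z_1 Z_N (rep_fc_F r) th_n qn').
by rewrite (rep_n r) (rep_N r).
Qed.

Lemma rep_seen c u : s.1 c <= n * n * n ->
  (sem s (tseen c u) != 0) = seen n e N (outside i F) (s.1 c) u.
Proof.
move=> cn; have cn' : s.1 c <= s.1 2 * s.1 2 * s.1 2 by rewrite (rep_n r).
rewrite (sem_tseen I n_gt0' nn_N' W_big' (rep_i r) (rep_fs r) (rep_fc r) (rep_th r)
  (rep_zc r) (rep_F r) F_1 F_N Z_1 Z_N (rep_fc_F r) th_n _ cn').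
by rewrite (rep_n r) (rep_N r).
Qed.

End Rep.

Lemma run_process s i F Z fc th b fl bits v :
    rep s i F Z fc th b fl bits -> s.1 11 = v -> (s.1 12 != 0) = (v \in F) ->
    b.+1 < W ->
  let st := process n e N k bits F (current i F Z fc th) v (Z, b, fl) in
  let s' := run s (sprocess nat) in
  rep s' i F st.1.1 fc th st.1.2 st.2 bits /\ s'.1 15 = s.1 15.
Proof.
move=> r s11 s12 bW st; rewrite /sprocess !run_then 3!run_assign.
set br := (v \in F) || branch n e N F (current i F Z fc th) v.
have -> : sem s (tbool (tor (Cell 12) (tbranch nat))) = br.
  by rewrite sem_tbool sem_tor sem_cell s12 (rep_branch r) s11.
set s1 := set_cell s 13 br;
  have r1 : rep s1 i F Z fc th b fl bits by apply: rep_scratch.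
set del := br && bits b.
have del_s1 : (sem s1 (tand (Cell 13) (Arr 2 (Cell 9))) != 0) = del.
  rewrite sem_tand sem_cell set_cell_same /del eqb0 negbK; congr (_ && _).
  rewrite -[sem s1 _]/(if s1.1 9 < s1.1 1 then s1.2 2 (s1.1 9) else 0).
  by rewrite (rep_b r1) (rep_L r1) (rep_bits r1); case: ltnP.
set s2 := set_cell s1 14 _.
have r2 : rep s2 i F Z fc th b fl bits by apply: rep_scratch.
have s2_14 : (s2.1 14 != 0) = del by rewrite set_cell_same.
have -> : sem s2 (Op Add (Cell 9) (Cell 13)) = b + br.
  rewrite -[sem s2 _]/((s2.1 9 + s2.1 13) %% W) (rep_b r2).
  have -> : s2.1 13 = br by rewrite set_cell_other // set_cell_same.
  by rewrite modn_small //; have := leq_b1 br; lia.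
set s3 := set_cell s2 9 (b + br).
have r3 : rep s3 i F Z fc th (b + br) fl bits.
  by case: r2 => *; split=> //; rewrite set_cell_other.
have s3_11 : s3.1 11 = v by rewrite !set_cell_other.
have s3_15 : s3.1 15 = s.1 15 by rewrite !set_cell_other.
rewrite run_test sem_cell (set_cell_other _ _ (isT : 14 != 9)) s2_14.
rewrite {}/st /process -/br -/del; case: ifP => _; last first.
  rewrite run_test (rep_conf r3) s3_11; case: ifP => _; rewrite ?orbT ?orbF.
    rewrite run_assign set_cell_other //; split=> //.
    by case: r3 => *; split=> //; rewrite ?set_cell_same // set_cell_other.
  by [].
rewrite run_test sem_lt 2!sem_cell (rep_zc r3) (rep_k r3).
case: ltnP => Zk; last first.
  rewrite run_assign set_cell_other //; split=> //.
  by case: r3 => *; split=> //; rewrite ?set_cell_same // set_cell_other.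
rewrite run_then run_assign -[run s3 _]/(if s3.1 8 < s3.1 1 then
  set_arr s3 1 (s3.1 8) (s3.1 11) else s3).
rewrite (rep_zc r3) (rep_L r3) ifT; last by rewrite L_def; lia.
rewrite s3_11; set s4 := set_arr _ _ _ _.
have -> : sem s4 (Op Add (Cell 8) (Const 1)) = (size Z).+1.
  rewrite -[sem s4 _]/((s3.1 8 + 1) %% W) (rep_zc r3) addn1 modn_small //.
  by have := L_N; rewrite L_def; lia.
rewrite set_cell_other //; split=> //.
have s4Z : mkseq (s4.2 1) (size Z).+1 = rcons Z v.
  rewrite mkseqS /= upd_same -[in RHS](rep_Z r3).
  congr rcons; apply/eq_in_map => j; rewrite mem_iota /= => jZ.
  by rewrite upd_other // neq_ltn jZ.
case: r3 => *; split=> //=; rewrite ?size_rcons //.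
all: by rewrite upd_other // upd_same.
Qed.

Section Attempt.

Variables (i : nat) (F : seq nat) (bits : nat -> bool).
Hypothesis UF : uniq F.
Hypothesis Fi : all (gtn i) F.

Notation attempt := (attempt n e N k bits F).
Notation R := (outside i F).
Notation order := (vertex_order n e N i F).

Lemma process_bits A v (st : guess_state) :
  (process n e N k bits F A v st).1.2 <= st.1.2.+1.
Proof.
case: st => [[Z b] fl]; rewrite /process /=; have :=
  leq_b1 ((v \in F) || branch n e N F A v).
by case: ifP => _ /=; [case: ifP => _ /=|]; lia.
Qed.

Lemma run_process_kept s Z fc th b fl v done :
    rep s i F Z fc th b fl bits -> s.1 11 = v -> (s.1 12 != 0) = (v \in F) ->
    b.+1 < W -> current i F Z fc th =1 kept done Z ->
  let st := attempt done [:: v] (Z, b, fl) in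
  let s' := run s (sprocess nat) in
  rep s' i F st.1.1 fc th st.1.2 st.2 bits /\ s'.1 15 = s.1 15.
Proof.
move=> r s11 s12 bW eqA st s'.
have -> : st = process n e N k bits F (current i F Z fc th) v (Z, b, fl).
  exact/esym/eq_process.
exact: run_process.
Qed.

Lemma rep_set_fc s x Z fc th b fl : x <= size F ->
  rep s i F Z fc th b fl bits -> rep (set_cell s 6 x) i F Z x th b fl bits.
Proof.
by move=> xF [] *; split=> //; rewrite ?set_cell_same // set_cell_other.
Qed.

Lemma rep_set_th s x Z fc th b fl : x <= n * n * n ->
  rep s i F Z fc th b fl bits -> rep (set_cell s 7 x) i F Z fc x b fl bits.
Proof.
by move=> xF [] *; split=> //; rewrite ?set_cell_same // set_cell_other.
Qed.

Lemma run_forced s fc :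
    rep s i F [::] fc (n * n * n) 0 false bits ->
  let st := attempt [::] F ([::], 0, false) in
  exists fc', rep (run s (sforced nat)) i F st.1.1 fc' (n * n * n) st.1.2 st.2 bits
    /\ st.1.2 <= size F.
Proof.
pose body (j : nat) : stmt nat := Test (Op Lt (Var j) (Cell 5))
  (Then (Assign 6 (Var j)) (Then (Assign 11 (Arr 0 (Var j)))
    (Then (Assign 12 (Const 1)) (sprocess nat)))) Nop.
move=> r st; rewrite -[sforced nat]/(Repeat body) run_repeat (rep_N r).
pose st_ m := attempt [::] (take m F) ([::], 0, false).
(* The count of used bits is carried along to exclude an overflow of cell 9. *)
suff main m : exists fc', rep (iteri m (fun i s => run s (body i)) s) i F
    (st_ m).1.1 fc' (n * n * n) (st_ m).1.2 (st_ m).2 bits /\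
    (st_ m).1.2 <= size (take m F).
  by have := main N; rewrite /st_ take_oversize // (leq_trans (rep_F_L r)).
elim: m => [|m [fc1 [r1 b1]]]; first by exists fc; rewrite /st_ take0.
rewrite iteriS; set s1 := iteri m _ s in r1 *.
rewrite /body run_test sem_lt sem_cell (rep_fs r1) -[sem s1 (Var m)]/m.
case: ltnP => mF; last first.
  have eq_take : take m.+1 F = take m F by rewrite !take_oversize // leqW.
  by exists fc1; rewrite /st_ eq_take.
exists m; set v := nth 0 F m.
have st_S : st_ m.+1 = attempt (take m F) [:: v] (st_ m).
  by rewrite /st_ (take_nth 0 mF) -cats1 attempt_cat.
rewrite 3!run_then 3!run_assign.
set s2 := set_cell s1 6 _;
  have r2 : rep s2 i F (st_ m).1.1 m (n * n * n) (st_ m).1.2 (st_ m).2 bits.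
  by apply: rep_set_fc r1; apply: ltnW.
have -> : sem s2 (Arr 0 (Var m)) = v.
  rewrite -[sem s2 _]/(if m < s2.1 1 then s2.2 0 m else 0) (rep_L r2).
  by rewrite (leq_trans mF (rep_F_L r)) /v -[in RHS](rep_F r2) nth_mkseq.
set s4 := set_cell _ 12 _.
have r4 : rep s4 i F (st_ m).1.1 m (n * n * n) (st_ m).1.2 (st_ m).2 bits.
  by do 2!apply: rep_scratch => //.
have bm : (st_ m).1.2 <= m by apply: leq_trans b1 _; rewrite size_take mF.
have [||||r5 _] := run_process_kept (v := v) (done := take m F) r4.
- by rewrite set_cell_other // set_cell_same.
- by rewrite set_cell_same /v mem_nth.
- by have := rep_F_L r; lia.
- move=> u; rewrite /current /kept /=.
  case: (boolP (u \in take m F)) => [/mem_take/(allP Fi)/= ->|_] /=.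
    by rewrite andbT.
  case: (ltnP u i) => [ui|_] //; have un : u < n := leq_trans ui (rep_i_n r).
  (* At threshold $n^3$ every vertex below [n] has been seen, so no vertex of R counts as decided
     while [F] is processed. *)
  by rewrite (seen_all e N n_gt0 _ un) !andbF.
have eq_st : st_ m = ((st_ m).1.1, (st_ m).1.2, (st_ m).2).
  by case: (st_ m) => [[]].
rewrite -eq_st -st_S in r5; split=> //.
rewrite st_S size_take; apply: leq_trans (process_bits _ _ _) _.
by case: (ltnP m.+1 (size F)) => _; [rewrite ltnS | exact: leq_ltn_trans bm mF].
Qed.

Lemma mem_order u : i <= n -> (u \in order) = (u < i).
Proof. by move=> i_n; apply: mem_vertex_order. Qed.

Lemma order_uniq : uniq order.
Proof. exact: vertex_order_uniq. Qed.

Lemma size_order : i <= n -> size order <= n.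
Proof.
move=> i_n; rewrite -[leqRHS](size_iota 0); apply: uniq_leq_size;
  first exact: order_uniq.
by move=> u; rewrite mem_order // mem_iota => ui; apply: leq_trans i_n.
Qed.

(** The order has no repetitions, so a vertex below [i] is decided exactly when it is missing from
    the remaining suffix, that is, unless it is in R and seen below [th]. *)
Lemma current_elim Z th done :
    i <= n -> done ++ elim_order n e N R th = order ->
  current i F Z (size F) th =1 kept done Z.
Proof.
move=> i_n def_order u.
have -> : kept done Z u = [&& u < i, u \notin Z & ~~ (R u && seen n e N R th u)].
  rewrite /kept /= -mem_elim_order -mem_order // -def_order mem_cat.
  have := order_uniq; rewrite -def_order cat_uniq => /and3P[_ /hasPn disj _].
  case: (boolP (u \in elim_order _ _ _ _ _)) => [/disj/negbTE->|_] /=.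
    by rewrite !andbF.
  by rewrite orbF andbT.
rewrite /current take_size /outside /=; case: (ltnP u i) => //= _.
by case: (u \in F); case: (seen _ _ _ _ _ _).
Qed.

Lemma run_elim s Z b fl (st0 := attempt [::] F ([::], 0, false)) :
    rep s i F Z (size F) (n * n * n) b fl bits ->
    st0 = (Z, b, fl) -> b <= size F ->
  let st := attempt [::] order ([::], 0, false) in
  rep (run s (selim nat)) i F st.1.1 (size F) 0 st.1.2 st.2 bits.
Proof.
move=> r def_st0 bF st; have i_n := rep_i_n r.
pose body : stmt nat := Test (Op Lt (Const 0) (Cell 7))
    (Then (Assign 15 (Op Defs.Sub (Cell 7) (Const 1)))
    (Then (Assign 11 (Let (Cell 15) (fun q => tscan q)))
    (Then (Assign 12 (Const 0))
    (Then (Test (tfirst nat) (sprocess nat) Nop) (Assign 7 (Cell 15)))))) Nop.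
rewrite -[selim nat]/(Repeat (fun _ => body)) run_repeat (rep_N r); cbv beta.
pose s_ m := iteri m (fun _ s => run s body) s.
(* After [m] rounds the remaining list is the order at threshold $n^3 - m$, and the rest of the
   attempt still leads to [st]. As $N \ge n^3$, the threshold reaches 0. *)
suff main m : exists done st', [/\
    done ++ elim_order n e N R (n * n * n - m) = order,
    st = attempt done (elim_order n e N R (n * n * n - m)) st',
    rep (s_ m) i F st'.1.1 (size F) (n * n * n - m) st'.1.2 st'.2 bits &
    st'.1.2 <= size done].
  have [done [st' [_ -> rN _]]] := main N.
  have th0 : n * n * n - N = 0 by apply/eqP; rewrite subn_eq0.
  by rewrite th0 in rN *.
elim: m => [|m [done [st' [def_order def_st r1 b1]]]].
  exists F, (Z, b, fl); rewrite subn0; split=> //.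
  by rewrite -def_st0 /st /vertex_order attempt_cat.
rewrite /s_ iteriS -/(s_ m) subnS; set s1 := s_ m in r1 *.
rewrite /body run_test sem_lt sem_cell (rep_th r1) -[sem s1 (Const 0)]/0.
have th_n := rep_th_n r1.
case: (n * n * n - m) th_n r1 def_order def_st => [|q] q_n r1 def_order def_st.
  by exists done, st'.
rewrite -[q.+1.-1]/q -[(0 < q.+1)]/true.
rewrite 4!run_then (run_assign s1).
have -> : sem s1 (Op Defs.Sub (Cell 7) (Const 1)) = q.
  by rewrite -[sem s1 _]/(s1.1 7 - 1) (rep_th r1) subn1.
set s2 := set_cell s1 15 q.
have r2 : rep s2 i F st'.1.1 (size F) q.+1 st'.1.2 st'.2 bits by apply: rep_scratch.
rewrite (run_assign s2); set v := scan n e N R q.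
have -> : sem s2 (Let (Cell 15) (fun q => tscan q)) = v.
  by rewrite sem_let sem_cell set_cell_same (rep_scan r2).
set s3 := set_cell s2 11 v; rewrite (run_assign s3); set s4 := set_cell s3 12 _.
have r4 : rep s4 i F st'.1.1 (size F) q.+1 st'.1.2 st'.2 bits.
  by do 2!apply: rep_scratch => //.
have s4_11 : s4.1 11 = v by rewrite set_cell_other // set_cell_same.
have s4_15 : s4.1 15 = q by rewrite 2?set_cell_other // set_cell_same.
have first_E : (sem s4 (tfirst nat) != 0) = R v && ~~ seen n e N R q v.
  rewrite sem_let; cbv beta; rewrite sem_tand sem_tnot sem_cell s4_11.
  by rewrite (rep_outside r4) (rep_seen r4) s4_15 // ltnW.
rewrite run_test run_assign first_E.
rewrite elim_orderS -/v in def_order def_st.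
case: ifP def_order def_st => first def_order def_st; last first.
  exists done, st'; split=> //; rewrite sem_cell s4_15.
  by apply: rep_set_th r4; apply: ltnW.
have NFv : v \notin F by case/andP: first => /andP[].
have eqst : st' = (st'.1.1, st'.1.2, st'.2) by case: (st') => [[]].
have szd : size done < n.
  apply: leq_trans (size_order i_n); rewrite -def_order size_cat /= addnS ltnS.
  exact: leq_addr.
have [||||r5 s5_15] := run_process_kept (v := v) (done := done) r4 => //.
- by rewrite set_cell_same (negbTE NFv).
- by move: b1 szd W_big n_N; lia.
- apply: current_elim => //.
  by rewrite elim_orderS -/v first.
exists (rcons done v), (attempt done [:: v] st'); split.
- by rewrite cat_rcons.
- by [].
- rewrite sem_cell s5_15 s4_15; apply: (rep_set_th (th := q.+1)); first exact: ltnW.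
  by rewrite -eqst in r5; exact: r5.
- by rewrite size_rcons; apply: leq_trans (process_bits _ _ _) _.
Qed.

End Attempt.

(** * Guesses as a binary counter *)

Definition bit (b j : nat) : bool := odd (b %/ 2 ^ j).

(** Bit [j] flips when all lower bits of [b] are 1, which is the divisibility of [b.+1] by $2^j$;
    [dvdn_bit] is the propagation of this carry. *)
Lemma bitS b j : bit b.+1 j = bit b j (+) (2 ^ j %| b.+1).
Proof. by rewrite /bit divnS ?expn_gt0 // oddD addbC; case: (_ %| _). Qed.

Lemma dvdn_bit b j : (2 ^ j.+1 %| b.+1) = (2 ^ j %| b.+1) && bit b j.
Proof.
case: (boolP (2 ^ j %| b.+1)) => [dv|ndv] /=; last first.
  by apply: contraNF ndv; apply: dvdn_trans; rewrite expnS dvdn_mull.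
rewrite -[bit b j]negbK; have <- : bit b.+1 j = ~~ bit b j by rewrite bitS dv addbT.
by rewrite /bit -{1}(divnK dv) expnS dvdn_pmul2r ?expn_gt0 // dvdn2.
Qed.

Lemma bits_exist (f : nat -> bool) m :
  exists2 b, b < 2 ^ m & forall j, j < m -> bit b j = f j.
Proof.
elim: m f => [|m IHm] f; first by exists 0.
have [b bm bf] := IHm (fun j => f j.+1); exists (f 0 + b.*2).
  by rewrite expnS; move: bm; case: (f 0); lia.
case=> [|j] jm; first by rewrite /bit divn1 oddD odd_double addbF; case: (f 0).
rewrite /bit expnS divnMA -bf //; congr (odd (_ %/ _)).
by rewrite divn2 half_bit_double.
Qed.

Definition guess (b j : nat) : bool := (j < L) && bit b j.

Record ready (s : store) (i : nat) (F : seq nat) : Prop := Ready {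
  ready_N : s.1 0 = N;
  ready_L : s.1 1 = L;
  ready_n : s.1 2 = n;
  ready_k : s.1 3 = k;
  ready_i : s.1 4 = i;
  ready_fs : s.1 5 = size F;
  ready_go : s.1 17 = 0;
  ready_F : mkseq (s.2 0) (size F) = F;
  ready_F_L : size F <= L;
  ready_i_n : i <= n }.

Definition has_guess (s : store) (b : nat) : Prop :=
  forall j, guess b j = (j < L) && (s.2 2 j != 0).

Lemma ready_scratch s i F x v :
  5 < x < 17 -> ready s i F -> ready (set_cell s x v) i F.
Proof.
case/andP=> x5 x17 [] *; split=> //; rewrite set_cell_other // neq_ltn;
  by apply/orP; lia.
Qed.

Lemma rep_ready s i F Z fc th c fl b :
  rep s i F Z fc th c fl (guess b) -> ready s i F /\ has_guess s b.
Proof. by case=> *; split. Qed.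

Lemma run_attempt s i F b :
    uniq F -> all (gtn i) F -> ready s i F -> has_guess s b ->
  let st := attempt n e N k (guess b) F [::] (vertex_order n e N i F) ([::], 0,
    false) in
  rep (run s (sattempt nat)) i F st.1.1 (size F) 0 st.1.2 st.2 (guess b).
Proof.
move=> UF Fi r g st; rewrite /sattempt 5!run_then.
rewrite (run_assign s); set s1 := set_cell s 6 _.
rewrite (run_assign s1); set s2 := set_cell s1 8 _.
rewrite (run_assign s2); set s3 := set_cell s2 9 _.
rewrite (run_assign s3); set s4 := set_cell s3 10 _.
rewrite (run_assign s4).
have r4 : ready s4 i F by do 4!apply: ready_scratch => //.
have -> : sem s4 (Op Mul (Op Mul (Cell 2) (Cell 2)) (Cell 2)) = n * n * n.
  rewrite -[sem s4 _]/((((s4.1 2 * s4.1 2) %% W) * s4.1 2) %% W) (ready_n r4).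
  rewrite [(n * n) %% W]modn_small ?modn_small //; move: nn_N nn_M W_big; lia.
set s5 := set_cell s4 7 _; have r5 : ready s5 i F by apply: ready_scratch.
have rep5 : rep s5 i F [::] 0 (n * n * n) 0 false (guess b).
  have cells : [/\ s5.1 6 = 0, s5.1 7 = n * n * n, s5.1 8 = 0, s5.1 9 = 0 & s5.1 10
    = 0].
    by rewrite /s5 /s4 /s3 /s2 /s1 /set_cell /= /upd /=.
  by case: cells => c6 c7 c8 c9 c10; case: r5 => *; split; rewrite ?c10.
have [fc [r6 b6]] := run_forced UF Fi rep5.
have r7 := rep_set_fc (leqnn (size F)) r6.
rewrite 2!run_then run_assign sem_cell (rep_fs r6).
apply: (run_elim UF Fi r7) => //.
by case: (attempt _ _ _ _ _ _ _ _ _) => [[]].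
Qed.

Lemma ready_put s i F j v : ready s i F -> ready (set_arr s 2 j v) i F.
Proof. by case=> *; split. Qed.

Lemma run_put s a t1 t2 : sem s t1 < s.1 1 ->
  run s (Put a t1 t2) = set_arr s a (sem s t1) (sem s t2).
Proof. by move=> lt; rewrite -[LHS]/(if _ then _ else _) lt. Qed.

Lemma run_put_out s a t1 t2 : s.1 1 <= sem s t1 -> run s (Put a t1 t2) = s.
Proof. by move=> le; rewrite -[LHS]/(if _ then _ else _) ltnNge le. Qed.

Lemma run_next_guess s i F b :
    ready s i F -> has_guess s b -> b < 2 ^ L ->
  let s' := run s (snext_guess nat) in
  if b.+1 < 2 ^ L then ready s' i F /\ has_guess s' b.+1
  else s'.1 17 = 1 /\ s'.1 18 = 0.
Proof.
move=> r g bL; rewrite /snext_guess 2!run_then (run_assign s).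
set s1 := set_cell s 16 _; have r1 : ready s1 i F by apply: ready_scratch.
pose body (j : nat) : stmt nat := Test (tand (Op Lt (Var j) (Cell 1)) (Cell 16))
      (Test (Arr 2 (Var j)) (Put 2 (Var j) (Const 0))
        (Then (Put 2 (Var j) (Const 1)) (Assign 16 (Const 0)))) Nop.
rewrite -[run s1 _]/(run s1 (Repeat body)) run_repeat (ready_N r1).
pose s_ m := iteri m (fun i s => run s (body i)) s1; rewrite -/(s_ N).
(* After [m] rounds the bits below [m] are those of [b.+1], the others are still those of [b], and
   the carry is divisibility by $2^m$. *)
suff main m : m <= L -> [/\ ready (s_ m) i F,
    (forall j, j < L -> ((s_ m).2 2 j != 0) = bit (b + (j < m)) j) &
    ((s_ m).1 16 != 0) = (2 ^ m %| b.+1)].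
  have [rL gL cL] := main L (leqnn L).
  have s_L d : s_ (L + d) = s_ L.
    elim: d => [|d IHd]; first by rewrite addn0.
    rewrite addnS /s_ iteriS -/(s_ (L + d)) IHd /body run_test sem_tand sem_lt.
    by rewrite sem_cell (ready_L rL) -[sem _ (Var _)]/(L + d) ltnNge leq_addr.
  have -> : s_ N = s_ L by rewrite -(subnKC L_N) s_L.
  rewrite run_test sem_cell cL; case: (ltnP b.+1 (2 ^ L)) => bL'.
    rewrite gtnNdvd //; split=> // j; rewrite /guess; case: ltnP => //= jL.
    by rewrite gL // jL addn1.
  have -> : b.+1 = 2 ^ L by apply/eqP; rewrite eqn_leq bL bL'.
  by rewrite dvdnn.
elim: m => [_|m IHm mL].
  split=> // [j jL|]; last by rewrite dvd1n.
  by have := g j; rewrite /guess jL /= addn0 => ->.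
have [rm gm cm] := IHm (ltnW mL).
have bits_S t : t.2 2 = (s_ m).2 2 -> ~~ (2 ^ m %| b.+1) ->
    forall j, j < L -> (t.2 2 j != 0) = bit (b + (j < m.+1)) j.
  move=> -> ndv j jL; rewrite gm // [j < m.+1]ltnS [j <= m]leq_eqVlt.
  case: (eqVneq j m) => //= ->.
  by rewrite ltnn addn0 addn1 bitS (negbTE ndv) addbF.
have bits_put v : (v != 0) = bit b.+1 m -> forall j, j < L ->
    ((set_arr (s_ m) 2 m v).2 2 j != 0) = bit (b + (j < m.+1)) j.
  move=> vE j jL; rewrite [j < m.+1]ltnS [j <= m]leq_eqVlt /= /upd.
  case: (eqVneq j m) => [->|_] /=; first by rewrite vE addn1.
  exact: gm.
rewrite /s_ iteriS -/(s_ m) /body run_test sem_tand sem_lt 2!sem_cell.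
rewrite (ready_L rm) -[sem _ (Var _)]/m mL andTb cm dvdn_bit.
case: ifP => [dv|/negbT ndv]; last first.
  split=> //; first exact: bits_S.
  by rewrite cm (negbTE ndv).
have lt_m : sem (s_ m) (Var m) < (s_ m).1 1 by rewrite (ready_L rm).
have arr_m : (sem (s_ m) (Arr 2 (Var m)) != 0) = bit b m.
  rewrite -[sem _ _]/(if m < (s_ m).1 1 then (s_ m).2 2 m else 0).
  by rewrite (ready_L rm) mL gm // ltnn addn0.
rewrite run_test arr_m; case: ifP => bm.
  rewrite run_put //; split; first exact: ready_put.
    by apply: bits_put; rewrite bitS bm dv.
  by rewrite -[(set_arr _ _ _ _).1 16]/((s_ m).1 16) cm dv.
rewrite run_then run_put // run_assign; split.
- by apply: ready_scratch => //; apply: ready_put.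
- by apply: bits_put; rewrite bitS bm dv.
- by rewrite set_cell_same.
Qed.

Lemma run_next_vertex s i F Z fc th c fl bits :
    rep s i F Z fc th c fl bits ->
  let s' := run s (snext_vertex nat) in
  if i == n then s'.1 17 = 1 /\ s'.1 18 = 1
  else ready s' i.+1 (rcons Z i) /\ has_guess s' 0.
Proof.
move=> r; rewrite /snext_vertex 2!run_then.
pose copy (j : nat) : stmt nat := Put 0 (Var j) (Arr 1 (Var j)).
rewrite -[run s (Repeat _)]/(run s (Repeat copy)) run_repeat (rep_N r).
pose s_ m := iteri m (fun i s => run s (copy i)) s; rewrite -/(s_ N).
(* Strictness leaves room for the new vertex in the array of [F]. *)
have Z_L : size Z < L by have := rep_Z_k r; rewrite L_def; lia.
have main m : [/\ (s_ m).1 = s.1, (s_ m).2 1 = s.2 1 &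
    forall j, j < m -> j < L -> (s_ m).2 0 j = s.2 1 j].
  elim: m => [|m [cm am bm]]; first by split.
  rewrite /s_ iteriS -/(s_ m) /copy.
  case: (ltnP m L) => mL; last first.
    rewrite run_put_out; last by rewrite cm (rep_L r).
    by split=> // j jm jL; apply: bm => //; apply: leq_trans jL mL.
  rewrite run_put; last by rewrite cm (rep_L r).
  rewrite -[sem _ (Arr _ _)]/(if m < (s_ m).1 1 then (s_ m).2 1 m else 0).
  rewrite -[sem _ (Var m)]/m cm (rep_L r) mL am.
  split=> // j jm jL; rewrite /= /upd; case: eqP => [->//|/eqP jm'].
  by apply: bm => //; rewrite ltn_neqAle jm' -ltnS.
have [cN aN bN] := main N; move: (s_ N) cN aN bN => s1 c1 a1 b1.
have F1 : mkseq (s1.2 0) (size Z) = Z.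
  rewrite -[RHS](rep_Z r); apply/eq_in_map => j; rewrite mem_iota add0n => /= jZ.
  by rewrite b1 ?(ltn_trans jZ) // (leq_trans Z_L).
rewrite (run_assign s1) sem_cell c1 (rep_zc r); set s2 := set_cell s1 5 _.
have c2 x : x != 5 -> s2.1 x = s.1 x by move=> x5; rewrite set_cell_other // c1.
rewrite run_test sem_eq 2!sem_cell !c2 // (rep_i r) (rep_n r).
case: (eqVneq i n) => [_|i_n].
  by rewrite run_then 2!run_assign; split=> //; rewrite set_cell_same.
rewrite run_then run_put; last by rewrite sem_cell set_cell_same c2 // (rep_L r).
rewrite 2!sem_cell set_cell_same (c2 4) // (rep_i r).
set s3 := set_arr s2 0 (size Z) i.
rewrite 2!run_then (run_assign s3).
have -> : sem s3 (Op Add (Cell 5) (Const 1)) = (size Z).+1.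
  rewrite -[sem s3 _]/((s2.1 5 + 1) %% W) set_cell_same addn1 modn_small //.
  by move: Z_L L_N W_big; lia.
set s4 := set_cell s3 5 _; rewrite (run_assign s4).
have lt_in : i < n by rewrite ltn_neqAle (rep_i_n r) andbT.
have -> : sem s4 (Op Add (Cell 4) (Const 1)) = i.+1.
  rewrite -[sem s4 _]/((s4.1 4 + 1) %% W) set_cell_other // -[s3.1 4]/(s2.1 4).
  rewrite (c2 4) // (rep_i r).
  by rewrite addn1 modn_small //; move: lt_in W_big; lia.
set s5 := set_cell s4 4 i.+1.
have r5 : ready s5 i.+1 (rcons Z i).
  have c5 x : x != 4 -> x != 5 -> s5.1 x = s.1 x.
    by move=> x4 x5; rewrite 2?set_cell_other // -[s3.1 x]/(s2.1 x) c2.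
  split=> //.
  - by rewrite c5 // (rep_N r).
  - by rewrite c5 // (rep_L r).
  - by rewrite c5 // (rep_n r).
  - by rewrite c5 // (rep_k r).
  - by rewrite size_rcons.
  - by rewrite c5 // (rep_go r).
  - rewrite size_rcons mkseqS /= upd_same -[in RHS]F1; congr rcons.
    apply/eq_in_map => j; rewrite mem_iota add0n => /= jZ.
    by rewrite upd_other // neq_ltn jZ.
  - by rewrite size_rcons.
pose reset (j : nat) : stmt nat := Put 2 (Var j) (Const 0).
rewrite -[run s5 _]/(run s5 (Repeat reset)) run_repeat (ready_N r5).
pose t_ m := iteri m (fun i s => run s (reset i)) s5; rewrite -/(t_ N).
have reset_main m : ready (t_ m) i.+1 (rcons Z i) /\
    (forall j, j < m -> j < L -> (t_ m).2 2 j = 0).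
  elim: m => [|m [rm gm]]; first by split.
  rewrite /t_ iteriS -/(t_ m) /reset.
  case: (ltnP m L) => mL; last first.
    rewrite run_put_out; last by rewrite (ready_L rm).
    by split=> // j jm jL; apply: gm => //; apply: leq_trans jL mL.
  rewrite run_put; last by rewrite (ready_L rm).
  rewrite -[sem _ (Var m)]/m; split; first exact: ready_put.
  move=> j jm jL; rewrite /= /upd; case: eqP => [//|/eqP jm'].
  by apply: gm => //; rewrite ltn_neqAle jm' -ltnS.
have [rN gN] := reset_main N; split=> // j.
rewrite /guess; case: ltnP => //= jL; rewrite gN //; last exact: leq_trans L_N.
by rewrite /bit div0n.
Qed.

(** * The search over all guesses and all prefixes of the vertex set *)

Definition solvable (i : nat) : Prop :=
  exists Z, [/\ uniq Z, size Z <= k & forest e (outside i Z)].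

Definition valid (i : nat) (F : seq nat) : Prop :=
  [/\ 0 < i, uniq F, all (gtn i) F, size F <= k.+1 & forest e (outside i F)].

Definition refuted (i : nat) (F : seq nat) (b : nat) : Prop :=
  forall c, c < b -> (attempt n e N k (guess c) F [::] (vertex_order n e N i F)
    ([::], 0, false)).2.

Lemma valid_next i Z : uniq Z -> size Z <= k -> all (gtn i) Z ->
  forest e (outside i Z) -> valid i.+1 (rcons Z i).
Proof.
move=> UZ Zk Zi fZ; split=> //.
- by rewrite rcons_uniq UZ andbT; apply/negP => /(allP Zi); rewrite /= ltnn.
- rewrite all_rcons /= ltnSn; apply/allP => x /(allP Zi)/= xi; exact: ltnW.
- by rewrite size_rcons.
- apply: sub_forest fZ => x /andP[xi]; rewrite mem_rcons in_cons negb_or.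
  case/andP=> x_i NZx; apply/andP; split=> //.
  by rewrite ltn_neqAle x_i -ltnS.
Qed.

(** The $3k + 2$ bits of [compress_complete] fit in [L], so a solution would have made one of the
    $2^L$ guesses succeed. *)
Lemma refuted_unsolvable i F :
  i <= n -> valid i F -> refuted i F (2 ^ L) -> ~ solvable i.
Proof.
move=> i_n [i0 UF Fi Fk fF] ref [Z0 [UZ0 Z0k fZ0]].
have [bs szbs run] := compress_complete e_sym e_irr e_lt n_gt0 nn_M i_n UF Fi fF
  Fk UZ0 Z0k fZ0.
have [b bL bE] := bits_exist (nth false bs) L.
have := ref b bL; rewrite run // => j jb; rewrite /guess.
have jL : j < L by apply: leq_trans jb (leq_trans szbs _); rewrite L_def; lia.
by rewrite jL bE.
Qed.

Lemma run_step s i F b :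
    ready s i F -> has_guess s b -> valid i F -> refuted i F b -> b < 2 ^ L ->
  let s' := run s (sstep nat) in
  [\/ [/\ ready s' i F, has_guess s' b.+1, refuted i F b.+1 & b.+1 < 2 ^ L],
      exists F', [/\ i < n, ready s' i.+1 F', has_guess s' 0 & valid i.+1 F'],
      [/\ s'.1 17 = 1, s'.1 18 = 1 & solvable n] |
      [/\ s'.1 17 = 1, s'.1 18 = 0 & ~ solvable i]].
Proof.
move=> r g val ref bL; rewrite /sstep run_then run_test sem_cell.
have [_ UF Fi _ _] := val; have i_n := ready_i_n r.
have := run_attempt UF Fi r g; set s1 := run s _; set st :=
  attempt _ _ _ _ _ _ _ _ _ => r1.
rewrite (rep_fl r1); have [r1' g1] := rep_ready r1.
case: ifP => st2.
  have ref' : refuted i F b.+1.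
    by move=> c; rewrite ltnS leq_eqVlt => /predU1P[->//|]; apply: ref.
  have := run_next_guess r1' g1 bL; case: ltnP => bL'; case.
    by move=> r2 g2; apply: Or41.
  move=> s17 s18; apply: Or44; split=> //; apply: refuted_unsolvable val _ => //.
  by have <- : b.+1 = 2 ^ L by apply/eqP; rewrite eqn_leq bL bL'.
have [Z [c [def_st UZ Zk Zi fZ]]] :=
  compress_sound e_sym e_irr e_lt n_gt0 nn_M i_n UF Fi (negbT st2).
have rZ : rep s1 i F Z (size F) 0 c false (guess b) by move: r1; rewrite /st def_st.
have := run_next_vertex rZ.
case: eqP => [i_eq [s17 s18]|/eqP i_neq [r2 g2]].
  by apply: Or43; split=> //; exists Z; rewrite -i_eq.
apply: Or42; exists (rcons Z i); split=> //; last exact: valid_next.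
by rewrite ltn_neqAle i_neq.
Qed.

Lemma solvable_le i : i <= n -> solvable n -> solvable i.
Proof.
move=> i_n [Z [UZ Zk fZ]]; exists Z; split=> //; apply: sub_forest fZ => x.
by case/andP=> xi NZx; apply/andP; split=> //; apply: leq_trans i_n.
Qed.

Let step (s : store) : store := run s (sstep nat).

(** The bound on [m] is the termination measure: a new guess lowers its second term, and a new
    vertex pays a full $2^L$ for resetting [b] to 0. A failure at [i] is final because a solution
    for all vertices restricts to the first [i]. *)
Lemma run_steps s i F b :
    ready s i F -> has_guess s b -> valid i F -> refuted i F b -> b < 2 ^ L ->
  exists m, [/\ m <= (n - i) * 2 ^ L + (2 ^ L - b),
    forall j, j < m -> (iter j step s).1 17 = 0,
    (iter m step s).1 17 = 1 &
    ((iter m step s).1 18 = 1 /\ solvable n) \/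
    ((iter m step s).1 18 = 0 /\ ~ solvable n)].
Proof.
move: {2}(_ + _) (leqnn ((n - i) * 2 ^ L + (2 ^ L - b))) => d.
elim: d s i F b => [|d IHd] s i F b le_d r g val ref bL.
  by move: le_d; rewrite leqn0 addn_eq0 subn_eq0 leqNgt bL andbF.
have go := ready_go r; have i_n := ready_i_n r.
have next m : (forall j, j < m -> (iter j step (step s)).1 17 = 0) ->
    forall j, j < m.+1 -> (iter j step s).1 17 = 0.
  by move=> H [|j] //; rewrite iterSr; apply: H.
case: (run_step r g val ref bL) => [[r' g' ref' bL']|[F' [lt_in r' g' val']]|[s17
  s18 sol]|[s17 s18 nsol]].
- have [|m [le_m go_m done_m ans_m]] := IHd _ _ _ _ _ r' g' val ref' bL'; first lia.
  by exists m.+1; rewrite !iterSr; split=> //; [lia | apply: next].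
- have ref' : refuted i.+1 F' 0 by [].
  have L0 : 0 < 2 ^ L by rewrite expn_gt0.
  have [|m [le_m go_m done_m ans_m]] := IHd _ _ _ _ _ r' g' val' ref' L0.
    by move: le_d bL lt_in; move: (2 ^ L) => p; nia.
  exists m.+1; rewrite !iterSr; split=> //; last exact: next.
  by move: le_m bL lt_in; move: (2 ^ L) => p; nia.
- exists 1; split=> //; first by rewrite addn_gt0 subn_gt0 bL orbT.
  + by case.
  + by left.
- exists 1; split=> //; first by rewrite addn_gt0 subn_gt0 bL orbT.
  + by case.
  + by right; split=> // /(solvable_le i_n).
Qed.

End StepSemantics.

(** * Instances *)

Lemma nth_allpairs (S T : Type) (f : S -> T -> nat) x0 y0 s t i j :
  i < size s -> j < size t ->
  nth 0 [seq f x y | x <- s, y <- t] (i * size t + j) = f (nth x0 s i) (nth y0 t j).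
Proof.
elim: s i => //= x s IHs [|i] si tj; rewrite nth_cat size_map.
  by rewrite mul0n add0n tj (nth_map y0).
by rewrite mulSn -addnA ltnNge leq_addr addKn IHs.
Qed.

Section Instance.

Variables (n : nat) (e : rel 'I_n) (k : nat).
Hypotheses (e_sym : symmetric e) (e_irr : irreflexive e).

Let I := fvs_input e k.
Let adj := [seq (e u v : nat) | u <- enum 'I_n, v <- enum 'I_n].

Lemma size_adj : size adj = n * n.
Proof. by rewrite size_allpairs size_enum_ord. Qed.

Lemma edgeE (u v : 'I_n) : edge I n u v = e u v.
Proof.
rewrite -[LHS]/[&& u < n, v < n & nth 0 (adj ++ parameter_code k) (u * n + v) != 0].
rewrite !ltn_ord nth_cat size_adj.
have -> : u * n + v < n * n by have := ltn_ord u; have := ltn_ord v; nia.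
rewrite -[X in u * X](size_enum_ord n) (nth_allpairs _ u v) ?size_enum_ord //.
by rewrite !nth_ord_enum; case: (e u v).
Qed.

Lemma edge_sym : symmetric (edge I n).
Proof.
move=> u v; case: (ltnP u n) => un; last first.
  by rewrite /edge /= !ltnNge un /= andbF.
case: (ltnP v n) => vn; last by rewrite /edge /= !(ltnNge v) vn /= andbF.
by have := edgeE (Ordinal un) (Ordinal vn); have := edgeE (Ordinal vn) (Ordinal un);
  rewrite /= => -> ->.
Qed.

Lemma edge_irr : irreflexive (edge I n).
Proof.
move=> u; case: (ltnP u n) => un; last by rewrite /edge /= !ltnNge un.
by have := edgeE (Ordinal un) (Ordinal un); rewrite /= => ->.
Qed.

Lemma ord_seq (p : seq nat) : all (gtn n) p -> exists q : seq 'I_n, p = map val q.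
Proof.
elim: p => [|x p IHp] /=; first by exists [::].
by case/andP=> xn /IHp[q ->]; exists (Ordinal xn :: q).
Qed.

Lemma solvable_fvs : solvable I n k n <-> has_fvs e k.
Proof.
split=> [[Z [UZ Zk fZ]]|[S [Sk fS]]].
  exists [set x : 'I_n | val x \in Z]; split.
    rewrite cardE -(size_map val); apply: leq_trans Zk; apply: uniq_leq_size.
      by rewrite (map_inj_uniq val_inj) enum_uniq.
    by move=> x /mapP[y]; rewrite mem_enum inE => yZ ->.
  move=> p sp /andP[cp Up]; rewrite -leqNgt -(size_map val); apply: fZ.
    rewrite all_map; apply/allP => x /sp; rewrite inE inE => NZx.
    by apply/andP; split=> /=; first exact: ltn_ord.
  rewrite /ucycle (map_inj_uniq val_inj) Up andbT cycle_map.
  by rewrite (@eq_cycle _ _ e) // => x y /=; apply: edgeE.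
exists (map val (enum S)); split.
- by rewrite (map_inj_uniq val_inj) enum_uniq.
- by rewrite size_map -cardE.
- move=> p Ap; have pn : all (gtn n) p by apply: sub_all Ap => x /andP[].
  have [q def_p] := ord_seq pn; move: Ap; rewrite def_p => Aq /andP[cq Uq].
  rewrite size_map leqNgt; apply: fS.
    move=> x xq; rewrite inE; have := allP Aq (val x) (map_f val xq).
    case/andP=> _; apply: contra => xS; apply/mapP; exists x => //.
    by rewrite mem_enum.
  move: cq Uq; rewrite /ucycle (map_inj_uniq val_inj) cycle_map => cq ->.
  by rewrite andbT -(@eq_cycle _ (relpre val (edge I n))) // => x y /=; apply: edgeE.
Qed.

Lemma has_fvs_trivial : n <= k -> has_fvs e k.
Proof.
move=> nk; exists setT; split; first by rewrite cardsT card_ord.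
move=> [|x p] // sp; have := sp x (mem_head x p); by rewrite !inE.
Qed.

Let digits := up_log 2 k.+1.

Lemma nth_digit j : nth 0 I (n * n + 1 + j) =
  if j < digits then (bit k j : nat).+1 else 0.
Proof.
rewrite addn1 addSn -[LHS]/(nth 0 (adj ++ parameter_code k) (n * n + j)).
rewrite nth_cat size_adj ltnNge leq_addr addKn [LHS]/=.
case: ltnP => [jd|dj].
  by rewrite (nth_map 0) ?size_iota // nth_iota.
by rewrite [LHS]nth_default // size_map size_iota.
Qed.

Lemma input_small W : n < W -> 4 <= W -> all (gtn W) I.
Proof.
move=> nW W4.
have -> : all (gtn W) I = (n < W) && all (gtn W) (adj ++ parameter_code k) by [].
rewrite nW andTb all_cat; apply/andP; split.
  apply/allP => x /allpairsP[[u v] [_ _ ->]] /=.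
  by case: (e u v); apply: leq_trans W4.
apply/allP => x /mapP[j _ ->] /=; case: (odd _); by apply: leq_trans W4.
Qed.

(** Capping commutes with Horner's rule: after [m] digits the value is the minimum of [n] and the
    quotient of [k] by $2^{N-m}$. The bound $2n + 2 \le W$ lets the doubling happen before the
    cap. *)
Lemma sem_tparameter W (s : store) : 0 < n -> s.1 2 = n -> n * n <= s.1 0 -> n <=
  s.1 0 ->
    n * n + s.1 0 + n + 2 <= W -> 2 * n + 2 <= W ->
  sem W I s (tparameter nat) = minn n k.
Proof.
move=> n0 s2; set N := s.1 0 => nnN nN W1 W2; pose p := n * n + 1.
pose step acc j := let d := nth 0 I (p + (N - (j + 1))) in
  if d != 0 then let c := acc + acc + (d - 1) in if c < n then c else n else acc.
have -> : sem W I s (tparameter nat) =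
    iteri N (fun j acc => step acc j) (if nth 0 I (p + N) != 0 then n else 0).
  pose p' := ((s.1 2 * s.1 2) %% W + 1) %% W.
  have p'E : p' = p.
    by rewrite /p' s2 [(n * n) %% W]modn_small ?modn_small //; move: W1; lia.
  rewrite -[LHS]/(iteri N (fun j acc =>
    let d := nth 0 I ((p' + (N - (j + 1) %% W)) %% W) in
    if d != 0 then
      let c := ((acc + acc) %% W + (d - 1)) %% W in
      if (c < s.1 2 : nat) != 0 then c else s.1 2
    else acc) (if nth 0 I ((p' + N) %% W) != 0 then s.1 2 else 0)).
  rewrite p'E s2 [(p + N) %% W]modn_small; last by rewrite /p; move: W1; lia.
  set a0 := if _ then n else 0; have a0n : a0 <= n by rewrite /a0; case: ifP.
  suff main m : m <= N -> iteri m (fun j acc =>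
      let d := nth 0 I ((p + (N - (j + 1) %% W)) %% W) in
      if d != 0 then
        let c := ((acc + acc) %% W + (d - 1)) %% W in
        if (c < n : nat) != 0 then c else n
      else acc) a0 = iteri m (fun j acc => step acc j) a0 /\
      iteri m (fun j acc => step acc j) a0 <= n.
    by have [] := main N (leqnn N).
  elim: m => [//|m IHm mN]; have [IH le] := IHm (ltnW mN).
  rewrite !iteriS IH /step; cbv zeta; set acc := iteri m _ a0 in le *.
  have mW : (m + 1) %% W = m + 1 by rewrite modn_small //; move: W1; lia.
  rewrite mW [(p + _) %% W]modn_small; last by rewrite /p; move: W1; lia.
  rewrite nth_digit; case: (ltnP _ digits) => //= _.
  rewrite [(acc + acc) %% W]modn_small; last by move: W2 le; lia.
  rewrite modn_small; last by move: W2 le; case: (bit _ _); lia.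
  by rewrite lt_nz; split=> //; case: ifP => // /ltnW.
have k_lt : k < 2 ^ digits by apply: up_logP.
suff main m : m <= N -> iteri m (fun j acc => step acc j)
    (if nth 0 I (p + N) != 0 then n else 0) =
    if digits <= N then minn n (k %/ 2 ^ (N - m)) else n.
  (* With more than [N] digits [k] is at least [n]: otherwise $k < n \le N < 2^N$. *)
  rewrite main // subnn divn1; case: leqP => // N_digits; apply/esym/minn_idPl.
  rewrite leqNgt; apply/negP => kn.
  have : digits <= N.
    apply: up_log_min => //.
    exact: leq_trans kn (leq_trans nN (ltnW (ltn_expl N (isT : 1 < 2)))).
  by rewrite leqNgt N_digits.
elim: m => [_|m IHm mN].
  rewrite /= nth_digit subn0 ltnNge; case: leqP => //= dN.
  by rewrite divn_small ?minn0 //; apply: leq_trans k_lt _; rewrite leq_pexp2l.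
rewrite iteriS (IHm (ltnW mN)) /step nth_digit addn1.
set j := N - m.+1; have jN : j < N by rewrite /j; lia.
have -> : N - m = j.+1 by rewrite /j; lia.
case: (leqP digits N) => dN; last first.
  by rewrite (ltn_trans jN dN) /=; case: ifP => //; lia.
have k_j : k %/ 2 ^ j = (k %/ 2 ^ j.+1).*2 + bit k j.
  by rewrite expnSr divnMA divn2 /bit addnC odd_double_half.
case: ltnP => [jd|dj] /=.
  rewrite k_j; move: (k %/ 2 ^ j.+1) => q; rewrite /minn.
  by case: (bit k j); case: (ltnP n q) => nq; case: ifP; case: ifP; lia.
have k0 i : digits <= i -> k %/ 2 ^ i = 0.
  by move=> di; rewrite divn_small //; apply: leq_trans k_lt _; rewrite leq_pexp2l.
by rewrite !k0 // ltnW.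
Qed.

End Instance.

(** * Running the program *)

Lemma cost_bound N c D : cmd_size c <= D -> cost N c <= D * N.+1 ^ D.
Proof.
move=> cD; apply: leq_trans (cost_poly N c) _; apply: leq_mul => //.
by rewrite leq_pexp2l.
Qed.

Lemma exec_time M c s t t' s' : exec M c s t s' -> t = t' -> exec M c s t' s'.
Proof. by move=> ex <-. Qed.

(* The parts of the program are kept abstract so that conversion never unfolds
   the compiled code. *)
Section Program.

Variables (tpar : term nat) (init step : stmt nat) (base : nat).

Definition loop : cmd :=
  While (Bin Eq (loc 17) (Cst 0)) (compile_stmt base scalars step).

(** The loop bound $4n^3$ covers the $n^3$ scan positions and, when $k < n$, the $3k + 3$ array
    entries. If $k \ge n$, deleting all vertices is a solution and no array is used. *)
Definition program : cmd :=
  Seq (Store (Cst 2) (Inp (Cst 0)))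
  (Seq (Store (Cst 0) (Bin Mul (Bin Mul (Bin Mul (Cst 4) (loc 2)) (loc 2)) (loc 2)))
  (Seq (compile base scalars tpar)
  (Seq (Store (Cst 3) (loc scalars))
  (If (Bin Lt (loc 3) (loc 2))
    (Seq (Store (Cst 1) (Bin Add (Bin Mul (Cst 3) (loc 3)) (Cst 3)))
    (Seq (compile_stmt base scalars init)
    (Seq loop (Emit (loc 18)))))
    (Emit (Cst 1)))))).

Variable M : machine.
Let W := 2 ^ word_size M.
Let I := input M.
Hypothesis rel_tpar : term_rel scalars [::] tpar tpar.
Hypothesis rel_init : stmt_rel scalars [::] init init.
Hypothesis rel_step : stmt_rel scalars [::] step step.
Hypothesis base_big : scalars < base.
Hypothesis base_aux : base <= aux_words M.
Hypothesis aux_W : aux_words M <= W.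
Hypothesis input_W : all (gtn W) I.
Hypothesis h_tpar : height scalars tpar <= base.
Hypothesis h_init : height_stmt scalars init <= base.
Hypothesis h_step : height_stmt scalars step <= base.

Let W_gt x : x <= scalars -> x < W.
Proof.
move=> xs; apply: leq_trans aux_W; apply: leq_trans base_aux.
exact: leq_ltn_trans xs base_big.
Qed.

Let aux_gt x : x <= scalars -> x < aux_words M.
Proof. by move=> xs; apply: leq_trans base_aux; apply: leq_ltn_trans xs base_big. Qed.

Let W_ge4 : 4 <= W := W_gt (isT : 3 <= scalars).

Let scalars_base : scalars <= base := ltnW base_big.

Definition store_of (m : nat -> nat) : store := (m, fun a j => m (base + a + 3 * j)).

Lemma agree_store_of m : agree scalars base (store_of m) m.
Proof. by split; move=> *; reflexivity. Qed.

Let next (s : store) : store := run W I s step.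

Let no_vars l m : bound_in scalars [::] l m.
Proof. by move=> x c; rewrite in_nil. Qed.

Lemma exec_loop s m m0 o :
    base + 3 * s.1 1 <= aux_words M -> agree scalars base s m0 -> bounded M m0 ->
    (forall j, j < m -> (iter j next s).1 17 = 0) -> (iter m next s).1 17 = 1 ->
  exists m1 t, [/\ exec M loop (m0, o) t (m1, o),
    agree scalars base (iter m next s) m1, bounded M m1 &
    t <= m * (cost (s.1 0) (compile_stmt base scalars step) + 5) + 5].
Proof.
have fixed s' : (next s').1 0 = s'.1 0 /\ (next s').1 1 = s'.1 1.
  exact: (run_fixed M rel_step s').
have ev s' m' : agree scalars base s' m' -> bounded M m' ->
    eval M m' (Bin Eq (loc 17) (Cst 0)) = Some (s'.1 17 == 0 : nat).
  move=> [cells _] bd; rewrite -[RHS]/(Some (op_sem W Eq (s'.1 17) 0)).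
  apply: (eval_op W_ge4).
  - by rewrite (eval_loc aux_W m' (aux_gt (isT : 17 <= scalars))) cells.
  - exact: eval_cst (W_gt (isT : 0 <= scalars)).
  - by rewrite -cells; first exact: bd.
  - exact: W_gt (isT : 0 <= scalars).
elim: m s m0 => [|m IHm] s m0 sa ag bd go stop.
  exists m0, 5; split=> //; apply: ExecWhileStop.
  by rewrite -[(m0, o).1]/m0 (ev s) // [s.1 17]stop.
have [m1 [t1 [ex1 ag1 _ bd1 c1]]] := compile_stmt_correct (isT : 1 < scalars)
  scalars_base aux_W W_ge4 input_W o rel_step sa (leqnn scalars) h_step ag bd
  (no_vars scalars m0).
have [s0 s1] := fixed s.
have [|||m2 [t2 [ex2 ag2 bd2 c2]]] := IHm (next s) m1 _ ag1 bd1.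
- by rewrite s1.
- by move=> j jm; rewrite -iterSr; apply: go.
- by rewrite -iterSr.
exists m2, (4 + t1 + t2).+1; split=> //.
- apply: (ExecWhileLoop (v := 1)) ex1 ex2 => //.
  by rewrite -[(m0, o).1]/m0 (ev s) // (go 0).
- by rewrite iterSr.
- by move: c1 c2; rewrite s0; lia.
Qed.

Variables (n k : nat).
Hypothesis in0 : nth 0 I 0 = n.
Let N := 4 * n * n * n.
Hypothesis N_W : N + n * n + 2 * n + 4 <= W.

Let m_start : nat -> nat := upd (upd (fun=> 0) 2 n) 0 N.

Let s_start : store := store_of m_start.

Hypothesis sem_tpar : 0 < n -> sem W I s_start tpar = minn n k.

(** The continuation [c2] is arbitrary so that both outcomes of the test share this prefix. The
    constant 24 is 4 + 12 + 4 for the three stores plus 4 for the sequencing. *)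
Lemma exec_setup o c2 : exists m1 t,
  [/\ forall t2 s2, exec M c2 (m1, o) t2 s2 ->
         exec M (Seq (Store (Cst 2) (Inp (Cst 0)))
           (Seq (Store (Cst 0) (Bin Mul (Bin Mul (Bin Mul (Cst 4) (loc 2)) (loc 2))
             (loc 2)))
           (Seq (compile base scalars tpar)
           (Seq (Store (Cst 3) (loc scalars)) c2)))) (fun=> 0, o) (t + t2) s2,
      bounded M m1, 0 < n -> m1 3 = minn n k,
      forall x, (x < scalars) || (base <= x) -> x != 3 -> m1 x = m_start x &
      t <= cost N (compile base scalars tpar) + 24].
Proof.
have n_W : n < W by move: N_W; lia.
have N_W' : N < W by move: N_W; lia.
have bd0 : bounded M (upd (fun=> 0) 2 n).
  by apply: bounded_upd => // x; apply: W_gt.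
have bd1 : bounded M m_start by apply: bounded_upd.
have ex1 : exec M (Store (Cst 2) (Inp (Cst 0))) (fun=> 0, o) 4 (upd (fun=> 0) 2 n, o).
  apply: (exec_store aux_W o (aux_gt (isT : 2 <= scalars))).
  rewrite -[LHS]/(if eval M (fun=> 0) (Cst 0) is Some i
    then Some (Defs.wrap M (nth 0 I i)) else None).
  by rewrite eval_cst ?in0 ?/Defs.wrap ?modn_small //; apply: W_gt.
have ex2 : exec M (Store (Cst 0) (Bin Mul (Bin Mul (Bin Mul (Cst 4) (loc 2)) (loc
  2)) (loc 2)))
    (upd (fun=> 0) 2 n, o) 12 (m_start, o).
  apply: (exec_store aux_W o (aux_gt (isT : 0 <= scalars))).
  have ev2 : eval M (upd (fun=> 0) 2 n) (loc 2) = Some n.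
    by rewrite (eval_loc aux_W _ (aux_gt (isT : 2 <= scalars))).
  have [a1 a2] : 4 * n < W /\ 4 * n * n < W.
    by move: N_W' n_W; rewrite /N; case: (n) => [|n'] *; split; nia.
  have N_E : N = op_sem W Mul (op_sem W Mul (op_sem W Mul 4 n) n) n.
    by rewrite /= [(4 * n) %% W]modn_small // [(4 * n * n) %% W]modn_small //
      modn_small.
  rewrite N_E; apply: (eval_op W_ge4) => //.
    apply: (eval_op W_ge4) => //.
      by apply: (eval_op W_ge4) => //; [apply: eval_cst; apply: W_gt | apply: W_gt].
    by rewrite /= modn_small.
  by rewrite /= [(4 * n) %% W]modn_small // modn_small.
have sa : base + 3 * s_start.1 1 <= aux_words M by rewrite muln0 addn0.
have [m1 [t1 [ex3 v1 sb1 bd2 c1]]] := compile_correct (isT : 1 < scalars)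
  scalars_base aux_W W_ge4 input_W o sa rel_tpar (leqnn scalars) h_tpar
  (agree_store_of m_start) bd1 (no_vars scalars m_start).
have ex4 : exec M (Store (Cst 3) (loc scalars)) (m1, o) 4 (upd m1 3 (m1 scalars), o).
  apply: (exec_store aux_W o (aux_gt (isT : 3 <= scalars))).
  exact: (eval_loc aux_W _ (aux_gt (leqnn scalars))).
exists (upd m1 3 (m1 scalars)), (t1 + 24); split.
- move=> t2 s2 ex5; apply: exec_time (ExecSeq ex1 (ExecSeq ex2 (ExecSeq ex3
    (ExecSeq ex4 ex5)))) _.
  lia.
- exact: bounded_upd.
- by move=> n0; rewrite upd_same v1; apply: sem_tpar.
- by move=> x xb x3; rewrite upd_other // sb1.
- by rewrite leq_add2r.
Qed.

Let start_cell x : x < scalars -> x != 0 -> x != 2 -> m_start x = 0.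
Proof. by move=> _ x0 x2; rewrite /m_start !upd_other. Qed.

Let start_arr x : base <= x -> m_start x = 0.
Proof.
move=> bx; have x2 : 2 < x by apply: leq_trans bx; apply: leq_trans base_big.
by rewrite /m_start !upd_other // neq_ltn ?x2 ?(ltnW (ltnW x2)) ?orbT.
Qed.

Let eval_lt m : bounded M m ->
  eval M m (Bin Lt (loc 3) (loc 2)) = Some (m 3 < m 2 : nat).
Proof.
move=> bd; rewrite -[RHS]/(Some (op_sem W Lt (m 3) (m 2))).
apply: (eval_op W_ge4); [| |exact: bd|exact: bd].
  exact: (eval_loc aux_W _ (aux_gt (isT : 3 <= scalars))).
exact: (eval_loc aux_W _ (aux_gt (isT : 2 <= scalars))).
Qed.

Lemma program_large : n <= k -> exists m t,
  exec M program (fun=> 0, [::]) t (m, [:: 1]) /\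
  t <= cost N (compile base scalars tpar) + 40.
Proof.
move=> nk; have [m1 [t1 [ex bd v3 same c1]]] := exec_setup [::]
  (If (Bin Lt (loc 3) (loc 2))
    (Seq (Store (Cst 1) (Bin Add (Bin Mul (Cst 3) (loc 3)) (Cst 3)))
    (Seq (compile_stmt base scalars init)
    (Seq loop (Emit (loc 18)))))
    (Emit (Cst 1))).
have v2 : m1 2 = n by rewrite same // /m_start upd_other // upd_same.
exists m1, (t1 + 8); split;
  last by rewrite (leq_trans (leq_add c1 (leqnn 8))) // -addnA leq_add2l.
apply: ex; apply: (@ExecIf M _ _ _ (m1, [::]) _ 2 _ (eval_lt bd)).
have -> : m1 3 < m1 2 = false.
  (* For [n = 0] the contents of cell 3 are not specified, but nothing is less than 0. *)
  rewrite v2; case: (posnP n) => [->//|n0]; rewrite v3 //.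
  by rewrite (minn_idPl nk) ltnn.
apply: (@ExecEmit M (Cst 1) m1 [::]).
exact: eval_cst (W_gt (isT : 1 <= scalars)).
Qed.

(** The hypothesis on runs isolates what the main loop computes; only steps and addresses are dealt
    with here. *)
Lemma program_small (T : nat) (Q : nat -> Prop) :
    k < n -> base + 3 * (3 * k + 3) <= aux_words M -> 3 * k + 3 < W ->
    (forall s : store, s.1 0 = N -> s.1 1 = 3 * k + 3 -> s.1 2 = n -> s.1 3 = k ->
       s.1 17 = 0 -> s.2 0 0 = 0 -> (forall j, s.2 2 j = 0) ->
       exists m ans, [/\ m <= T,
         forall j, j < m -> (iter j next (run W I s init)).1 17 = 0,
         (iter m next (run W I s init)).1 17 = 1,
         (iter m next (run W I s init)).1 18 = ans & Q ans]) ->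
  exists m t ans, [/\ exec M program (fun=> 0, [::]) t (m, [:: ans]), Q ans &
    t <= cost N (compile base scalars tpar) + cost N (compile_stmt base scalars init)
      + T * (cost N (compile_stmt base scalars step) + 5) + 60].
Proof.
move=> kn sa L_W runs; have n0 : 0 < n by apply: leq_ltn_trans kn.
have [m1 [t1 [ex bd v3 same c1]]] := exec_setup [::]
  (If (Bin Lt (loc 3) (loc 2))
    (Seq (Store (Cst 1) (Bin Add (Bin Mul (Cst 3) (loc 3)) (Cst 3)))
    (Seq (compile_stmt base scalars init)
    (Seq loop (Emit (loc 18)))))
    (Emit (Cst 1))).
have {}v3 : m1 3 = k by rewrite v3 // (minn_idPr (ltnW kn)).
have v2 : m1 2 = n by rewrite same // /m_start upd_other // upd_same.
set L := 3 * k + 3 in sa L_W runs.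
pose m2 := upd m1 1 L; pose s2 := store_of m2.
have bd2 : bounded M m2 by apply: bounded_upd.
have ex2 : exec M (Store (Cst 1) (Bin Add (Bin Mul (Cst 3) (loc 3)) (Cst 3)))
    (m1, [::]) 8 (m2, [::]).
  apply: (exec_store aux_W [::] (aux_gt (isT : 1 <= scalars))).
  have k3 : 3 * k < W by apply: leq_ltn_trans L_W; apply: leq_addr.
  rewrite (_ : L = op_sem W Add (op_sem W Mul 3 k) 3); last first.
    by rewrite /= [(3 * k) %% W]modn_small // modn_small.
  have ev3 : eval M m1 (loc 3) = Some k.
    by rewrite (eval_loc aux_W _ (aux_gt (isT : 3 <= scalars))) v3.
  have W3 : 3 < W := W_gt (isT : 3 <= scalars).
  apply: (eval_op W_ge4); [|exact: eval_cst| |exact: W3].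
    apply: (eval_op W_ge4); [exact: eval_cst|exact: ev3|exact: W3|].
    by rewrite -v3; apply: bd.
  by rewrite /= modn_small.
have sa2 : base + 3 * s2.1 1 <= aux_words M by [].
have [m3 [t3 [ex3 ag3 _ bd3 c3]]] := compile_stmt_correct (isT : 1 < scalars)
  scalars_base aux_W W_ge4 input_W [::] rel_init sa2 (leqnn scalars) h_init
  (agree_store_of m2) bd2 (no_vars scalars m2).
have m2_other x : (x < scalars) || (base <= x) -> x != 1 -> x != 3 -> m2 x = m_start x.
  by move=> xb x1 x3; rewrite /m2 upd_other // same.
have m2_arr x : base <= x -> m2 x = 0.
  move=> bx; have x3 : 3 < x by apply: leq_trans bx; apply: leq_trans base_big.
  rewrite m2_other ?start_arr ?bx ?orbT // neq_ltn ?x3 ?orbT //.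
  by rewrite (leq_ltn_trans _ x3) ?orbT.
have [||||||| m [ans [mT go stop ans_m Qans]]] := runs s2.
- by rewrite /= m2_other.
- by [].
- by rewrite /= m2_other // /m_start upd_other // upd_same.
- by rewrite /= /m2 upd_other.
- by rewrite /= m2_other // start_cell.
- by rewrite /= m2_arr // addn0 leq_addr.
- by move=> j; rewrite /= m2_arr // -addnA leq_addr.
have [f0 f1] := run_fixed M rel_init s2.
have sa3 : base + 3 * (run W I s2 init).1 1 <= aux_words M by rewrite f1.
have [m4 [t4 [ex4 ag4 bd4 c4]]] := exec_loop [::] sa3 ag3 bd3 go stop.
exists m4, (t1 + (5 + (8 + (t3 + (t4 + 3).+1).+1).+1).+1), ans; split=> //.
  apply: ex; apply: (@ExecIf M _ _ _ (m1, [::]) _ _ _ (eval_lt bd)).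
  rewrite v3 v2 kn; apply: ExecSeq ex2 _; apply: ExecSeq ex3 _; apply: ExecSeq ex4 _.
  apply: (@ExecEmit M (loc 18) m4 [::]).
  rewrite (eval_loc aux_W _ (aux_gt (isT : 18 <= scalars))).
  by case: ag4 => cells _; rewrite cells ?ans_m.
have s20 : s2.1 0 = N by rewrite /= m2_other.
move: c1 c3 c4; rewrite f0 s20.
move: (cost N _) (cost N _) (cost N _) => x y z.
have : m * (x + 5) <= T * (x + 5) by rewrite leq_mul2r mT orbT.
by clear; lia.
Qed.

End Program.

(** * Bounds *)

(** $2^{3k+3} = 8 \cdot 8^k$ and $8^k \le 3 (3k)^k$. The factor 3 serves $k = 1$ and $k = 2$; from
    $k = 3$ on, $8 \le 3k$. *)
Lemma guesses_bound k : 2 ^ (3 * k + 3) <= 24 * (3 * k) ^ k.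
Proof.
have -> : 2 ^ (3 * k + 3) = 8 * 8 ^ k by rewrite expnD expnM mulnC.
have : 8 ^ k <= 3 * (3 * k) ^ k.
  case: k => [|[|[|k]]] //; apply: leq_trans (leq_pmull _ _) => //.
  by rewrite leq_exp2r //; lia.
lia.
Qed.

Lemma leq_exp2r_weak m n e : m <= n -> m ^ e <= n ^ e.
Proof. by case: e => // e mn; rewrite leq_exp2r. Qed.

Lemma lg_bound n : n <= 2 ^ lg n.
Proof.
by apply: leq_trans (up_logP n (isT : 1 < 2)) _; rewrite leq_pexp2l // leq_maxr.
Qed.

(** With $y = 2^{lg(n)} \ge 2$, the factor $y^{base}$ exceeds [base] and $y^8 \ge 32 y^3$ dominates
    the cubic polynomial. *)
Lemma word_bound base n :
  base + (4 * n * n * n + n * n + 20 * n + 20) <= 2 ^ ((base + 8) * lg n).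
Proof.
set y := 2 ^ lg n.
have -> : 2 ^ ((base + 8) * lg n) = y ^ base * y ^ 8.
  by rewrite mulnC expnM expnD.
have y2 : 2 <= y by rewrite -[leqLHS]expn1 leq_pexp2l // leq_maxl.
have ny : n <= y := lg_bound n.
have y_base : base < y ^ base.
  by apply: leq_trans (ltn_expl base (isT : 1 < 2)) _; apply: leq_exp2r_weak.
have y8 : 4 * n * n * n + n * n + 20 * n + 20 <= y ^ 8.
  apply: (@leq_trans (4 * y * y * y + y * y + 20 * y + 20)).
    by rewrite leq_add2r !leq_add // !leq_mul.
  have y3 : y ^ 3 = y * y * y by rewrite !expnSr expn0 mul1n.
  have y5 : 32 <= y ^ 5 by apply: (@leq_trans (2 ^ 5)); last exact: leq_exp2r_weak.
  rewrite (expnD y 5 3) y3; apply: (@leq_trans (32 * (y * y * y))).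
    by move: y2; clear; nia.
  by rewrite leq_mul2r y5 orbT.
have p0 : 0 < y ^ 8 by rewrite expn_gt0 (leq_trans _ y2).
apply: (@leq_trans (base.+1 * y ^ 8)); last by rewrite leq_mul2r y_base orbT.
by rewrite mulSn addnC leq_add // leq_pmulr.
Qed.

(** 26 = 2 + 24: two set-up terms and the 24 of [guesses_bound]. 180 = 24 * 5 + 60. The power of 5
    comes from $4n^3 + 1 \le 5 \max(n,1)^3$. *)
Lemma time_bound D N n k t :
  N = 4 * n * n * n ->
  t <= 2 * (D * N.+1 ^ D) + n * 2 ^ (3 * k + 3) * (D * N.+1 ^ D + 5) + 60 ->
  t <= (26 * (D * 5 ^ D) + 180) * (3 * k) ^ k * maxn n 1 ^ (3 * D + 1).
Proof.
move=> N_def; set y := maxn n 1; have y1 : 0 < y by rewrite leq_max orbT.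
have ny : n <= y by rewrite leq_maxl.
have : N.+1 ^ D <= 5 ^ D * y ^ (3 * D).
  rewrite (expnM y 3) -expnMn leq_exp2r_weak //.
  by rewrite N_def /y; case: (n) => // n'; rewrite (maxn_idPl _) // !expnS expn0; nia.
have B1 : 0 < (3 * k) ^ k by rewrite expn_gt0; case: (k).
have Y1 : 0 < y ^ (3 * D) by rewrite expn_gt0 y1.
have := guesses_bound k; rewrite (_ : y ^ (3 * D + 1) = y * y ^ (3 * D));
  last by rewrite addn1 expnS.
move: ((3 * k) ^ k) B1 (y ^ (3 * D)) Y1 (5 ^ D) (N.+1 ^ D) (2 ^ _) => B B1 Y Y1 F X
  G GB XB tb.
set F5 := D * F; have DX : D * X <= F5 * Y by rewrite /F5 -mulnA leq_mul2l XB orbT.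
have Y_le : Y <= B * (y * Y) by rewrite mulnA leq_pmull // muln_gt0 B1.
have t1 : D * X <= F5 * (B * (y * Y)).
  by apply: leq_trans DX _; rewrite leq_mul2l Y_le orbT.
have t2 : n * G * (D * X + 5) <= 24 * (B * (y * Y)) * (F5 + 5).
  apply: (@leq_trans (y * (24 * B) * (F5 * Y + 5 * Y))).
    by apply: leq_mul; [apply: leq_mul | apply: leq_add => //; nia].
  by rewrite -mulnDl; nia.
have : 60 <= 60 * (B * (y * Y)) by rewrite leq_pmulr // !muln_gt0 B1 y1.
move: tb t1 t2; rewrite -(mulnA _ B); move: (B * (y * Y)) => Z.
by move: (D * X) (n * G * _) => u v; nia.
Qed.

Lemma common_bound a b c d : exists m, [/\ a < m, b <= m, c <= m & d <= m].
Proof.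
by exists (maxn a.+1 (maxn b (maxn c d))); rewrite !leq_max !leqnn !orbT.
Qed.

Section Correct.

Variables (base n : nat) (e : rel 'I_n) (k : nat).
Hypotheses (e_sym : symmetric e) (e_irr : irreflexive e).

Let W := 2 ^ ((base + 8) * lg n).
Let I := fvs_input e k.
Let N := 4 * n * n * n.
Let L := 3 * k + 3.

Let W_big : base + (4 * n * n * n + n * n + 20 * n + 20) <= W := word_bound base n.

Lemma init_ready (s : store) : k < n ->
    s.1 0 = N -> s.1 1 = L -> s.1 2 = n -> s.1 3 = k -> s.1 17 = 0 ->
    s.2 0 0 = 0 -> (forall j, s.2 2 j = 0) ->
  ready N L n k (run W I s (sinit nat)) 1 [:: 0] /\ has_guess L (run W I s (sinit
    nat)) 0.
Proof.
move=> kn s0 s1 s2 s3 s17 a0 a2; split.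
  have c x : x != 4 -> x != 5 -> (run W I s (sinit nat)).1 x = s.1 x.
    by move=> x4 x5; rewrite run_then 2!run_assign !set_cell_other.
  split; try by rewrite c.
  - by [].
  - by [].
  - by rewrite /mkseq /= a0.
  - by rewrite /L addn3.
  - exact: leq_ltn_trans kn.
move=> j; rewrite run_then 2!run_assign -[(set_cell _ _ _).2]/s.2 a2 andbF.
by rewrite /guess /bit div0n andbF.
Qed.

Lemma run_all (s : store) : k < n ->
    s.1 0 = N -> s.1 1 = L -> s.1 2 = n -> s.1 3 = k -> s.1 17 = 0 ->
    s.2 0 0 = 0 -> (forall j, s.2 2 j = 0) ->
  exists m ans, [/\ m <= n * 2 ^ L,
    forall j, j < m -> (iter j (fun s => run W I s (sstep nat)) (run W I s (sinit
      nat))).1 17 = 0,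
    (iter m (fun s => run W I s (sstep nat)) (run W I s (sinit nat))).1 17 = 1,
    (iter m (fun s => run W I s (sstep nat)) (run W I s (sinit nat))).1 18 = ans &
    exists2 b : bool, ans = b & b <-> has_fvs e k].
Proof.
move=> kn s0 s1 s2 s3 s17 a0 a2; have n0 : 0 < n by apply: leq_ltn_trans kn.
have [r g] := init_ready kn s0 s1 s2 s3 s17 a0 a2.
have nnN : n * n * n <= N by rewrite /N -!mulnA leq_pmull.
have W_N : N + n + 2 <= W by move: W_big; rewrite /N; lia.
have L_N : L <= N by move: kn; rewrite /L /N; nia.
have val : valid I n k 1 [:: 0].
  split=> //; case=> [|x p] //= /andP[/andP[]].
  by rewrite ltnS leqn0 inE => ->.
have ref : refuted I N L n k 1 [:: 0] 0 by [].
have [m [mT go stop ans]] := run_steps n0 nnN W_N (erefl L) L_N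
  (edge_sym k e_sym) (edge_irr k e_irr) r g val ref (expn_gt0 2 L : 0 < 2 ^ L).
exists m, ((iter m (fun s => run W I s (sstep nat)) (run W I s (sinit nat))).1 18).
split=> //.
  apply: leq_trans mT _; rewrite subn0 -[X in _ + X]mul1n -mulnDl.
  by rewrite leq_mul2r subnK ?leqnn ?orbT.
case: ans => [[-> sol]|[-> nsol]]; [exists true | exists false] => //.
  by split=> // _; apply/solvable_fvs.
by split=> // /solvable_fvs.
Qed.

Lemma sem_start : 0 < n -> sem W I
    (store_of base (upd (upd (fun=> 0) 2 n) 0 N)) (tparameter nat) = minn n k.
Proof.
move=> n0; set s0 := store_of _ _.
have [s00 s02] : s0.1 0 = N /\ s0.1 2 = n by split.
have nnN : n * n <= N by rewrite /N -[leqLHS]mul1n -!mulnA leq_mul // leq_mul //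
  leq_pmulr.
apply: (sem_tparameter e k n0 s02); rewrite ?s00.
- exact: nnN.
- by apply: leq_trans nnN; rewrite leq_pmulr.
- by apply: leq_trans W_big; rewrite /N; clear; lia.
- by apply: leq_trans W_big; clear; lia.
Qed.

(** 18 comes from $9q + 9 \le 18q$ for $q \ge 1$. *)
Lemma space_bound p :
  (base + 3 * (3 * (if k < n then k else 0) + 3) + p) * ((base + 8) * lg n) <=
  (base + 18 + p) * (base + 8) * maxn k 1 * lg n.
Proof.
rewrite mulnA leq_mul2r; apply/orP; right.
rewrite -mulnA [(base + 8) * _]mulnC mulnA leq_mul2r; apply/orP; right.
have : (if k < n then k else 0) <= maxn k 1.
  by case: ifP; rewrite leq_max ?leqnn.
have : 1 <= maxn k 1 by rewrite leq_max orbT.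
by move: (maxn k 1) (if _ then _ else _) => q k'; clear; nia.
Qed.

End Correct.

(* One program and four constants serve all instances: words have cw * lg n bits,
   the time is ct * (3k)^k * n^d and the space cs * k * lg n bits. The two maxn
   matter only in the degenerate cases n = 0 and k = 0. *)
Theorem theorem5 :
  exists (P : cmd) (cw ct d cs : nat),
  forall (n : nat) (e : rel 'I_n) (k : nat),
    symmetric e -> irreflexive e ->
    exists (s t : nat) (b : bool),
      let M := Machine (cw * lg n) s (fvs_input e k) in
      [/\ outputs_in_time M P [:: b : nat] t,
          b <-> has_fvs e k,
          t <= ct * (3 * k) ^ k * maxn n 1 ^ d
        & aux_bits M P <= cs * maxn k 1 * lg n].
Proof.
(* [base] is only known to be large enough, so the heights of the program parts need not be
   evaluated. *)
have [base [base_big h1 h2 h3]] := common_bound scalars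
  (height scalars (tparameter nat)) (height_stmt scalars (sinit nat))
  (height_stmt scalars (sstep nat)).
pose P := program (tparameter nat) (sinit nat) (sstep nat) base.
pose c1 := compile base scalars (tparameter nat).
pose c2 := compile_stmt base scalars (sinit nat).
pose c3 := compile_stmt base scalars (sstep nat).
pose D := cmd_size c1 + cmd_size c2 + cmd_size c3.
exists P, (base + 8), (26 * (D * 5 ^ D) + 180), (3 * D + 1),
  ((base + 18 + cmd_size P) * (base + 8)).
move=> n e k e_sym e_irr; set I := fvs_input e k.
have W_big := word_bound base n.
(* For $k \ge n$ no array is used, and a memory of size proportional to [k] might exceed the range
   of addresses. *)
pose k' := if k < n then k else 0.
pose M := Machine ((base + 8) * lg n) (base + 3 * (3 * k' + 3)) I.
have k'n : 3 * (3 * k' + 3) <= 9 * n + 9 by rewrite /k'; case: ltnP => ?; lia.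
have base_aux : base <= aux_words M by rewrite leq_addr.
have aux_W : aux_words M <= 2 ^ word_size M.
  by apply: leq_trans W_big; rewrite /=; lia.
have in_W : all (gtn (2 ^ word_size M)) (input M).
  by apply: input_small; apply: leq_trans W_big; lia.
pose N := 4 * n * n * n.
have N_W : N + n * n + 2 * n + 4 <= 2 ^ word_size M.
  by apply: leq_trans W_big; rewrite /N; lia.
have cost_le c : cmd_size c <= D -> cost N c <= D * N.+1 ^ D by apply: cost_bound.
have [le1 le2 le3] : [/\ cost N c1 <= D * N.+1 ^ D, cost N c2 <= D * N.+1 ^ D &
    cost N c3 <= D * N.+1 ^ D].
  by split; apply: cost_le; rewrite /D; lia.
have sem_par := sem_start base e k.
have space := space_bound base n k (cmd_size P).
case: (leqP n k) => kn.
  have [m [t [ex tb]]] :=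
    program_large rel_parameter base_big base_aux aux_W in_W h1 h2 h3
    (erefl n : nth 0 (input M) 0 = n) N_W sem_par kn.
  exists (aux_words M), t, true; split; [by exists m | | | exact: space].
    by split=> _; [apply: has_fvs_trivial | exact: isT].
  apply: (time_bound (erefl N)); apply: leq_trans tb _.
  apply: leq_trans (leq_add le1 (leqnn 40)) _.
  by move: (D * N.+1 ^ D) => u; clear; lia.
have def_k' : k' = k by rewrite /k' kn.
have sa : base + 3 * (3 * k + 3) <= aux_words M.
  by rewrite [aux_words M]/= def_k'; exact: leqnn.
have L_W : 3 * k + 3 < 2 ^ word_size M.
  by apply: leq_trans W_big; move: kn; clear; lia.
have [m [t [ans [ex [b ansE bE] tb]]]] := program_small rel_parameter rel_init rel_step
  base_big base_aux aux_W in_W h1 h2 h3 (erefl n : nth 0 (input M) 0 = n) N_W sem_par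
  kn sa L_W (fun s => run_all base e_sym e_irr kn).
exists (aux_words M), t, b; split; [by rewrite -ansE;
  exists m | exact: bE | | exact: space].
apply: (time_bound (erefl N)); apply: leq_trans tb _.
apply: leq_add; last exact: leqnn; apply: leq_add.
  by rewrite mul2n -addnn; apply: leq_add; [exact: le1 | exact: le2].
by apply: leq_mul; [exact: leqnn | rewrite leq_add2r; exact: le3].
Qed.
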